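(* Consider a metric $k$-DOAT instance $\langle T, c\rangle$ with $n$ vertices and $k = O\big(\sqrt{n/\log n}\big)$. Run Gonzalez algorithm on the tree $T$ (edge costs given by $c$) with $h = k+1$ to obtain vertices $x_1,\ldots,x_{k+1}$, and output $S = \{(x_1,x_i) : 2\le i\le k+1\}$. This algorithm runs in $O(n)$ time and $S$ is a $4$-approximate solution, i.e., $\mathrm{diam}(T+S) \le 4\,\mathrm{diam}(T+S^* )$ where $S^*$ is an optimal set of $k$ shortcuts.
   Context: An instance of $k$-DOAT is a pair $\langle T, c\rangle$ where $T$ is a tree on $n$ vertices and $c$ assigns a non-negative cost $c(u,v)$ to every pair of distinct vertices $u,v$ (tree edges included); $c$ is accessed through an oracle returning $c(u,v)$ in constant time. A shortcut is a pair of distinct vertices; for a set $S$ of shortcuts, $T+S$ is $T$ plus the edges of $S$, each edge $(u,v)$ with cost $c(u,v)$. $\mathrm{diam}(G)=\max_{u,v} d_G(u,v)$ with $d_G$ the shortest-path distance. An optimal solution $S^*$ is a set of $k$ shortcuts minimizing $\mathrm{diam}(T+S^* )$. The instance is metric if $c(u,v)\le c(u,w)+c(w,v)$ for all distinct $u,v,w$. Gonzalez algorithm on a graph $G$ with non-negative edge costs and integer $h$ picks an arbitrary vertex $x_1$ and, for $i<h$, picks $x_{i+1}\in\arg\max_{v\in V(G)}\min_{1\le j\le i} d_G(v,x_j)$. *)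

(* Defs.v *)
From mathcomp Require Import all_boot all_order all_algebra.
From mathcomp Require Import boolp classical_sets reals.
Set Implicit Arguments.
Unset Strict Implicit.
Unset Printing Implicit Defensive.
Import Order.TTheory GRing.Theory Num.Theory.

Local Open Scope ring_scope.

Section Graphs.
Variables (R : realType) (V : finType).

(* An acyclic graph has no simple closed walk through three or more vertices;
   [:: u; v] is a ucycle as soon as uv is an edge. *)
Record is_tree (T : rel V) : Prop := IsTree {
  tree_sym : symmetric T;
  tree_irr : irreflexive T;
  tree_connected : forall u v, connect T u v;
  tree_acyclic : forall s : seq V, ucycle T s -> (size s <= 2)%N }.

(* The diagonal of c is unconstrained and never contributes to a cost. *)
Record metric_instance (T : rel V) (c : V -> V -> R) : Prop := MetricInstance {
  instance_tree : is_tree T;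
  cost_sym : forall u v, u != v -> c u v = c v u;
  cost_ge0 : forall u v, u != v -> 0 <= c u v;
  cost_triangle : forall u v w, u != v -> u != w -> w != v ->
    c u v <= c u w + c w v }.

Fixpoint walk_cost (c : V -> V -> R) (u : V) (p : seq V) : R :=
  if p is w :: p' then c u w + walk_cost c w p' else 0.

(* The infimum over walks is a minimum: with non-negative costs, removing loops
   leaves only the finitely many simple paths. *)
Definition dist (E : rel V) (c : V -> V -> R) (u v : V) : R :=
  inf [set r | exists p : seq V,
         [/\ path E u p, last u p = v & r = walk_cost c u p]].

Definition diam (E : rel V) (c : V -> V -> R) : R :=
  \big[Num.max/0]_(uv : V * V) dist E c uv.1 uv.2.

(* A shortcut is an unordered pair of distinct vertices, i.e. a 2-subset of V. *)
Definition shortcuts (S : {set {set V}}) : Prop :=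
  forall e, e \in S -> #|e| = 2%N.

Definition augment (T : rel V) (S : {set {set V}}) : rel V :=
  [rel u v | T u v || ([set u; v] \in S)].

Definition feasible (k : nat) (S : {set {set V}}) : Prop :=
  shortcuts S /\ #|S| = k.

Definition optimal (T : rel V) (c : V -> V -> R) (k : nat)
    (S : {set {set V}}) : Prop :=
  feasible k S /\
  forall S', feasible k S' -> diam (augment T S) c <= diam (augment T S') c.

Section Gonzalez.
Variables (E : rel V) (c : V -> V -> R) (m : nat) (x : 'I_m.+1 -> V).

(* Distance from v to the first i picks, for 0 < i. *)
Definition dist_to_first (i : nat) (v : V) : R :=
  \big[Num.min/dist E c v (x ord0)]_(j < m.+1 | (j < i)%N) dist E c v (x j).

(* x is the outcome of some run with h = m.+1, under arbitrary choices of the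
   first vertex and of the maximizers. *)
Definition gonzalez : Prop :=
  forall i : 'I_m.+1, (0 < i)%N ->
  forall v, dist_to_first i v <= dist_to_first i (x i).

End Gonzalez.

(* When every vertex is at distance 0 from the previous picks, the first vertex
   may be picked again; the resulting loop is not a shortcut and is dropped. *)
Definition star (m : nat) (x : 'I_m.+1 -> V) : {set {set V}} :=
  [set [set x ord0; x i] | i : 'I_m.+1 & x i != x ord0].

End Graphs.

(* Running time is measured on a word RAM extended with registers and arrays
   holding exact costs, on which only addition, subtraction and comparison are
   available, together with the oracle for c.  Programs are closed syntax and do
   not depend on the instance.  Variables and arrays are named by the naturals
   occurring in the program text, hence each program has finitely many. *)
Inductive wexp :=
  | WConst of nat
  | WVar of nat
  | WGet of nat & wexp          (* array name, index *)
  | WAdd of wexp & wexp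
  | WSub of wexp & wexp         (* truncated at 0 *)
  | WMul of wexp & wexp
  | WDiv of wexp & wexp
  | WMod of wexp & wexp.

Inductive cexp :=
  | CZero
  | CVar of nat
  | CGet of nat & wexp
  | COracle of wexp & wexp
  | CAdd of cexp & cexp
  | CSub of cexp & cexp.

Inductive bexp :=
  | BWEq of wexp & wexp
  | BWLt of wexp & wexp
  | BCLe of cexp & cexp
  | BNot of bexp
  | BAnd of bexp & bexp.

Inductive cmd :=
  | Skip
  | WSet of nat & wexp
  | WPut of nat & wexp & wexp   (* array name, index, value *)
  | CSet of nat & cexp
  | CPut of nat & wexp & cexp
  | Seq of cmd & cmd
  | If of bexp & cmd & cmd
  | While of bexp & cmd.

Section Machine.
Variable R : realType.

Record state := State {
  wvar : nat -> nat;
  warr : nat -> nat -> nat;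
  cvar : nat -> R;
  carr : nat -> nat -> R }.

Definition upd (A : Type) (f : nat -> A) (i : nat) (a : A) : nat -> A :=
  fun j => if j == i then a else f j.

Variables (W : nat) (orc : nat -> nat -> R).

(* Words are the naturals below W; operations that may overflow wrap around. *)
Fixpoint weval (s : state) (e : wexp) : nat :=
  match e with
  | WConst m => m %% W
  | WVar x => wvar s x
  | WGet a e1 => warr s a (weval s e1)
  | WAdd e1 e2 => (weval s e1 + weval s e2) %% W
  | WSub e1 e2 => weval s e1 - weval s e2
  | WMul e1 e2 => (weval s e1 * weval s e2) %% W
  | WDiv e1 e2 => weval s e1 %/ weval s e2
  | WMod e1 e2 => weval s e1 %% weval s e2
  end%N.

Fixpoint ceval (s : state) (e : cexp) : R :=
  match e with
  | CZero => 0
  | CVar x => cvar s x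
  | CGet a e1 => carr s a (weval s e1)
  | COracle e1 e2 => orc (weval s e1) (weval s e2)
  | CAdd e1 e2 => ceval s e1 + ceval s e2
  | CSub e1 e2 => ceval s e1 - ceval s e2
  end.

Fixpoint beval (s : state) (b : bexp) : bool :=
  match b with
  | BWEq e1 e2 => weval s e1 == weval s e2
  | BWLt e1 e2 => (weval s e1 < weval s e2)%N
  | BCLe e1 e2 => ceval s e1 <= ceval s e2
  | BNot b1 => ~~ beval s b1
  | BAnd b1 b2 => beval s b1 && beval s b2
  end.

Definition set_wvar s x n := State (upd (wvar s) x n) (warr s) (cvar s) (carr s).
Definition set_warr s a i n :=
  State (wvar s) (upd (warr s) a (upd (warr s a) i n)) (cvar s) (carr s).
Definition set_cvar s x r := State (wvar s) (warr s) (upd (cvar s) x r) (carr s).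
Definition set_carr s a i r :=
  State (wvar s) (warr s) (cvar s) (upd (carr s) a (upd (carr s a) i r)).

(* exec p s t s' : started in s, program p halts in s' after t steps.  Every
   command and every evaluation of a test is one step; expressions have sizes
   fixed by the program text, so charging each of their operations separately
   would change t by at most a factor depending on the program only. *)
Inductive exec : cmd -> state -> nat -> state -> Prop :=
  | ExecSkip s : exec Skip s 1 s
  | ExecWSet x e s : exec (WSet x e) s 1 (set_wvar s x (weval s e))
  | ExecWPut a e1 e2 s :
      exec (WPut a e1 e2) s 1 (set_warr s a (weval s e1) (weval s e2))
  | ExecCSet x e s : exec (CSet x e) s 1 (set_cvar s x (ceval s e))
  | ExecCPut a e1 e2 s :
      exec (CPut a e1 e2) s 1 (set_carr s a (weval s e1) (ceval s e2))
  | ExecSeq p q s t s' t' s'' :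
      exec p s t s' -> exec q s' t' s'' -> exec (Seq p q) s (t + t')%N s''
  | ExecIfT b p q s t s' :
      beval s b -> exec p s t s' -> exec (If b p q) s t.+1 s'
  | ExecIfF b p q s t s' :
      ~~ beval s b -> exec q s t s' -> exec (If b p q) s t.+1 s'
  | ExecWhileT b p s t s' t' s'' :
      beval s b -> exec p s t s' -> exec (While b p) s' t' s'' ->
      exec (While b p) s (t + t').+1 s''
  | ExecWhileF b p s : ~~ beval s b -> exec (While b p) s 1 s.

End Machine.

Section InputOutput.
Variables (R : realType) (n : nat).

(* adj v lists the neighbours of v, in an arbitrary order. *)
Definition adjacency_lists (T : rel 'I_n) (adj : 'I_n -> seq 'I_n) : Prop :=
  forall v, perm_eq (adj v) (enum [pred w | T v w]).

Definition oracle (c : 'I_n -> 'I_n -> R) (i j : nat) : R :=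
  if (insub i, insub j) is (Some u, Some v) then c u v else 0.

(* Words of b * log2 (n + k + 2) bits. *)
Definition word_bound (k b : nat) : nat := ((n + k + 2) ^ b)%N.

(* Variables 0, 1, 2 hold n, k and the first vertex; array 1 holds the
   concatenation of the adjacency lists and array 0 their offsets: the neighbours
   of v occupy the positions i of array 1 with array0[v] <= i < array0[v + 1].
   Everything else is 0. *)
Definition input_state (k : nat) (adj : 'I_n -> seq 'I_n) (x1 : 'I_n) : state R :=
  let lists := [seq adj v | v <- enum 'I_n] in
  let offsets := [seq sumn (take i (shape lists)) | i <- iota 0 n.+1] in
  let targets := [seq val w | w <- flatten lists] in
  State (nth 0%N [:: n; k; val x1])
        (fun a => nth 0%N (nth [::] [:: offsets; targets] a))
        (fun=> 0) (fun=> fun=> 0).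

(* The pairs (x_1, x_i), 2 <= i <= k + 1, in order: first components in array 2,
   second components in array 3.  Since x is indexed from 0, the l-th pair is
   (x ord0, x l). *)
Definition outputs (k : nat) (s : state R) (x : 'I_k.+1 -> 'I_n) : Prop :=
  forall l : 'I_k.+1, (0 < l)%N ->
    warr s 2 l.-1 = x ord0 /\ warr s 3 l.-1 = x l.

End InputOutput.

(* Main.v *)
Require Import Defs.
From mathcomp Require Import all_boot all_order all_algebra.
From mathcomp Require Import reals exp.
From mathcomp Require boolp.
From mathcomp Require Import zify ring lra.
Set Implicit Arguments.
Unset Strict Implicit.
Unset Printing Implicit Defensive.
Import Order.TTheory GRing.Theory Num.Theory.
Local Open Scope ring_scope.

(* Approximation. Let u be a vertex at distance r > 0 from {x_1, ..., x_{k+1}}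
   in T; by the greedy rule these k+2 points are at pairwise distance at least
   r. Assign every vertex to a nearest point; k shortcuts induce k links between
   the points, and merging linked points leaves two classes with more points
   than shortcuts. Inside the zone of each class (the union of the cells of its
   points), some point has distance at least r/2 to the boundary of the zone
   even with shortcuts, because the last shortcut on a nearly shortest walk from
   the boundary can serve only one point. So two such points are at distance at
   least r in T+S for every S with k shortcuts, and r <= diam (T+S). From any
   vertex one then reaches any other through x_i, x_1 and x_j with suitable i, j,
   each leg costing at most diam (T+S); the two middle ones by the triangle
   inequality for c.

   Running time. Breadth-first search numbers the vertices, and chaining
   siblings through nodes at distance 0 makes the tree binary. The active nodes
   are those on the paths from the root to the picks, each prolonged to a
   deepest leaf; every other node hangs from an active one by a subtree whose
   height is known, so that the farthest vertex maximizes, over the active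
   positions, the distance to the picks plus this height. The active nodes are
   cut into O(k) vertical paths of at most (k+1)(L+1) positions, where L = O(log
   n). Along such a path the distance to the picks is determined by its values
   just above and at the bottom, and is the minimum of an increasing and of a
   decreasing function of the depth; a binary search finds where they cross, and
   prefix and suffix maxima computed once per path give the best position. A
   round thus costs O(k L), apart from the O(1) amortized work per activated
   node and the recomputation of the O(1) paths that are split. In total this is
   O(n + k^2 L) = O(n). *)

(** * Walks and distances *)

(** Costs equal to 0 obstruct the lower bound: nearly shortest walks may cross a free shortcut in
    both directions, and it can then not be charged to a single point. All costs are therefore
    raised by a small [eta], which gives the last shortcut of such a walk a definite direction;
    [eta] disappears at the end because walks without loops have fewer than [#|V|] edges.

    In the program, a new pick may change the distance to the picks at every active position, so
    these distances are not maintained. Only the bottoms of the vertical paths carry a value. A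
    climb from the new pick repairs the values at the bottoms above it; the others may stay too
    large until the pass of the next round relaxes them through the parent path, and one sweep
    suffices because upper paths are listed before lower ones. Inside a path all distances follow
    from the values at its two ends. The farthest vertex is first known only as a height below an
    active position; its nodes are activated once it has been selected, by following children of
    greatest height. *)

Section Walks.
Context {R : realType} {V : finType}.
Implicit Types (E : rel V) (c : V -> V -> R) (u v w : V) (p : seq V).

Lemma walk_cost_cat c u p q :
  walk_cost c u (p ++ q) = walk_cost c u p + walk_cost c (last u p) q.
Proof. by elim: p u => [|w p IHp] u /=; rewrite ?add0r // IHp addrA. Qed.

Lemma walk_cost_ge0 E c : (forall u v, E u v -> 0 <= c u v) ->
  forall u p, path E u p -> 0 <= walk_cost c u p.
Proof.
move=> c_ge0 u p; elim: p u => [|w p IHp] u //= /andP[Euw Ep].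
by rewrite addr_ge0 ?c_ge0 ?IHp.
Qed.

(** The bound on the number of edges is what allows all costs to be raised by a small constant at a
    controlled price. *)
Lemma short_walk E c : (forall u v, E u v -> 0 <= c u v) ->
  forall u p, path E u p -> exists q, [/\ path E u q, last u q = last u p,
    (size q < #|V|)%N & walk_cost c u q <= walk_cost c u p].
Proof.
move=> c_ge0 u p Ep.
suff [q [Eq lq uq cq]] : exists q, [/\ path E u q, last u q = last u p,
    uniq (u :: q) & walk_cost c u q <= walk_cost c u p].
  by exists q; split=> //; rewrite -[(size q).+1](card_uniqP uq) max_card.
elim: p u Ep => [|w p IHp] u /=; first by exists [::].
case/andP=> Euw /IHp [q [Eq lq uq cq]].
case: (boolP (u \in w :: q)) => [uinq | uninq]; last first.
  exists (w :: q); split => //=; first by rewrite Euw.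
  - by move: uninq uq => /= -> .
  - by rewrite lerD2l.
case/splitPl: q / uinq Eq lq uq cq => q1 q2 lq1.
rewrite cat_path last_cat lq1 walk_cost_cat -cat_cons cat_uniq lq1.
case/andP=> Eq1 Eq2 lq2 /and3P[_ uq1 uq2] cq; exists q2; split => //=.
- rewrite uq2 andbT; apply: contra uq1 => uq2'.
  by apply/hasP; exists u => //; rewrite -lq1 mem_last.
- apply: le_trans (ler_wpDl (c_ge0 _ _ Euw) (lexx _)).
  by apply: le_trans cq; rewrite ler_wpDl // (walk_cost_ge0 c_ge0).
Qed.

Section Dist.
Variables (E : rel V) (c : V -> V -> R).
Hypothesis E_conn : forall u v, connect E u v.
Hypothesis c_ge0 : forall u v, E u v -> 0 <= c u v.

(** Together with [dist_le] this is the only access to the infimum, so that no shortest walk ever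
    has to be exhibited. *)
Lemma le_dist r u v :
  (forall p, path E u p -> last u p = v -> r <= walk_cost c u p) ->
  r <= dist E c u v.
Proof.
move=> le_r; apply: lb_le_inf => [|x [p [Ep lp ->]]]; last exact: le_r.
by have /connectP[p Ep lp] := E_conn u v; exists (walk_cost c u p), p.
Qed.

Lemma dist_le u v p :
  path E u p -> last u p = v -> dist E c u v <= walk_cost c u p.
Proof.
move=> Ep lp; apply: ge_inf; last by exists p.
by exists 0 => x [q [Eq _ ->]]; apply: walk_cost_ge0 Eq.
Qed.

Lemma dist_ge0 u v : 0 <= dist E c u v.
Proof. by apply: le_dist => p Ep _; apply: walk_cost_ge0 Ep. Qed.

Lemma distxx u : dist E c u u = 0.
Proof. by apply/le_anti; rewrite dist_ge0 andbT (@dist_le u u [::]). Qed.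

Lemma dist_triangle v u w : dist E c u w <= dist E c u v + dist E c v w.
Proof.
rewrite -lerBlDr; apply: le_dist => p Ep lp.
rewrite lerBlDr -lerBlDl; apply: le_dist => q Eq lq.
rewrite lerBlDl -[v in walk_cost c v q]lp -walk_cost_cat; apply: dist_le.
  by rewrite cat_path Ep lp.
by rewrite last_cat lp.
Qed.

Lemma dist_edge u v : E u v -> dist E c u v <= c u v.
Proof. by move=> Euv; have := @dist_le u v [:: v]; rewrite /= Euv addr0; exact. Qed.

Lemma walk_cost_rev : symmetric E -> (forall u v, E u v -> c u v = c v u) ->
  forall u p, path E u p -> exists q, [/\ path E (last u p) q,
    last (last u p) q = u & walk_cost c (last u p) q = walk_cost c u p].
Proof.
move=> E_sym c_sym u p; elim/last_ind: p => [|p w IHp]; first by exists [::].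
rewrite rcons_path last_rcons => /andP[/IHp [q [Eq lq cq]] Epw].
exists (last u p :: q) => /=.
by rewrite E_sym Epw Eq lq -cats1 walk_cost_cat cq /= addr0 addrC -c_sym.
Qed.

Lemma dist_sym : symmetric E -> (forall u v, E u v -> c u v = c v u) ->
  forall u v, dist E c u v = dist E c v u.
Proof.
move=> E_sym c_sym.
suff le_d u v : dist E c u v <= dist E c v u.
  by move=> u v; apply/le_anti; rewrite !le_d.
apply: le_dist => p Ep lp; have [q] := walk_cost_rev E_sym c_sym Ep.
by rewrite lp => -[Eq lq <-]; apply: dist_le.
Qed.

End Dist.

Lemma le_diam E c u v : dist E c u v <= diam E c.
Proof. by rewrite /diam (le_bigmax _ (fun uv => dist E c uv.1 uv.2) (u, v)). Qed.

Lemma diam_ge0 E c : 0 <= diam E c.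
Proof. exact: bigmax_ge_id. Qed.

Lemma diam_le E c r : 0 <= r -> (forall u v, dist E c u v <= r) -> diam E c <= r.
Proof. by move=> r_ge0 le_r; apply: bigmax_le => // uv _; apply: le_r. Qed.

End Walks.

(** * The approximation ratio *)

Section SparseClasses.
Variable I : finType.
Implicit Types (s : seq (I * I)) (f : I -> I).

(** Contract the links one at a time. A link between two classes joins them and is itself counted in
    the joint class; a link inside a class only increases a count. So a class never has more than
    one element in excess of its links. *)
Lemma merged_labels s : exists f, (forall e, e \in s -> f e.1 = f e.2) /\
  (forall l, (#|[pred i | f i == l]| <= (count (fun e => f e.1 == l) s).+1)%N).
Proof.
elim: s => [|[u v] s [f [f_s f_card]]].
  by exists id; split=> // l /=; rewrite (eq_card (B := pred1 l)) ?card1.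
have [fuv | fuv] := eqVneq (f u) (f v).
  exists f; split=> [e|l]; last by have := f_card l; rewrite /=; lia.
  by rewrite inE => /predU1P[-> //|/f_s].
(* The class of [u] takes over the label of the class of [v]; the label [f u] becomes empty. *)
pose g i := if f i == f u then f v else f i.
exists g; split=> [e|l].
  rewrite inE => /predU1P[-> /=|/f_s]; rewrite /g; last by move=> ->.
  by rewrite eqxx; case: ifP.
have [->|lu] := eqVneq l (f u).
  rewrite eq_card0 // => i; rewrite inE /g.
  by case: (eqVneq (f i) (f u)) => [_|/negPf//]; rewrite eq_sym (negPf fuv).
have [->|lv] := eqVneq l (f v); last first.
  have gl i : (g i == l) = (f i == l).
    rewrite /g; case: (f i =P f u) => // ->; by rewrite !(eq_sym _ l) (negPf lu) (negPf lv).
  have -> : #|[pred i | g i == l]| = #|[pred i | f i == l]|.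
    by apply: eq_card => i; rewrite !inE gl.
  apply: leq_trans (f_card l) _; rewrite /= gl.
  by rewrite (@eq_count _ (fun e => g e.1 == l) (fun e => f e.1 == l)) // ltnS leq_addl.
have gl i : (g i == f v) = (f i == f u) || (f i == f v).
  by rewrite /g; case: (f i =P f u); rewrite ?eqxx.
pose cl l := [pred i | f i == l].
have -> : #|[pred i | g i == f v]| = (#|cl (f u)| + #|cl (f v)|)%N.
  rewrite -cardUI -[LHS]addn0; congr addn.
    by apply: eq_card => i; rewrite !inE gl.
  apply/esym/eq_card0 => i; rewrite !inE.
  by apply/andP=> -[/eqP->]; rewrite (negPf fuv).
rewrite /= gl eqxx /=.
rewrite (@eq_count _ (fun e => g e.1 == f v)
  (predU (fun e => f e.1 == f u) (fun e => f e.1 == f v))); last first.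
  by move=> e; rewrite /= gl.
have := count_predUI (fun e : I * I => f e.1 == f u) (fun e => f e.1 == f v) s.
rewrite (@eq_count _ (predI _ _) pred0) ?count_pred0; last first.
  by move=> e /=; apply/andP=> -[/eqP->]; rewrite (negPf fuv).
by have := f_card (f u); have := f_card (f v); rewrite -/(cl _) -/(cl _); lia.
Qed.

(** The excess of elements over links is at most 1 in each class and at least 2 in total, so it is
    positive in at least two classes. *)
Lemma two_sparse_classes s : (size s + 2 <= #|I|)%N ->
  exists f l1 l2, [/\ l1 != l2, forall e, e \in s -> f e.1 = f e.2,
    (count (fun e => f e.1 == l1) s < #|[pred i | f i == l1]|)%N
  & (count (fun e => f e.1 == l2) s < #|[pred i | f i == l2]|)%N].
Proof.
move=> s_small; have [f [f_s f_card]] := merged_labels s.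
pose a l := #|[pred i | f i == l]|; pose b l := count (fun e => f e.1 == l) s.
have sum_a : (\sum_l a l = #|I|)%N.
  rewrite -[RHS]sum1_card [RHS](partition_big f xpredT) //=.
  by apply: eq_bigr => l _; rewrite /a -sum1_card.
have sum_b : (\sum_l b l = size s)%N.
  rewrite {}/b {f_s f_card s_small}; elim: s => [|e s IHs] /=; first by rewrite big1.
  rewrite big_split /= IHs -add1n; congr addn.
  rewrite (bigD1 (f e.1)) //= eqxx big1 // => l.
  by rewrite eq_sym => /negPf->.
have ex_l (P : pred I) : (\sum_(l | P l) b l < \sum_(l | P l) a l)%N ->
    exists2 l, P l & (b l < a l)%N.
  move=> lt_ba; have [l /andP[Pl ltl]|no_l] := pickP (fun l => P l && (b l < a l)%N).
    by exists l.
  move: lt_ba; rewrite ltnNge leq_sum // => l Pl.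
  by rewrite leqNgt; have := no_l l; rewrite Pl /= => ->.
have [|l1 _ lt1] := ex_l xpredT; first by rewrite sum_a sum_b; lia.
have [|l2 l12 lt2] := ex_l (fun l => l != l1).
  have fc : (a l1 <= (b l1).+1)%N := f_card l1.
  move: sum_a sum_b; rewrite (bigD1 l1) //= => sum_a; rewrite (bigD1 l1) //= => sum_b.
  move: sum_a sum_b fc s_small; set sa := (\sum_(l | _) a l)%N; set sb := (\sum_(l | _) b l)%N.
  by move: sa sb (a l1) (b l1) #|I| (size s) => *; lia.
by exists f, l1, l2; split; rewrite // eq_sym.
Qed.

End SparseClasses.

(** * Points that stay far apart in spite of the shortcuts *)

Section Separation.
Context {R : realType} {V I : finType}.
Variables (T : rel V) (c : V -> V -> R) (S : {set {set V}}) (X : I -> V) (r : R).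
Hypotheses (T_sym : symmetric T) (T_irr : irreflexive T).
Hypothesis T_conn : forall u v, connect T u v.
Hypothesis c_sym : forall u v, u != v -> c u v = c v u.
Hypothesis S_shortcuts : shortcuts S.
Hypothesis SX : (#|S| + 2 <= #|I|)%N.
Hypothesis r_gt0 : 0 < r.

Lemma augment_sym : symmetric (augment T S).
Proof. by move=> u v; rewrite /augment /= T_sym setUC. Qed.

Lemma augment_neq u v : augment T S u v -> u != v.
Proof.
case/orP=> [Tuv|/S_shortcuts]; first by apply: contraL Tuv => /eqP->; rewrite T_irr.
by apply: contra_eq_neq => ->; rewrite setUid cards1.
Qed.

Section PositiveCosts.
Variable eta : R.
Hypotheses (eta_gt0 : 0 < eta) (c_ge : forall u v, u != v -> eta <= c u v).
Hypothesis X_sep : forall i j, i != j -> r <= dist T c (X i) (X j).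

Let c_ge0 u v : u != v -> 0 <= c u v.
Proof. by move=> /c_ge; apply/le_trans/ltW. Qed.

Let T_neq u v : T u v -> u != v.
Proof. by move=> Tuv; apply: augment_neq; rewrite /augment /= Tuv. Qed.

Let T_ge0 u v : T u v -> 0 <= c u v.
Proof. by move=> /T_neq/c_ge0. Qed.

Let dT := dist T c.
Let dTxx u : dT u u = 0. Proof. exact: distxx. Qed.
Let dT_sym u v : dT u v = dT v u.
Proof. by apply: dist_sym => // x y /T_neq/c_sym. Qed.
Let dT_tri v u w : dT u w <= dT u v + dT v w. Proof. exact: dist_triangle. Qed.

Variable i0 : I.

Let cell v : I := [arg min_(i < i0) dT v (X i)]%O.
Let delta v := dT v (X (cell v)).

Let delta_le v i : delta v <= dT v (X i).
Proof. by rewrite /delta /cell; case: arg_minP => // j _ ->. Qed.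

Let cellX i : cell (X i) = i.
Proof.
apply/eqP/negPn/negP => neq; have := X_sep neq; rewrite -/dT dT_sym.
by have := delta_le (X i) i; rewrite dTxx /delta; move: r_gt0; lra.
Qed.

(* The distance still to cover before reaching the boundary of the Voronoi cell. *)
Let gap v := Num.max 0 (r / 2 - delta v).

Let gap_ge0 v : 0 <= gap v. Proof. by rewrite /gap le_max lexx. Qed.

Let gap_ge v : r / 2 - delta v <= gap v.
Proof. by rewrite /gap le_max lexx orbT. Qed.

(** If both gaps are positive, this is the separation of the two points whose cells meet at the
    edge. If one of them is 0, the other is at most [c u v] because [delta] changes by at most
    [c u v] along the edge. *)
Let gap_cross u v : T u v -> cell u != cell v -> gap u + gap v <= c u v.
Proof.
move=> Tuv neq.
have cuv : dT u v <= c u v by apply: dist_edge.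
have lip_u : delta u <= c u v + delta v.
  apply: le_trans (delta_le u (cell v)) _.
  by apply: le_trans (dT_tri v u (X (cell v))) _; rewrite lerD2r.
have lip_v : delta v <= c u v + delta u.
  apply: le_trans (delta_le v (cell u)) _.
  by apply: le_trans (dT_tri u v (X (cell u))) _; rewrite lerD2r dT_sym.
have sep : r <= delta u + c u v + delta v.
  apply: le_trans (X_sep neq) _; apply: le_trans (dT_tri u _ _) _.
  rewrite dT_sym -addrA lerD2l; apply: le_trans (dT_tri v _ _) _.
  by rewrite lerD2r.
have cuv_ge0 := c_ge0 (T_neq Tuv).
by rewrite /gap; case: (leP 0 (r / 2 - delta u)) => ?; case: (leP 0 (r / 2 - delta v)) => ?; lra.
Qed.

(** Fixes an order of the two endpoints of a shortcut; the default value only makes the choice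
    total. *)
Let ends (e : {set V}) : V * V :=
  if [pick uv : V * V | e == [set uv.1; uv.2]] is Some uv then uv else (X i0, X i0).

Lemma endsP e : e \in S -> e = [set (ends e).1; (ends e).2].
Proof.
move=> /S_shortcuts/eqP/cards2P[u [v [_ ->]]]; rewrite /ends.
by case: pickP => [uv /eqP//|/(_ (u, v))]; rewrite eqxx.
Qed.

Let links := [seq (cell (ends e).1, cell (ends e).2) | e <- enum S].
Section Labels.
Variable f : I -> I.
Hypothesis f_links : forall e, e \in links -> f e.1 = f e.2.

Let zone v := f (cell v).

(** Consequently every edge of [augment T S] that leaves a zone is a tree edge between two cells,
    and [gap_cross] applies to it. *)
Let zone_shortcut u v : [set u; v] \in S -> zone u = zone v.
Proof.
move=> uvS; have := endsP uvS.
have : zone (ends [set u; v]).1 = zone (ends [set u; v]).2.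
  apply: (f_links (e := (_, _))); apply/mapP; exists [set u; v] => //.
  by rewrite mem_enum.
move: (ends [set u; v]) => [x y] /= zxy uvE.
have /set2P[] : u \in [set x; y] by rewrite -uvE set21.
  by move=> ->; have /set2P[->|->] : v \in [set x; y] by rewrite -uvE set22.
by move=> ->; have /set2P[->|->] : v \in [set x; y] by rewrite -uvE set22.
Qed.

Let within l : rel V := [rel u v | [&& augment T S u v, zone u == l & zone v == l]].

Let within_ge0 l u v : within l u v -> 0 <= c u v.
Proof. by case/and3P=> /augment_neq/c_ge0. Qed.

(** Plays the role of the distance from the boundary of the zone to [v] when shortcuts are allowed:
    a walk may start anywhere in the zone but pays the gap of its start. [phi_end] compares it with
    walks that come from outside. *)
Let phi l v := inf (fun x => exists u p,
  [/\ path (within l) u p, last u p = v & x = gap u + walk_cost c u p]).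

Let phi_le l u p : path (within l) u p -> phi l (last u p) <= gap u + walk_cost c u p.
Proof.
move=> Ep; apply: ge_inf; last by exists u, p.
exists 0 => _ [v [q [Eq _ ->]]].
by rewrite addr_ge0 // (walk_cost_ge0 (@within_ge0 l)).
Qed.

Let le_phi l v x : (forall u p, path (within l) u p -> last u p = v ->
  x <= gap u + walk_cost c u p) -> x <= phi l v.
Proof.
move=> le_x; apply: lb_le_inf => [|_ [u [p [Ep lp ->]]]]; last exact: le_x.
by exists (gap v + walk_cost c v [::]), v, [::].
Qed.

Let phi_step l u v : within l u v -> phi l v <= phi l u + c u v.
Proof.
move=> Euv; rewrite -lerBlDr; apply: le_phi => w p Ep lp.
have := @phi_le l w (rcons p v); rewrite rcons_path Ep lp Euv last_rcons => /(_ isT).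
by rewrite -cats1 walk_cost_cat /= lp; lra.
Qed.

Let phi_path l u p : path (within l) u p -> phi l (last u p) <= phi l u + walk_cost c u p.
Proof.
elim: p u => [|w p IHp] u /=; first by rewrite addr0.
case/andP=> /phi_step phi_w /IHp; lra.
Qed.

Let phi_gap l v : phi l v <= gap v.
Proof. by have := @phi_le l v [::]; rewrite addr0; apply. Qed.

(* A near-optimal walk from the boundary takes its last shortcut from the
   endpoint with the smaller phi to the one with the larger phi, up to a
   difference below eta; so each shortcut makes at most one point close. *)
Let far_point l :
  (count (fun e => f e.1 == l) links < #|[pred i | f i == l]|)%N ->
  exists2 i, f i = l & r / 2 <= phi l (X i).
Proof.
move=> sparse; apply: boolp.contrapT => no_far.
have near i : f i = l -> phi l (X i) < r / 2.
  by move=> fi; rewrite ltNge; apply/negP => far; apply: no_far; exists i.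
pose hi e := if phi l (ends e).1 <= phi l (ends e).2 then (ends e).2 else (ends e).1.
pose A := [set e in S | zone (ends e).1 == l].
have cardA : #|A| = count (fun e => f e.1 == l) links.
  rewrite /links count_map -size_filter cardE; congr size.
  rewrite /A [LHS]/enum_mem -filter_predI; apply: eq_filter => e /=.
  by rewrite inE andbC.
have blame i : exists e, f i = l -> e \in A /\ dT (hi e) (X i) < r / 2.
  have [fi|/eqP nfi] := eqVneq (f i) l; last by exists set0.
  have [_ [u [p [Ep lp ->]]]] : exists2 x, (exists u p,
     [/\ path (within l) u p, last u p = X i & x = gap u + walk_cost c u p])
       & x < Num.min (r / 2) (phi l (X i) + eta).
    apply: boolp.contrapT => none.
    suff : Num.min (r / 2) (phi l (X i) + eta) <= phi l (X i).
      by rewrite ge_min; have := near i fi; move: eta_gt0; lra.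
    apply: le_phi => u p Ep lp; rewrite leNgt; apply/negP => lt_m.
    by apply: none; exists (gap u + walk_cost c u p) => //; exists u, p.
  rewrite lt_min => /andP[lt_r lt_phi].
  (* Without shortcuts the walk costs at least [delta u]; adding [gap u] already gives [r / 2]. *)
  have [Tp|] := boolP (path T u p).
    have := dist_le T_ge0 Tp lp; have := delta_le u i; have := gap_ge u.
    by rewrite /dT; lra.
  move=> nTp.
  have [p1 [v [p2 [pE nTv Tp2]]]] :
      exists p1 v p2, [/\ p = p1 ++ v :: p2, ~~ T (last u p1) v & path T v p2].
    elim: p u nTp {Ep lp lt_r lt_phi} => [|w p IHp] u //=.
    have [Tw|nTw] := boolP (path T w p); last first.
      move=> _; have [p1 [v [p2 [-> ? ?]]]] := IHp w nTw.
      by exists (w :: p1), v, p2.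
    by rewrite andbT => nTuw; exists [::], w, p.
  move: Ep lp lt_r lt_phi; rewrite pE cat_path last_cat walk_cost_cat /=.
  case/and3P=> Ep1 Euv Ep2 lp2 lt_r lt_phi.
  set w := last u p1 in nTv Euv lt_r lt_phi *.
  have /and3P[] := Euv; rewrite /augment /= (negPf nTv) /= => wvS zw zv.
  have neq_wv : w != v by apply: augment_neq; rewrite /augment /= wvS orbT.
  have := phi_le Ep1; rewrite -/w => phi_w.
  have := phi_path Ep2; rewrite lp2 => phi_i.
  have c_wv := c_ge neq_wv.
  (* The walk exceeds the infimum by less than [eta], whereas the shortcut costs at least [eta], so
     [phi] strictly increases from [w] to [v]. Hence [hi] selects [v], from where only tree edges
     lead to the point. *)
  have lt_wv : phi l w < phi l v by lra.
  have hiE : hi [set w; v] = v.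
    rewrite /hi; have := endsP wvS; move: (ends [set w; v]) => [x y] /= wvE.
    have /set2P[] : w \in [set x; y] by rewrite -wvE set21.
      move=> wx; have /set2P[vx|vy] : v \in [set x; y] by rewrite -wvE set22.
        by move: neq_wv; rewrite wx vx eqxx.
      by rewrite -wx -vy (ltW lt_wv).
    move=> wy; have /set2P[vx|vy] : v \in [set x; y] by rewrite -wvE set22.
      by rewrite -wy -vx leNgt lt_wv.
    by move: neq_wv; rewrite wy vy eqxx.
  exists [set w; v] => _; split.
    rewrite inE wvS /=; have := endsP wvS; move: (ends [set w; v]) => [x y] /= wvE.
    have /set2P[] : x \in [set w; v] by rewrite wvE set21.
      by move=> ->.
    by move=> ->.
  rewrite hiE; apply: le_lt_trans (dist_le T_ge0 Tp2 lp2) _.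
  have := walk_cost_ge0 (@within_ge0 l) Ep1; have := gap_ge0 u.
  by have := c_ge0 neq_wv; lra.
have {}blame i : {e | f i = l -> e \in A /\ dT (hi e) (X i) < r / 2}.
  exact: boolp.cid (blame i).
pose g i := sval (blame i).
(* Two points charged to the same shortcut would both be within [r / 2] in [T] of its [hi] endpoint,
   hence closer than [r] to each other. *)
have g_inj : {in [pred i | f i == l] &, injective g}.
  move=> i j; rewrite !inE => /eqP fi /eqP fj gij; apply/eqP/negPn/negP => nij.
  have [_] := svalP (blame i) fi; have [_] := svalP (blame j) fj.
  rewrite -/(g i) -/(g j) -gij => lt_j lt_i.
  have := X_sep nij; have := dT_tri (hi (g i)) (X i) (X j).
  by rewrite (dT_sym (X i) (hi _)) -/dT; lra.
move: sparse; rewrite ltnNge => /negP; apply.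
rewrite -cardA -(card_in_image g_inj); apply/subset_leq_card/subsetP => e.
by case/imageP => i; rewrite inE => /eqP fi ->; case: (svalP (blame i) fi).
Qed.

(** Follow the walk backwards from [v]. As long as it stays in the zone, [phi_step] applies; the
    edge by which it enters the zone joins two cells and costs at least the gap of its inner end,
    which bounds [phi] there. *)
Let phi_end l u p v : zone v = l -> path (augment T S) u p -> last u p = v ->
  phi l v <= gap u + walk_cost c u p.
Proof.
elim/last_ind: p v => [|p w IHp] v zv /=.
  by move=> _ ->; rewrite addr0 phi_gap.
rewrite rcons_path last_rcons -cats1 walk_cost_cat /= addr0 => /andP[Ep Euw] wv.
rewrite wv in Euw *.
have [zu|zu] := eqVneq (zone (last u p)) l.
  have := IHp _ zu Ep erefl.
  by have := @phi_step l (last u p) v; rewrite /within /= zu zv eqxx !andbT => /(_ Euw); lra.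
have Tuw : T (last u p) v.
  by case/orP: Euw => // /zone_shortcut zuv; rewrite -zuv in zv; rewrite zv eqxx in zu.
have := gap_cross Tuw; have := phi_gap l v; have := gap_ge0 (last u p).
have := gap_ge0 u.
have := walk_cost_ge0 (fun u v Euv => c_ge0 (@augment_neq u v Euv)) Ep.
have -> : cell (last u p) != cell v.
  by apply: contra_neq zu => cuv; rewrite -zv /zone cuv.
by move=> ? ? ? ? /(_ isT); lra.
Qed.

(** The first edge that leaves the zone of [u] pays for the gaps of both its ends. The inner gap
    completes a bound on [phi l u]; the outer one is the starting fee in [phi_end] for the rest of
    the walk. *)
Let far_walk l l' u v p : l != l' -> zone u = l -> zone v = l' ->
  path (augment T S) u p -> last u p = v ->
  phi l u + phi l' v <= walk_cost c u p.
Proof.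
move=> nll'; elim: p u => [|w p IHp] u /= zu zv.
  by move=> _ uv; move: nll'; rewrite -zu -zv uv eqxx.
case/andP=> Euw Ep lp; have nuw := augment_neq Euw.
have [zw|zw] := eqVneq (zone w) l.
  have := IHp _ zw zv Ep lp.
  have := @phi_step l w u; rewrite /within /= zu zw eqxx !andbT.
  rewrite augment_sym => /(_ Euw); rewrite (c_sym nuw); lra.
have Tuw : T u w.
  by case/orP: Euw => // /zone_shortcut zuw; rewrite -zuw zu eqxx in zw.
have := gap_cross Tuw; have := phi_gap l u; have := phi_end zv Ep lp.
have -> : cell u != cell w.
  by apply: contra_neq zw => cuw; rewrite -zu /zone cuw.
by move=> ? ? /(_ isT); lra.
Qed.

Lemma far_pair_labels l l' : l != l' ->
  (count (fun e => f e.1 == l) links < #|[pred i | f i == l]|)%N ->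
  (count (fun e => f e.1 == l') links < #|[pred i | f i == l']|)%N ->
  exists i j, r <= dist (augment T S) c (X i) (X j).
Proof.
move=> nll' /far_point[i fi far_i] /far_point[j fj far_j]; exists i, j.
apply: le_dist => [u v|p Ep lp].
  by apply: connect_sub (T_conn u v) => x y Txy; rewrite connect1 // /augment /= Txy.
have := @far_walk l l' (X i) (X j) p nll'; rewrite /zone !cellX.
by move=> /(_ fi fj Ep lp); lra.
Qed.

End Labels.

Lemma far_pair_pos : exists i j, r <= dist (augment T S) c (X i) (X j).
Proof.
have [|f [l [l' [nll' f_links lt_l lt_l']]]] := @two_sparse_classes I links.
  by rewrite size_map -cardE.
exact: far_pair_labels lt_l lt_l'.
Qed.

End PositiveCosts.

Lemma augment_conn u v : connect (augment T S) u v.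
Proof.
by apply: connect_sub (T_conn u v) => x y Txy; rewrite connect1 // /augment /= Txy.
Qed.

End Separation.

Section FarPair.
Context {R : realType} {V I : finType}.
Variables (T : rel V) (c : V -> V -> R) (S : {set {set V}}) (X : I -> V) (r : R).
Hypotheses (T_sym : symmetric T) (T_irr : irreflexive T).
Hypothesis T_conn : forall u v, connect T u v.
Hypothesis c_sym : forall u v, u != v -> c u v = c v u.
Hypothesis S_shortcuts : shortcuts S.
Hypothesis SX : (#|S| + 2 <= #|I|)%N.
Hypothesis r_gt0 : 0 < r.

Lemma walk_costD eta u p :
  walk_cost (fun u v => c u v + eta) u p = walk_cost c u p + eta *+ size p.
Proof. by elim: p u => [|w p IHp] u /=; rewrite ?addr0 // IHp mulrS; ring. Qed.

Lemma far_pair : (forall u v, u != v -> 0 <= c u v) ->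
  (forall i j, i != j -> r <= dist T c (X i) (X j)) ->
  r <= diam (augment T S) c.
Proof.
move=> c_ge0 X_sep; apply/ler_addgt0Pr => e e_gt0.
have /card_gt0P[i0 _] : (0 < #|I|)%N by lia.
have V_gt0 : (0 < #|V|)%N by apply/card_gt0P; exists (X i0).
(* A walk with fewer than [#|V|] edges becomes longer by at most [e]. *)
pose eta := e / #|V|%:R.
have eta_gt0 : 0 < eta by rewrite divr_gt0 ?ltr0n.
pose c' u v := c u v + eta.
have [|||i [j le_r]] := @far_pair_pos _ _ _ T c' S X r T_sym T_irr T_conn _ S_shortcuts SX r_gt0 eta eta_gt0 _ _ i0.
- by move=> u v uv; rewrite /c' c_sym.
- by move=> u v /c_ge0; rewrite /c'; lra.
- move=> i j /X_sep/le_trans; apply; apply: le_dist => // p Tp lp.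
  rewrite walk_costD ler_wpDr ?mulrn_wge0 ?(ltW eta_gt0) //.
  by apply: dist_le => // u v Tuv; apply/c_ge0/(augment_neq T_irr S_shortcuts); rewrite /augment /= Tuv.
apply: le_trans le_r _; rewrite -lerBlDr; apply: le_trans (le_diam _ _ (X i) (X j)).
have aug_ge0 u v : augment T S u v -> 0 <= c u v by move/(augment_neq T_irr S_shortcuts)/c_ge0.
apply: le_dist => [|p Ep lp]; first exact: augment_conn T_conn.
have [q [Eq lq sq cq]] := short_walk aug_ge0 Ep.
rewrite lerBlDr; apply: le_trans (dist_le _ Eq _) _; rewrite ?lq //.
  by move=> u v /aug_ge0; rewrite /c'; lra.
rewrite walk_costD lerD // -mulr_natr /eta mulrAC ler_pdivrMr ?ltr0n //.
by rewrite ler_wpM2l ?(ltW e_gt0) // ler_nat ltnW.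
Qed.

End FarPair.

(** * The star around the first pick *)

Section StarApproximation.
Context {R : realType} {V : finType}.

Lemma star_shortcuts k (x : 'I_k.+1 -> V) : shortcuts (star x).
Proof. by move=> e /imsetP[i]; rewrite inE => ni ->; rewrite cards2 eq_sym ni. Qed.

Lemma card_star k (x : 'I_k.+1 -> V) : (#|star x| <= k)%N.
Proof.
apply: leq_trans (leq_imset_card _ _) _.
rewrite -ltnS -[leqRHS]card_ord -cardsT.
apply/proper_card/properP; split; first exact/subsetP.
by exists ord0; rewrite ?inE // eqxx.
Qed.

Lemma metric_le_walk (T : rel V) (c : V -> V -> R) (E : rel V) :
  metric_instance T c -> (forall u v, E u v -> u != v) ->
  forall u v p, u != v -> path E u p -> last u p = v -> c u v <= walk_cost c u p.
Proof.
move=> [_ c_sym c_ge0 c_tri] E_neq u v p; elim: p u => [|w p IHp] u nuv /=.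
  by move=> _ uv; rewrite uv eqxx in nuv.
case/andP=> /E_neq nuw Ep lp; have [wv|nwv] := eqVneq w v.
  rewrite -wv ler_wpDr //; apply: (walk_cost_ge0 (E := E)) Ep.
  by move=> x y /E_neq/c_ge0.
by apply: le_trans (c_tri u v w nuv nuw nwv) _; rewrite lerD2l IHp.
Qed.

Lemma star_approximation (T : rel V) (c : V -> V -> R) k (x : 'I_k.+1 -> V)
    (S : {set {set V}}) :
  metric_instance T c -> gonzalez T c x -> feasible k S ->
  diam (augment T (star x)) c <= 4 * diam (augment T S) c.
Proof.
move=> Tc gonz [S_shortcuts cardS].
have [[T_sym T_irr T_conn _] c_sym c_ge0 c_tri] := Tc.
have star_sc : shortcuts (star x) by exact: star_shortcuts.
set D := diam (augment T S) c; have D_ge0 : 0 <= D by apply: diam_ge0.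
have aug_ge0 S' : shortcuts S' -> forall u v, augment T S' u v -> 0 <= c u v.
  by move=> S'_sc u v /(augment_neq T_irr S'_sc)/c_ge0.
have T_ge0 u v : T u v -> 0 <= c u v.
  by move=> Tuv; apply: (aug_ge0 S) => //; rewrite /augment /= Tuv.
have dT_sym u v : dist T c u v = dist T c v u.
  apply: dist_sym => // {}u {}v Tuv; apply/c_sym/(augment_neq T_irr S_shortcuts).
  by rewrite /augment /= Tuv.
have cover u : exists i, dist T c u (x i) <= D.
  have [i _ min_i] := arg_minP (fun i => dist T c u (x i)) (isT : xpredT (ord0 : 'I_k.+1)).
  exists i; have [r_le0|r_gt0] := lerP (dist T c u (x i)) 0.
    exact: le_trans r_le0 D_ge0.
  (* The picks together with [u] are [k + 2] points, two more than [S] has shortcuts. *)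
  pose X o := if o is Some j then x j else u.
  refine (@far_pair _ _ (option 'I_k.+1) T c S X _ T_sym T_irr T_conn c_sym S_shortcuts _ r_gt0 c_ge0 _).
    by rewrite card_option card_ord cardS addn2.
  (* When [x j] was chosen, [u] was a candidate whose distance to the earlier picks was at least its
     final distance to all picks; the maximizer is no closer to them. *)
  have sep (j j' : 'I_k.+1) : (j' < j)%N -> dist T c u (x i) <= dist T c (x j) (x j').
    move=> lt_j; have j_gt0 : (0 < j)%N by apply: leq_ltn_trans lt_j.
    apply: le_trans (le_trans (gonz j j_gt0 u) _).
      by apply: le_bigmin => [|l _]; apply: min_i.
    by rewrite /dist_to_first; apply: bigmin_le_cond.
  case=> [j|] [j'|] //= njj'.
  - have : j != j' by apply: contra_neq njj' => ->.
    by rewrite neq_ltn => /orP[/sep|/sep//]; rewrite (dT_sym (x j)).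
  - by rewrite (dT_sym (x j)); apply: min_i.
  - exact: min_i.
have hub i : dist (augment T (star x)) c (x i) (x ord0) <= D /\
             dist (augment T (star x)) c (x ord0) (x i) <= D.
  have [->|ni0] := eqVneq (x i) (x ord0).
    have d0 := distxx (augment_conn (star x) T_conn) (aug_ge0 _ star_sc) (x ord0).
    by rewrite d0.
  (* By the triangle inequality the direct cost is at most the cost of any walk, in particular of
     every walk in [augment T S]. *)
  have c_le : c (x i) (x ord0) <= D.
    apply: le_trans (le_diam _ _ (x i) (x ord0)).
    apply: le_dist => [|p]; first exact: (augment_conn _ T_conn).
    apply: (metric_le_walk Tc) => // u v; exact: augment_neq.
  have star_i : [set x ord0; x i] \in star x by apply: imset_f; rewrite inE.
  split.
    apply: le_trans c_le; apply: dist_edge; first exact: (aug_ge0 _ star_sc).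
    by rewrite /augment /= setUC star_i orbT.
  apply: le_trans c_le; rewrite (c_sym _ _ ni0).
  apply: dist_edge; first exact: (aug_ge0 _ star_sc).
  by rewrite /augment /= star_i orbT.
have sub u v : dist (augment T (star x)) c u v <= dist T c u v.
  apply: le_dist => // p Tp lp; apply: dist_le => //.
    exact: (aug_ge0 _ star_sc).
  by apply: sub_path Tp => a b Tab; rewrite /augment /= Tab.
apply: diam_le => [|u v]; first by rewrite mulr_ge0.
have [i ui] := cover u; have [j vj] := cover v.
have tri := dist_triangle (augment_conn (star x) T_conn) (aug_ge0 _ star_sc).
have := tri (x i) u v; have := tri (x ord0) (x i) v; have := tri (x j) (x ord0) v.
have := sub u (x i); have := sub (x j) v; rewrite (dT_sym (x j)).
have := hub i; have := hub j; case=> ? ? [? ?]; lra.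
Qed.

End StarApproximation.

(** * Trees and distances to the picks *)

Definition anc (par : nat -> nat) (z a : nat) : Prop := exists m, iter m par a = z.

Lemma anc_refl par z : anc par z z. Proof. by exists 0%N. Qed.

Lemma anc_trans par y x z : anc par x y -> anc par y z -> anc par x z.
Proof. by move=> [m <-] [m' <-]; exists (m + m')%N; rewrite iterD. Qed.

Lemma anc_par par z : anc par (par z) z. Proof. by exists 1%N. Qed.

Lemma anc_case par z a : anc par z a -> z = a \/ anc par z (par a).
Proof. by case=> -[|m]; [left | rewrite iterSr; right; exists m]. Qed.

Section TreeMetric.
Variable R : realType.
Implicit Types (N : nat) (par : nat -> nat) (wt : nat -> R) (D : nat -> nat -> R).

(* A tree on the nodes 1, ..., N rooted at 1.  Dcut says that the edge above z
   separates the descendants of z from the other nodes. *)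
Record tree_metric N par wt D : Prop := TreeMetric {
  par0 : par 0%N = 0%N;
  par1 : par 1%N = 0%N;
  par_lt : forall z, (1 < z <= N)%N -> (0 < par z < z)%N;
  wt_ge0 : forall z, (1 < z <= N)%N -> 0 <= wt z;
  Dxx : forall x, D x x = 0;
  Dsym : forall x y, D x y = D y x;
  Dge0 : forall x y, 0 <= D x y;
  Dtri : forall y x z, D x z <= D x y + D y z;
  Dcut : forall z b, (1 < z <= N)%N -> (0 < b <= N)%N -> ~ anc par z b ->
    D z b = wt z + D (par z) b }.

Section Theory.
Variables (N : nat) (par : nat -> nat) (wt : nat -> R) (D : nat -> nat -> R).
Hypothesis tm : tree_metric N par wt D.

Lemma anc0 z : anc par z 0 -> z = 0%N.
Proof. by case=> m <-; elim: m => //= m ->; apply: par0 tm. Qed.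

Lemma anc_le z a : (a <= N)%N -> anc par z a -> (z <= a)%N.
Proof.
move=> aN [m]; elim: m a aN => [|m IHm] a aN; first by move=> <-.
rewrite iterSr => /IHm le_z.
have [a_le1|a_gt1] := leqP a 1; last first.
  by have := par_lt tm (z := a); rewrite a_gt1 aN => /(_ isT); lia.
have : par a = 0%N by case: a a_le1 {aN le_z} => [|[|]] // _; [apply: par0 tm|apply: par1 tm].
by lia.
Qed.

Lemma anc_root a : (0 < a <= N)%N -> anc par 1 a.
Proof.
elim/ltn_ind: a => a IHa /andP[a_gt0 aN].
have [->|a_neq1] := eqVneq a 1%N; first exact: anc_refl.
have /andP[? ?] : (0 < par a < a)%N by apply: (par_lt tm); lia.
by apply: anc_trans (anc_par par a); apply: IHa => //; lia.
Qed.

Lemma anc_gt1 z a : (1 < z)%N -> (a <= N)%N -> anc par z a -> (1 < a)%N.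
Proof. by move=> z1 aN /(anc_le aN); lia. Qed.

Lemma dep_step z : (1 < z <= N)%N -> D 1 z = D 1 (par z) + wt z.
Proof.
move=> zN; rewrite (Dsym tm 1 z) (Dcut tm (b := 1)) //; last by move/anc_le; lia.
  by rewrite addrC (Dsym tm 1).
by lia.
Qed.

Lemma D_anc z a : (0 < z)%N -> (a <= N)%N -> anc par z a -> D a z = D 1 a - D 1 z.
Proof.
move=> z0 + [m]; elim: m a => [|m IHm] a aN.
  by move=> za; have {za}-> : z = a := esym za; rewrite subrr (Dxx tm).
rewrite iterSr => am; have za : anc par z a by exists m.+1; rewrite iterSr.
have [a_le1|a_gt1] := leqP a 1.
  have := anc_le aN za => ?; have -> : a = z by lia.
  by rewrite subrr (Dxx tm).
have pa : (0 < par a < a)%N by apply: (par_lt tm); rewrite a_gt1.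
have zpa : anc par z (par a) by exists m.
have z_le : (z <= par a)%N by apply: anc_le zpa; lia.
rewrite (Dcut tm) ?a_gt1 ?z0 //; [|by lia|by move/anc_le; lia].
by rewrite IHm //; [rewrite (dep_step (z := a)) ?a_gt1 //; lra | lia].
Qed.

Lemma dep_le z a : (0 < z)%N -> (a <= N)%N -> anc par z a -> D 1 z <= D 1 a.
Proof. by move=> z0 aN za; rewrite -subr_ge0 -D_anc // (Dge0 tm). Qed.

(** Climb from [a] to [par z]: every edge on the way has its lower side inside the subtree of [z],
    which does not contain [b], so [Dcut] applies to each of them. *)
Lemma D_cut z a b : (1 < z)%N -> (a <= N)%N -> (0 < b <= N)%N ->
  anc par z a -> ~ anc par z b -> D a b = D 1 a - D 1 (par z) + D (par z) b.
Proof.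
move=> z1 + bN [m] + nzb; elim: m a => [|m IHm] a aN.
  move=> za; have {}za : z = a := esym za; rewrite -za in aN *.
  rewrite (Dcut tm) ?z1 //.
  by rewrite (dep_step (z := z)) ?z1 //; lra.
rewrite iterSr => am; have za : anc par z a by exists m.+1; rewrite iterSr.
have a_gt1 := anc_gt1 z1 aN za.
have pa : (0 < par a < a)%N by apply: (par_lt tm); rewrite a_gt1.
rewrite (Dcut tm) ?a_gt1 //; last by move=> ab; apply: nzb; apply: anc_trans ab.
rewrite IHm //; last by lia.
by rewrite (dep_step (z := a)) ?a_gt1 //; lra.
Qed.

End Theory.

(* lc is the child towards a deepest descendant, oc the other child (0 if
   absent), hgt the distance to the deepest descendant, and ohgt the distance
   to the deepest descendant in the direction of oc. *)
Record long_children N par wt (lc oc : nat -> nat) (hgt ohgt : nat -> R) : Prop :=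
  LongChildren {
  lc_spec : forall z, (0 < z <= N)%N -> lc z != 0%N ->
    [/\ (1 < lc z <= N)%N, par (lc z) = z & hgt z = hgt (lc z) + wt (lc z)];
  lc0_spec : forall z, (0 < z <= N)%N -> lc z = 0%N -> hgt z = 0;
  oc_spec : forall z, (0 < z <= N)%N -> oc z != 0%N ->
    [/\ (1 < oc z <= N)%N, par (oc z) = z, oc z <> lc z,
        ohgt z = hgt (oc z) + wt (oc z) & ohgt z <= hgt z];
  oc0_spec : forall z, (0 < z <= N)%N -> oc z = 0%N -> ohgt z = 0;
  child_spec : forall a, (1 < a <= N)%N -> a = lc (par a) \/ a = oc (par a) }.

(* Node 1 is the first pick. *)
Definition near D (ys : seq nat) (v : nat) : R :=
  \big[Num.min/D v 1%N]_(y <- ys) D v y.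

Lemma near_le1 D ys v : near D ys v <= D v 1%N.
Proof. exact: bigmin_le_id. Qed.

Lemma near_le D ys v y : y \in ys -> near D ys v <= D v y.
Proof. by move=> yys; rewrite /near; apply: (@ge_bigmin_seq _ _ _ ys _ y). Qed.

Lemma near_attained D ys v :
  near D ys v = D v 1%N \/ exists2 y, y \in ys & near D ys v = D v y.
Proof.
rewrite /near; elim: ys => [|y ys IHys]; first by rewrite big_nil; left.
rewrite big_cons; case: leP => _; first by right; exists y; rewrite ?mem_head.
case: IHys => [->|[x xys ->]]; first by left.
by right; exists x; rewrite // inE xys orbT.
Qed.

Lemma near_rcons D ys y v : near D (rcons ys y) v = Num.min (near D ys v) (D v y).
Proof.
rewrite /near; elim: ys => [|x ys IHys]; first by rewrite big_cons !big_nil minC.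
by rewrite rcons_cons !big_cons IHys minA.
Qed.

Lemma near_lip N par wt D ys u v : tree_metric N par wt D ->
  near D ys u <= near D ys v + D u v.
Proof.
move=> tm; case: (near_attained D ys v) => [->|[y yys ->]].
  by rewrite addrC; apply: le_trans (near_le1 D ys u) (Dtri tm v u 1).
by rewrite addrC; apply: le_trans (near_le D u yys) (Dtri tm v u y).
Qed.

Lemma near_ge0 N par wt D ys v : tree_metric N par wt D -> 0 <= near D ys v.
Proof.
by move=> tm; case: (near_attained D ys v) => [->|[y _ ->]]; apply: (Dge0 tm).
Qed.

End TreeMetric.

(** * Active nodes and the subtrees hanging from them *)

Section ActiveTree.
Context {R : realType}.
Variables (N : nat) (par : nat -> nat) (wt : nat -> R) (D : nat -> nat -> R).
Variables (lc oc : nat -> nat) (hgt ohgt : nat -> R).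
Hypothesis tm : tree_metric N par wt D.
Hypothesis lcs : long_children N par wt lc oc hgt ohgt.
Hypothesis wt1 : wt 1%N = 0.
Hypothesis N_gt0 : (0 < N)%N.

Lemma hgt_ge0 z : (0 < z <= N)%N -> 0 <= hgt z.
Proof.
move: {2}(N - z)%N (leqnn (N - z)) => m; elim: m z => [|m IHm] z le_m zN.
all: have [l0|l_neq0] := eqVneq (lc z) 0%N; first by rewrite (lc0_spec lcs zN l0).
all: have [lN lz ->] := lc_spec lcs zN l_neq0; have := par_lt tm lN; rewrite lz => ?.
  by lia.
by rewrite addr_ge0 ?(wt_ge0 tm lN) // IHm; lia.
Qed.

(** Depth plus height does not increase from a parent to a child: it is unchanged towards the long
    child, and towards the other child [ohgt] replaces the larger [hgt]. *)
Lemma dep_hgt_le z a : (0 < z)%N -> (a <= N)%N -> anc par z a ->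
  D 1 a + hgt a <= D 1 z + hgt z.
Proof.
move=> z_gt0; elim/ltn_ind: a => a IHa aN za.
case: (anc_case za) => [->//|zpa].
have a_gt1 : (1 < a)%N.
  rewrite ltnNge; apply/negP => a1; have pa0 : par a = 0%N.
    by case: a a1 {IHa aN za zpa} => [|[|]] // _; [apply: par0 tm|apply: par1 tm].
  by rewrite pa0 in zpa; have := anc0 tm zpa; lia.
have aN' : (1 < a <= N)%N by rewrite a_gt1.
have pa := par_lt tm aN'.
apply: le_trans (IHa (par a) _ _ zpa); [|by lia|by lia].
have paN : (0 < par a <= N)%N by lia.
rewrite (dep_step tm aN') -addrA lerD2l addrC.
case: (child_spec lcs aN') => aE.
  have [|_ _ ->] := lc_spec lcs paN; first by rewrite -aE; lia.
  by rewrite -aE.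
have [|_ _ _ hE hle] := oc_spec lcs paN; first by rewrite -aE; lia.
by rewrite hE -aE in hle.
Qed.

(* Positions 1, ..., cnt - 1 enumerate the active nodes nd 1, nd 2, ..., a
   subtree containing the root; position 0 is a copy of the root.  At position
   i, ocp i is the unexplored child, if any, and hp i the height in its
   direction.  The node z <> 0 is about to be activated below position p. *)
Record active (cnt : nat) (nd pp ocp : nat -> nat) (dep hp : nat -> R)
    (z p : nat) : Prop := Active {
  act_cnt : (0 < cnt)%N;
  act_nd0 : nd 0%N = 1%N;
  act_pp0 : pp 0%N = 0%N;
  act_dep0 : dep 0%N = 0;
  act_pos1 : (1 < cnt)%N -> pp 1%N = 0%N /\ nd 1%N = 1%N;
  act_nd : forall i, (0 < i < cnt)%N -> (0 < nd i <= N)%N;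
  act_inj : forall i j, (0 < i < cnt)%N -> (0 < j < cnt)%N -> nd i = nd j -> i = j;
  act_pp : forall i, (1 < i < cnt)%N -> (0 < pp i < i)%N /\ par (nd i) = nd (pp i);
  act_dep : forall i, (0 < i < cnt)%N -> dep i = D 1%N (nd i);
  act_child : forall i a, (0 < i < cnt)%N -> (1 < a <= N)%N -> par a = nd i ->
    [\/ exists2 j, (0 < j < cnt)%N & nd j = a, a = ocp i | a = z];
  act_oc : forall i, (0 < i < cnt)%N -> ocp i <> 0%N ->
    [/\ ocp i = oc (nd i), hp i = ohgt (nd i), ocp i <> z
      & forall j, (0 < j < cnt)%N -> nd j <> ocp i];
  act_oc0 : forall i, (0 < i < cnt)%N -> ocp i = 0%N -> hp i = 0;
  act_z : z <> 0%N -> [/\ (0 < z <= N)%N, (p < cnt)%N,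
     forall j, (0 < j < cnt)%N -> nd j <> z
   & if cnt == 1%N then z = 1%N /\ p = 0%N else [/\ (0 < p)%N, (1 < z)%N & par z = nd p]] }.

Lemma active_size cnt nd pp ocp dep hp z p :
  active cnt nd pp ocp dep hp z p -> (cnt <= N.+1)%N.
Proof.
move=> A; rewrite -[cnt](prednK (act_cnt A)) ltnS.
rewrite -[leqLHS](size_iota 1) -(size_map nd) -[leqRHS](size_iota 1).
apply: uniq_leq_size => [|v /mapP[i]].
  rewrite map_inj_in_uniq ?iota_uniq // => i j; rewrite !mem_iota => Hi Hj.
  by apply: (act_inj A); have := act_cnt A; lia.
rewrite !mem_iota => Hi ->; have cnt0 := act_cnt A.
by have := act_nd A (i := i); lia.
Qed.

Lemma active_start nd pp ocp dep hp : nd 0%N = 1%N -> pp 0%N = 0%N -> dep 0%N = 0 ->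
  active 1 nd pp ocp dep hp 1 0.
Proof.
move=> nd0 pp0 d0; split=> //; try by (move=> *; exfalso; lia).
by move=> _; split=> //; move=> *; exfalso; lia.
Qed.

Lemma active_lt_size cnt nd pp ocp dep hp z p :
  active cnt nd pp ocp dep hp z p -> z <> 0%N -> (cnt <= N)%N.
Proof.
move=> A z0; have [zN pc znd _] := act_z A z0.
rewrite -[cnt](prednK (act_cnt A)).
rewrite -[(cnt.-1)%N](size_iota 1) -(size_map nd) -[leqRHS](size_iota 1).
apply: (@uniq_leq_size _ (z :: _)) => [|v].
  rewrite /= map_inj_in_uniq ?iota_uniq ?andbT => [|i j]; last first.
    by rewrite !mem_iota => Hi Hj; apply: (act_inj A); have := act_cnt A; lia.
  apply/mapP => -[i]; rewrite mem_iota => Hi zE; case: (znd i) => //.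
  by have := act_cnt A; lia.
rewrite inE mem_iota => /predU1P[->|/mapP[i]]; first by lia.
rewrite !mem_iota => Hi ->; have cnt0 := act_cnt A.
by have := act_nd A (i := i); lia.
Qed.

Lemma updE (A : Type) (f : nat -> A) i x j : upd f i x j = if j == i then x else f j.
Proof. by []. Qed.

Lemma upd_eq (A : Type) (f : nat -> A) i x : upd f i x i = x.
Proof. by rewrite updE eqxx. Qed.

Lemma upd_neq (A : Type) (f : nat -> A) i x j : j != i -> upd f i x j = f j.
Proof. by rewrite updE => /negPf->. Qed.

(** The new node stores its other child as unexplored and passes on its long child as the next node
    to activate. Thus each child of an active node remains active, unexplored or pending. *)
Lemma active_step cnt nd pp ocp dep hp z p :
  active cnt nd pp ocp dep hp z p -> z <> 0%N ->
  active cnt.+1 (upd nd cnt z) (upd pp cnt p) (upd ocp cnt (oc z))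
    (upd dep cnt (dep p + wt z)) (upd hp cnt (ohgt z)) (lc z) cnt.
Proof.
move=> A z0; have [zN pc znd zp] := act_z A z0; have cnt0 := act_cnt A.
have old (B : Type) (f : nat -> B) x i : (i < cnt)%N -> upd f cnt x i = f i.
  by move=> ic; rewrite upd_neq //; lia.
have ocz_neq : oc z <> 0%N -> oc z <> lc z.
  by move=> /eqP/(oc_spec lcs zN)[].
have ndz a : (1 < a <= N)%N -> par a = z -> forall j, (0 < j < cnt)%N -> nd j <> a.
  move=> aN az j jc nja; have [j1|j1] := leqP j 1.
    have jE : j = 1%N by lia.
    by have [|_ nd1] := act_pos1 A; [lia | move: nja; rewrite jE nd1; lia].
  have [|ppj pnj] := act_pp A (i := j); first by lia.
  by move: pnj; rewrite nja az => zE; case: (znd (pp j)) => //; lia.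
split=> //.
- by rewrite old //; apply: act_nd0 A.
- by rewrite old //; apply: act_pp0 A.
- by rewrite old //; apply: act_dep0 A.
- move=> _; move: zp; have [c1|c1] := eqVneq cnt 1%N.
    by case=> -> ->; rewrite c1 !upd_eq.
  by move=> _; rewrite !old; [apply: (act_pos1 A); lia | lia | lia].
- move=> i ic; rewrite updE; have [_|ni] := eqVneq i cnt; first by [].
  by apply: (act_nd A); lia.
- move=> i j; rewrite !updE.
  have [->|ni] := eqVneq i cnt; have [->|nj] := eqVneq j cnt => // Hi Hj.
  + by move=> zE; case: (znd j) => //; lia.
  + by move=> zE; case: (znd i) => //; lia.
  + by apply: (act_inj A); lia.
- move=> i ic; rewrite !(updE _ _ _ i); have [iE|ni] := eqVneq i cnt.
    move: zp; have [c1|c1] := eqVneq cnt 1%N; first by lia.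
    case=> p0 z1 pz; rewrite old //; split=> //; lia.
  by rewrite old; [apply: (act_pp A); lia | have := act_pp A (i := i); lia].
- move=> i ic; rewrite !updE; have [iE|ni] := eqVneq i cnt; last by apply: (act_dep A); lia.
  move: zp; have [c1|c1] := eqVneq cnt 1%N.
    by case=> -> ->; rewrite wt1 (act_dep0 A) (Dxx tm) addr0.
  case=> p0 z1 pz; rewrite (dep_step tm (z := z)); last by lia.
  by rewrite pz (act_dep A) //; lia.
- move=> i a ic aN; rewrite !(updE _ _ _ i); have [iE|ni] := eqVneq i cnt.
    move=> az; case: (child_spec lcs aN); rewrite az; first by constructor 3.
    by constructor 2.
  move=> ai; case: (act_child A _ aN ai) => [|[j jc ja]|aoc|az]; first by lia.
  + by constructor 1; exists j; [lia | rewrite old //; lia].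
  + by constructor 2.
  + by constructor 1; exists cnt; [lia | rewrite upd_eq az].
- move=> i ic; rewrite !(updE _ _ _ i); have [iE|ni] := eqVneq i cnt.
    move=> oz; have [oN opz _ _ _] := oc_spec lcs zN (introN eqP oz).
    split=> //; first exact: ocz_neq.
    move=> j jc; rewrite updE; have [_|nj] := eqVneq j cnt.
      by move=> zE; have := par_lt tm oN; rewrite opz -zE; lia.
    by apply: ndz => //; lia.
  move=> oi; have [|oE hE onz onj] := act_oc A (i := i) _ oi; first by lia.
  split=> //.
    move=> olc; have iN : (0 < nd i <= N)%N by apply: (act_nd A); lia.
    rewrite olc in oE oi; have [lN lz _] := lc_spec lcs zN (introN eqP oi).
    have [|_ oni _ _ _] := oc_spec lcs iN; first by rewrite -oE; lia.
    by case: (znd i); [lia | rewrite -oni -oE].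
  move=> j jc; rewrite updE; have [_|nj] := eqVneq j cnt; first by move/esym.
  by apply: onj; lia.
- move=> i ic; rewrite !(updE _ _ _ i); have [iE|ni] := eqVneq i cnt.
    by move=> oz; apply: (oc0_spec lcs).
  by apply: (act_oc0 A); lia.
- move=> l0; have [lN lz _] := lc_spec lcs zN (introN eqP l0).
  split; [by lia | by lia | | ].
    move=> j jc; rewrite updE; have [_|nj] := eqVneq j cnt.
      by move=> zE; have := par_lt tm lN; rewrite lz -zE; lia.
    by apply: ndz => //; lia.
  rewrite ifN; last by lia.
  by rewrite upd_eq; split=> //; lia.
Qed.

Section Complete.
Variables (cnt : nat) (nd pp ocp : nat -> nat) (dep hp : nat -> R) (p0 : nat).
Hypothesis A : active cnt nd pp ocp dep hp 0 p0.
Hypothesis cnt_gt1 : (1 < cnt)%N.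

Lemma anc_active i b : (0 < i < cnt)%N -> (0 < b < cnt)%N ->
  anc par (nd i) (nd b) -> anc pp i b.
Proof.
move=> ic; elim/ltn_ind: b => b IHb bc ib.
case: (anc_case ib) => [ib_eq|]; first by rewrite (act_inj A ic bc ib_eq); apply: anc_refl.
have [b1|b1] := leqP b 1.
  have -> : b = 1%N by lia.
  have [_ ->] := act_pos1 A cnt_gt1; rewrite (par1 tm) => /(anc0 tm).
  by have := act_nd A ic; lia.
have [|ppb ->] := act_pp A (i := b); first by lia.
by move=> ipb; apply: anc_trans (anc_par pp b); apply: IHb => //; lia.
Qed.

(** Positions inherit a tree metric from the nodes, so the lemmas on ancestors and cuts can be used
    for [pp] as well as for [par]. *)
Lemma active_metric :
  tree_metric cnt.-1 pp (fun i => wt (nd i)) (fun i j => D (nd i) (nd j)).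
Proof.
have [pp1 nd1] := act_pos1 A cnt_gt1.
split=> //.
- exact: act_pp0 A.
- by move=> z zc; have [] := act_pp A (i := z); lia.
- move=> z zc; apply: (wt_ge0 tm); have [|ppz pz] := act_pp A (i := z); first by lia.
  have nz : nd z <> 1%N by move=> nz; have := act_inj A (i := z) (j := 1%N); rewrite nd1; lia.
  by have := act_nd A (i := z); lia.
- by move=> x; rewrite (Dxx tm).
- by move=> x y; rewrite (Dsym tm).
- by move=> x y; rewrite (Dge0 tm).
- by move=> y x z; apply: (Dtri tm).
- move=> z b zc bc nzb; have [|ppz <-] := act_pp A (i := z); first by lia.
  apply: (Dcut tm).
  + have nz : nd z <> 1%N.
      by move=> nz; have := act_inj A (i := z) (j := 1%N); rewrite nd1; lia.
    by have := act_nd A (i := z); lia.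
  + by have := act_nd A (i := b); lia.
  + by move=> zb; apply: nzb; apply: anc_active => //; lia.
Qed.

Lemma active_cover v : (0 < v <= N)%N -> exists2 i, (0 < i < cnt)%N &
  v = nd i \/ ocp i <> 0%N /\ anc par (ocp i) v.
Proof.
elim/ltn_ind: v => v IHv vN; have [v1|v1] := leqP v 1.
  have [_ nd1] := act_pos1 A cnt_gt1.
  by exists 1%N; [lia | left; rewrite nd1; lia].
have vN' : (1 < v <= N)%N by lia.
have pv := par_lt tm vN'.
have [||i ic [pvi|[oi opv]]] := IHv (par v); [by lia | by lia | |]; last first.
  by exists i => //; right; split=> //; apply: anc_trans opv (anc_par par v).
case: (act_child A ic vN' pvi) => [[j jc <-]|vo|]; [by exists j => //; left| |by lia].
by exists i => //; right; rewrite -vo; split; [lia | apply: anc_refl].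
Qed.

(** Climbing from an active node meets active nodes only, and [ocp i] is not active. *)
Lemma unexplored_anc i j : (0 < i < cnt)%N -> ocp i <> 0%N -> (0 < j < cnt)%N ->
  ~ anc par (ocp i) (nd j).
Proof.
move=> ic oi; have [oE _ _ onj] := act_oc A ic oi.
elim/ltn_ind: j => j IHj jc oj; case: (anc_case oj) => [/esym|]; first exact: onj.
have [j1|j1] := leqP j 1.
  have -> : j = 1%N by lia.
  by have [_ ->] := act_pos1 A cnt_gt1; rewrite (par1 tm) => /(anc0 tm).
by have [|ppj ->] := act_pp A (i := j); [lia | apply: IHj; lia].
Qed.

Lemma unexplored_dist i v : (0 < i < cnt)%N -> ocp i <> 0%N ->
  (v <= N)%N -> anc par (ocp i) v -> D (nd i) v <= hp i.
Proof.
move=> ic oi vN ov; have [oE hE _ _] := act_oc A ic oi.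
have iN := act_nd A ic.
have [|oN opar _ ohE _] := oc_spec lcs iN; first by rewrite -oE; lia.
rewrite -oE in oN opar ohE.
rewrite (Dsym tm) (D_anc tm) //; [|by lia|]; last first.
  by apply: anc_trans ov; rewrite -opar; apply: anc_par.
have o0 : (0 < ocp i)%N by lia.
have v0 : (0 < v)%N by case: v ov {vN} => // /(anc0 tm).
have := dep_hgt_le o0 vN ov; rewrite (dep_step tm oN) opar hE ohE.
have v_ge0 : 0 <= hgt v by apply: hgt_ge0; rewrite v0.
by lra.
Qed.

(** This is why a search over active positions suffices. The right-hand side is attained, by a
    deepest node below the unexplored child or by [nd i] itself if there is none, so maximizing it
    yields a farthest node. *)
Lemma near_le_hanging ys v : (0 < v <= N)%N ->
  exists2 i, (0 < i < cnt)%N & near D ys v <= near D ys (nd i) + hp i.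
Proof.
move=> vN; have [i ic [->|[oi ov]]] := active_cover vN; exists i => //.
  rewrite lerDl; have [oi|/eqP oi] := eqVneq (ocp i) 0%N; first by rewrite (act_oc0 A ic oi).
  have [oE hE _ _] := act_oc A ic oi; have iN := act_nd A ic.
  have [|oN _ _ ohE _] := oc_spec lcs iN; first by rewrite -oE; lia.
  by rewrite hE ohE addr_ge0 ?hgt_ge0 ?(wt_ge0 tm) //; lia.
apply: le_trans (near_lip ys v (nd i) tm) _.
by rewrite lerD2l (Dsym tm) unexplored_dist //; lia.
Qed.

End Complete.

End ActiveTree.

(** * Linked lists and their topological order *)

Section LinkedList.
Implicit Types (nxt : nat -> nat) (ps : seq nat).

(** The end is marked by 0. In [pieces] the start [t] is 0 as well, a sentinel that makes insertion
    at the front an ordinary insertion. *)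
Fixpoint linked nxt t ps : Prop :=
  if ps is u :: ps' then nxt t = u /\ linked nxt u ps' else nxt t = 0%N.

Lemma eq_linked nxt nxt' t ps : {in t :: ps, nxt =1 nxt'} ->
  linked nxt t ps -> linked nxt' t ps.
Proof.
elim: ps t => [|u ps IHps] t eq_nxt /=; first by rewrite eq_nxt ?mem_head.
case=> tu ups; split; first by rewrite -eq_nxt ?mem_head.
by apply: IHps ups => x xps; apply: eq_nxt; rewrite inE xps orbT.
Qed.

Lemma linked_insert nxt t q1 q2 l : linked nxt t (q1 ++ q2) ->
  uniq (t :: q1 ++ q2) -> l \notin t :: q1 ++ q2 ->
  linked (upd (upd nxt l (nxt (last t q1))) (last t q1) l) t (q1 ++ l :: q2).
Proof.
elim: q1 t => [|u q1 IHq] t /=.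
  move=> tq2 /andP[tq _]; rewrite inE negb_or => /andP[lt lq].
  rewrite upd_eq; split=> //.
  case: q2 => [|u q2] in tq2 tq lq *; rewrite /= upd_neq // upd_eq //.
  case: tq2 => tu uq2; split=> //; apply: eq_linked uq2 => x xq.
  rewrite !upd_neq //; [by apply: contraNneq lq => <- | by apply: contraNneq tq => <-].
move=> [tu uq] /andP[tq uq12] lq.
have lt : t != last u q1.
  by apply: contraNneq tq => ->; rewrite -cat_cons mem_cat mem_last.
rewrite upd_neq // upd_neq; last by apply: contraNneq lq => ->; rewrite mem_head.
by split=> //; apply: IHq => //; apply: contra lq => lq; rewrite inE lq orbT.
Qed.

Lemma uniq_insert (t : nat) q1 q2 l :
  uniq (t :: q1 ++ l :: q2) = (l \notin t :: q1 ++ q2) && uniq (t :: q1 ++ q2).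
Proof.
have pm : perm_eq (t :: q1 ++ l :: q2) (l :: t :: q1 ++ q2).
  rewrite -[t :: q1 ++ _]/((t :: q1) ++ l :: q2) perm_catC /= perm_cons perm_catC.
  by rewrite /=.
by rewrite (perm_uniq pm).
Qed.

(** [B] accumulates the bottoms of the paths already listed. Starting from position 0 alone, it
    expresses that each path hangs from the root copy or from the bottom of an earlier path. *)
Fixpoint topo (pp bot : nat -> nat) (B : nat -> Prop) ps : Prop :=
  if ps is t :: ps' then B (pp t) /\ topo pp bot (fun y => B y \/ y = bot t) ps'
  else True.

Lemma topo_mono pp bot bot' (B B' : nat -> Prop) ps :
  {in ps, bot =1 bot'} -> (forall y, B y -> B' y) ->
  topo pp bot B ps -> topo pp bot' B' ps.
Proof.
elim: ps B B' => //= t ps IHps B B' eq_bot BB' [Bt tps]; split; first exact: BB'.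
apply: IHps tps => [x xps|y [/BB'|->]]; first by apply: eq_bot; rewrite inE xps orbT.
  by left.
by right; apply: eq_bot; rewrite mem_head.
Qed.

Lemma topo_cat pp bot B q1 q2 : topo pp bot B (q1 ++ q2) <->
  topo pp bot B q1 /\ topo pp bot (fun y => B y \/ exists2 t, t \in q1 & y = bot t) q2.
Proof.
elim: q1 B => [|t q1 IHq] B /=.
  split=> [q2_t|[_ q2_t]]; first split=> //.
    by apply: topo_mono q2_t => // y; left.
  by apply: topo_mono q2_t => // y [//|[t]]; rewrite in_nil.
rewrite IHq; split=> [[Bt [q1_t q2_t]]|[[Bt q1_t] q2_t]]; split=> //; try split=> //.
  apply: topo_mono q2_t => // y [[By|->]|[x xq ->]]; first by left.
    by right; exists t; rewrite ?mem_head.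
  by right; exists x; rewrite // inE xq orbT.
apply: topo_mono q2_t => // y [By|[x]]; first by left; left.
rewrite inE => /predU1P[-> ->|xq ->]; first by left; right.
by right; exists x.
Qed.

End LinkedList.

(** * Cutting the active tree into vertical paths *)

Section Pieces.
Implicit Types (lim S : nat) (pp bot top nxt : nat -> nat) (ps : seq nat).

(* The positions 1, ..., lim - 1 are divided into vertical paths t, ..., bot t of at
   most S consecutive positions, listed so that upper paths precede lower ones. *)
Record pieces lim S pp bot top nxt ps : Prop := Pieces {
  pc_linked : linked nxt 0 ps;
  pc_uniq : uniq (0%N :: ps);
  pc_topo : topo pp bot (fun y => y = 0%N) ps;
  pc_in : forall t, t \in ps ->
    [/\ (0 < t <= bot t)%N, (bot t < lim)%N, top (bot t) = t & (bot t < t + S)%N];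
  pc_chain : forall t i, t \in ps -> (t < i <= bot t)%N -> pp i = i.-1;
  pc_cover : forall i, (0 < i < lim)%N -> exists2 t, t \in ps & (t <= i <= bot t)%N;
  pc_disj : forall t t' i, t \in ps -> t' \in ps -> (t <= i <= bot t)%N ->
    (t' <= i <= bot t')%N -> t = t' }.

Lemma pieces_start S pp bot top nxt : nxt 0%N = 0%N -> pieces 1 S pp bot top nxt [::].
Proof. by move=> nxt0; split=> // i; lia. Qed.

Lemma pieces_append lim S pp bot top nxt q1 q2 r :
  pieces lim S pp bot top nxt (q1 ++ q2) -> (0 < lim <= r)%N -> (r < lim + S)%N ->
  (forall i, (lim < i <= r)%N -> pp i = i.-1) ->
  pp lim = 0%N \/ (exists2 t, t \in q1 & pp lim = bot t) ->
  pieces r.+1 S pp (upd bot lim r) (upd top r lim)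
    (upd (upd nxt lim (nxt (last 0%N q1))) (last 0%N q1) lim) (q1 ++ lim :: q2).
Proof.
move=> P lim_r rS chain_r hang.
have in_q t : (t \in q1 ++ lim :: q2) = (t == lim) || (t \in q1 ++ q2).
  by rewrite !mem_cat inE; case: (t == lim); case: (t \in q1).
have lim_q : lim \notin q1 ++ q2.
  by apply/negP => /(pc_in P)[]; lia.
have old t : t \in q1 ++ q2 -> upd bot lim r t = bot t.
  by move=> tq; rewrite upd_neq //; apply: contraTneq tq => ->.
split.
- apply: linked_insert (pc_linked P) (pc_uniq P) _.
  by rewrite inE negb_or lim_q andbT; lia.
- by rewrite uniq_insert inE negb_or lim_q (pc_uniq P) !andbT; lia.
- have := pc_topo P; rewrite !topo_cat /= => -[q1_t q2_t]; split; last split.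
  + by apply: topo_mono q1_t => // t tq; rewrite old // mem_cat tq.
  + case: hang => [->|[t tq ->]]; first by left.
    by right; exists t; rewrite ?old // mem_cat tq.
  + apply: topo_mono q2_t => [t tq|y [->|[t tq ->]]]; first by rewrite old // mem_cat tq orbT.
      by left; left.
    by left; right; exists t; rewrite ?old // mem_cat tq.
- move=> t; rewrite in_q => /predU1P[->|tq].
    by rewrite !upd_eq; split; lia.
  rewrite old //; have [? ? tE ?] := pc_in P tq.
  by rewrite upd_neq ?tE; [split; lia | lia].
- move=> t i; rewrite in_q => /predU1P[->|tq]; first by rewrite upd_eq; apply: chain_r.
  by rewrite old //; apply: (pc_chain P).
- move=> i ir; have [il|il] := ltnP i lim.
    have [|t tq ti] := pc_cover P (i := i); first by lia.
    by exists t; rewrite ?in_q ?tq ?orbT // old.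
  by exists lim; rewrite ?in_q ?eqxx // upd_eq; lia.
- move=> t t' i; rewrite !in_q => /predU1P[->|tq] /predU1P[->|tq'] //.
  + by rewrite upd_eq old // => ? ?; have [] := pc_in P tq'; lia.
  + by rewrite upd_eq old // => ? ?; have [] := pc_in P tq; lia.
  + by rewrite !old //; apply: (pc_disj P).
Qed.

(** The upper half keeps its top [l] and the lower half keeps the old bottom, so whatever hung from
    that bottom is not affected. The lower half hangs from [w] and is listed right after the upper
    one. *)
Lemma pieces_split lim S pp bot top nxt q1 q2 l w :
  pieces lim S pp bot top nxt (q1 ++ l :: q2) -> (l <= w < bot l)%N ->
  pieces lim S pp (upd (upd bot l w) w.+1 (bot l)) (upd (upd top w l) (bot l) w.+1)
    (upd (upd nxt w.+1 (nxt l)) l w.+1) (q1 ++ l :: w.+1 :: q2).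
Proof.
move=> P lw; set ps := q1 ++ l :: q2 in P; set ps' := q1 ++ _.
have lps : l \in ps by rewrite mem_cat mem_head orbT.
have [l_gt0 bl topl Sl] := pc_in P lps.
have in_q t : (t \in ps') = (t == w.+1) || (t \in ps).
  by rewrite !mem_cat !inE; case: (t == w.+1); case: (t \in q1); case: (t == l).
have w_ps : w.+1 \notin ps.
  apply/negP => wps; have [? _ _ _] := pc_in P wps.
  by have := pc_disj P (i := w.+1) lps wps; lia.
have old t : t \in ps -> t != l -> upd (upd bot l w) w.+1 (bot l) t = bot t.
  by move=> tq tl; rewrite !upd_neq //; apply: contraTneq tq => ->.
have botl : upd (upd bot l w) w.+1 (bot l) l = w.
  by rewrite upd_neq ?upd_eq //; lia.
have := pc_uniq P; rewrite /= cat_uniq /= => /andP[_ /and4P[uq1 q1l lq2 uq2]].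
have lq1 : l \notin q1 by move: q1l; rewrite negb_or => /andP[].
split.
- have := @linked_insert nxt 0 (q1 ++ [:: l]) q2 w.+1.
  rewrite -!catA /= last_cat /=; apply; [exact: pc_linked P|exact: pc_uniq P|].
  by rewrite inE.
- have := uniq_insert 0 (q1 ++ [:: l]) q2 w.+1; rewrite -!catA /= => ->.
  by rewrite inE w_ps -[l :: q2]/([:: l] ++ q2) /=; apply: pc_uniq P.
- have := pc_topo P; rewrite !topo_cat /= botl upd_eq => -[q1_t [l_t q2_t]].
  have old1 t : t \in q1 -> upd (upd bot l w) w.+1 (bot l) t = bot t.
    by move=> tq; apply: old; [rewrite mem_cat tq | apply: contraNneq lq1 => <-].
  have mono1 y : y = 0%N \/ (exists2 t, t \in q1 & y = bot t) -> y = 0%N \/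
      (exists2 t, t \in q1 & y = upd (upd bot l w) w.+1 (bot l) t).
    by case=> [->|[t tq ->]]; [left | right; exists t; rewrite ?old1].
  split; [|split; [exact: mono1|split]].
  + by apply: topo_mono q1_t => // t tq; rewrite old1.
  + by right; apply: (pc_chain P lps); lia.
  + apply: topo_mono q2_t => [t tq|y [/mono1|->]]; last by right.
      by rewrite old ?mem_cat ?inE ?tq ?orbT //; apply: contraNneq lq2 => <-.
    by left; left.
all: clear uq1 q1l lq2 uq2 lq1; clearbody ps ps'.
- move=> t; rewrite in_q => /predU1P[->|tq].
    by rewrite !upd_eq; split; lia.
  have [->|tl] := eqVneq t l.
    by rewrite botl (upd_neq _ _ (_ : w != bot l)) ?upd_eq; [split|]; lia.
  rewrite old //; have [t0 ? tE ?] := pc_in P tq; rewrite !upd_neq ?tE //.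
    by apply: contraNneq tl => bt; rewrite (pc_disj P (i := w) tq lps) //; lia.
  by apply: contraNneq tl => bt; rewrite (pc_disj P (i := bot t) tq lps) //; lia.
- move=> t i; rewrite in_q => /predU1P[->|tq].
    by rewrite upd_eq => ?; apply: (pc_chain P lps); lia.
  have [->|tl] := eqVneq t l; last by rewrite old //; apply: (pc_chain P tq).
  by rewrite botl => ?; apply: (pc_chain P lps); lia.
- move=> i ir; have [t tq ti] := pc_cover P ir.
  have [tl|tl] := eqVneq t l; last by exists t; rewrite ?in_q ?tq ?orbT // old.
  rewrite tl in ti; have [iw|iw] := leqP i w.
    by exists l; rewrite ?in_q ?lps ?orbT // botl; lia.
  by exists w.+1; rewrite ?in_q ?eqxx // upd_eq; lia.
- have inl t i : t \in ps -> t != l -> (l <= i <= bot l)%N -> ~ (t <= i <= bot t)%N.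
    by move=> tq tl il ti; case/eqP: tl; apply: (pc_disj P) ti il.
  move=> t t' i; rewrite !in_q => /predU1P[->|tq] /predU1P[->|tq'] //.
  + rewrite upd_eq; have [->|tl] := eqVneq t' l; first by rewrite botl; lia.
    by rewrite old // => ? /inl; case=> //; lia.
  + rewrite upd_eq; have [->|tl] := eqVneq t l; first by rewrite botl; lia.
    by rewrite old // => /inl ti ?; case: ti => //; lia.
  + have [->|tl] := eqVneq t l; have [->|tl'] := eqVneq t' l => //; rewrite ?botl ?old //.
    * by move=> ? /inl; case=> //; lia.
    * by move=> /inl ti ?; case: ti => //; lia.
    * exact: (pc_disj P).
Qed.

End Pieces.

(** * Distances to the picks along a path *)

Section NearOnPieces.
Context {R : realType}.
Variables (N : nat) (par : nat -> nat) (wt : nat -> R) (D : nat -> nat -> R).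
Variables (lc oc : nat -> nat) (hgt ohgt : nat -> R).
Hypothesis tm : tree_metric N par wt D.
Variables (cnt S : nat) (nd pp ocp : nat -> nat) (dep hp : nat -> R) (p0 : nat).
Variables (bot top nxt : nat -> nat) (ps : seq nat).
Hypothesis A : active N par D oc ohgt cnt nd pp ocp dep hp 0 p0.
Hypothesis cnt_gt1 : (1 < cnt)%N.
Hypothesis P : pieces cnt S pp bot top nxt ps.

Let N_gt0 : (0 < N)%N. Proof. by have := act_nd A (i := 1); lia. Qed.
Let ptm := active_metric tm N_gt0 A cnt_gt1.
Let E i j := D (nd i) (nd j).

Let nd1 : nd 1%N = 1%N. Proof. by have [] := act_pos1 A cnt_gt1. Qed.

Lemma pos_dep i : (i < cnt)%N -> dep i = D 1 (nd i).
Proof.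
case: i => [_|i ic]; first by rewrite (act_dep0 A) (act_nd0 A) (Dxx tm).
exact: (act_dep A).
Qed.

Lemma pos_depE i : (i < cnt)%N -> dep i = E 1 i.
Proof. by move=> ic; rewrite pos_dep // /E nd1. Qed.

Lemma iter_pp t i : t \in ps -> (t <= i <= bot t)%N -> iter (i - t) pp i = t.
Proof.
move=> tps; move ed: (i - t)%N => d; elim: d i ed => [|d IHd] i ed ti /=; first by lia.
rewrite -iterS iterSr (pc_chain P tps); last by lia.
by rewrite IHd; lia.
Qed.

Lemma anc_piece t i j : t \in ps -> (t <= i <= j)%N -> (j <= bot t)%N -> anc pp i j.
Proof.
move=> tps tij jt; exists (j - i)%N; move ed: (j - i)%N => d.
elim: d j ed tij jt => [|d IHd] j ed tij jt /=; first by lia.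
rewrite -iterS iterSr (pc_chain P tps); last by lia.
by rewrite IHd; lia.
Qed.

Lemma chain_exit t b i : t \in ps -> (t <= b <= bot t)%N -> (i < t)%N ->
  anc pp i b -> anc pp i (pp t).
Proof.
move=> tps tb it [m mi]; have [mb|mb] := leqP m (b - t).
  have ai : anc pp t i.
    exists (b - t - m)%N; rewrite -mi -iterD subnK //; exact: iter_pp.
  have bc : (b < cnt)%N by have [] := pc_in P tps; lia.
  have ib : (i <= b)%N by lia.
  by have := anc_le ptm _ ai; lia.
exists (m - (b - t).+1)%N.
have -> : pp t = iter (b - t).+1 pp b by rewrite iterS (iter_pp tps tb).
by rewrite -iterD subnK.
Qed.

(** Paths hang from bottoms only, so a descent that enters a path at its top can leave it only
    through its bottom. *)
Lemma bottom_below l t : l \in ps -> t \in ps -> anc pp l (bot t) -> anc pp (bot l) (bot t).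
Proof.
move=> lps; move: {2}(bot t) (erefl (bot t)) => b.
elim/ltn_ind: b t => b IHb t bt tps lb.
have [t_gt0 t_lt _ _] := pc_in P tps; have [l_gt0 l_lt _ _] := pc_in P lps.
have [lt|tl] := ltnP l t; last first.
  have lE : t = l.
    apply: (pc_disj P (i := l) tps lps); last by lia.
    by have := anc_le ptm _ lb; lia.
  by rewrite lE; apply: anc_refl.
have lpt : anc pp l (pp t) by apply: chain_exit lt lb => //; lia.
have ptb : anc pp (pp t) (bot t).
  apply: anc_trans (anc_par pp t) _; apply: (anc_piece tps); lia.
apply: anc_trans ptb.
have /pc_topo := P; rewrite -(cat_take_drop (index t ps) ps) topo_cat.
rewrite (drop_nth 0%N) ?index_mem // nth_index //= => -[_ [[pt0|[t' t'ps ptE]] _]].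
  by rewrite pt0 in lpt; have := anc0 ptm lpt; lia.
rewrite ptE; apply: (IHb (bot t') _ t' erefl); rewrite -?ptE //; last exact: mem_take t'ps.
have t1 : (1 < t)%N by lia.
have [|? _] := act_pp A (i := t); first by lia.
by lia.
Qed.

Lemma bottom_step t t' : t \in ps -> t' \in ps -> anc pp (bot t') (bot t) ->
  bot t' = bot t \/ anc pp (bot t') (pp t).
Proof.
move=> tps t'ps bb; have [? ? _ _] := pc_in P tps; have [? ? _ _] := pc_in P t'ps.
have le_b : (bot t' <= bot t)%N by apply: (anc_le ptm _ bb); lia.
have [lt|tl] := ltnP (bot t') t; first by right; apply: chain_exit lt bb => //; lia.
by left; rewrite (pc_disj P (i := bot t') t'ps tps) //; lia.
Qed.

Lemma pp_cases t : t \in ps -> t = 1%N \/ (1 < t)%N.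
Proof. by move=> /(pc_in P)[]; lia. Qed.

Lemma dist_up t i : t \in ps -> (t <= i <= bot t)%N -> D (nd i) (nd (pp t)) = dep i - dep (pp t).
Proof.
move=> tps ti; have [? ? _ _] := pc_in P tps; case: (pp_cases tps) => t1.
  rewrite t1; have [-> _] := act_pos1 A cnt_gt1.
  by rewrite (act_nd0 A) (act_dep0 A) subr0 (Dsym tm) pos_dep //; lia.
have [|? _] := act_pp A (i := t); first by lia.
have := D_anc ptm (z := pp t) (a := i); rewrite nd1 -!pos_dep; try lia.
apply; [by lia|by lia|].
apply: anc_trans (anc_par pp t) _; apply: (anc_piece tps); lia.
Qed.

Lemma dist_down t i : t \in ps -> (t <= i <= bot t)%N ->
  D (nd (bot t)) (nd i) = dep (bot t) - dep i.
Proof.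
move=> tps ti; have [? ? _ _] := pc_in P tps.
rewrite !pos_depE; [|by lia|by lia].
apply: (D_anc ptm); [by lia|by lia|].
by apply: (anc_piece tps); lia.
Qed.

Lemma dep_mono t i j : t \in ps -> (t <= i <= j)%N -> (j <= bot t)%N -> dep i <= dep j.
Proof.
move=> tps tij jt; have [? ? _ _] := pc_in P tps.
rewrite !pos_depE; [|by lia|by lia].
by apply: (dep_le ptm); [lia|lia|apply: (anc_piece tps)].
Qed.

Lemma dist_exit t b i : t \in ps -> (t <= i <= bot t)%N -> (0 < b < cnt)%N ->
  ~ anc pp t b -> D (nd i) (nd b) = dep i - dep (pp t) + D (nd (pp t)) (nd b).
Proof.
move=> tps ti bc ntb; have [? ? _ _] := pc_in P tps; case: (pp_cases tps) => t1.
  by case: ntb; rewrite t1; apply: (anc_root ptm); lia.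
have [|? _] := act_pp A (i := t); first by lia.
rewrite !pos_depE; [|by lia|by lia].
by apply: (D_cut ptm) => //; [lia|lia|apply: (anc_piece tps); lia].
Qed.

Section Picks.
Variable ys : seq nat.
Hypothesis ys_bot : forall y, y \in ys -> exists2 t, t \in ps & nd (bot t) = y.
Let f := near D ys.

(** Apart from the root, picks sit at bottoms, never strictly inside a path. From [i] one therefore
    reaches a pick either through the parent of the top, at a cost increasing with the depth, or
    through the bottom, at a decreasing cost. *)
Lemma near_piece t i : t \in ps -> (t <= i <= bot t)%N ->
  f (nd i) = Num.min (f (nd (pp t)) - dep (pp t) + dep i)
                     (f (nd (bot t)) + dep (bot t) - dep i).
Proof.
move=> tps ti; have [? ? _ _] := pc_in P tps.
have up := near_lip ys (nd i) (nd (pp t)) tm; rewrite dist_up // in up.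
have down := near_lip ys (nd i) (nd (bot t)) tm.
rewrite (Dsym tm) dist_down // in down.
apply/le_anti/andP; split; first by rewrite le_min /f; apply/andP; split; lra.
rewrite ge_min; apply/orP.
case: (near_attained D ys (nd i)) => [fE|[y yys fE]]; rewrite /f fE.
  left; have := near_le1 D ys (nd (pp t)).
  have ppt : (pp t < cnt)%N.
    case: (pp_cases tps) => t1; last by have [|? _] := act_pp A (i := t); lia.
    by rewrite t1; have [-> _] := act_pos1 A cnt_gt1; lia.
  by rewrite !(Dsym tm _ 1) -!pos_dep //; [lra|lia].
have [t' t'ps yE] := ys_bot yys; have [? ? _ _] := pc_in P t'ps.
rewrite -yE in yys fE *.
(* A pick in the subtree of [t] lies below [bot t] by [bottom_below]; for any other pick the path
   from [i] climbs to [pp t]. *)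
case: (boolp.pselect (anc pp t (bot t'))) => [tb|ntb].
  right; have := near_le D (nd (bot t)) yys.
  have [ib|ib] := eqVneq i (bot t); first by rewrite ib; lra.
  have rb := bottom_below tps t'ps tb.
  have t1 : (1 < bot t)%N by lia.
  have := D_cut ptm (z := bot t) (a := bot t') (b := i) t1.
  rewrite nd1 (pc_chain P tps (i := bot t)); last by lia.
  have := D_anc ptm (z := bot t) (a := bot t'); rewrite nd1.
  have := D_anc ptm (z := i) (a := (bot t).-1); rewrite nd1.
  rewrite -!pos_dep; try lia.
  rewrite (Dsym tm (nd i)) (Dsym tm (nd (bot t))) => h1 h2 h3.
  have {}h1 := h1 _ _ _; rewrite h1 in h3; [|by lia|by lia|apply: (anc_piece tps); lia].
  rewrite h2; [|by lia|by lia|exact: rb].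
  rewrite h3; [by lra|by lia|by lia|exact: rb|].
  by move=> bi; have := anc_le ptm _ bi; lia.
left; have := near_le D (nd (pp t)) yys.
by rewrite (dist_exit tps ti _ ntb); [lra|lia].
Qed.

(* F may exceed f only at bottoms whose nearest pick is reached through the
   parent piece, and the next pass corrects it there. *)
Definition prefit (g F : nat -> R) : Prop := forall t, t \in ps ->
  g (nd (bot t)) <= F (bot t) /\ (F (bot t) = g (nd (bot t)) \/
  g (nd (bot t)) = g (nd (pp t)) + dep (bot t) - dep (pp t)).

(** For a bottom above the new pick, the new distance is a difference of depths and the climb
    records it. For any other bottom, the way to the new pick goes through the parent of its path,
    so an improvement that [F'] misses falls under the second alternative of [prefit]. *)
Lemma prefit_climb (x : nat) (F F' : nat -> R) : x \in ps ->
  prefit f F ->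
  (forall t, t \in ps -> anc pp (bot t) (bot x) ->
     F' (bot t) = Num.min (F (bot t)) (dep (bot x) - dep (bot t))) ->
  (forall t, t \in ps -> ~ anc pp (bot t) (bot x) -> F' (bot t) = F (bot t)) ->
  prefit (near D (rcons ys (nd (bot x)))) F'.
Proof.
move=> xps fit F'anc F'nanc t tps; have [? ? _ _] := pc_in P tps.
have [? ? _ _] := pc_in P xps.
have [le_F F_eq] := fit t tps.
have lip : near D (rcons ys (nd (bot x))) (nd (bot t)) <=
    near D (rcons ys (nd (bot x))) (nd (pp t)) + (dep (bot t) - dep (pp t)).
  by rewrite -dist_up //; [apply: near_lip tm | lia].
move: lip; rewrite !near_rcons -/f => lip.
case: (boolp.pselect (anc pp (bot t) (bot x))) => [bx|nbx].
  have dE : D (nd (bot t)) (nd (bot x)) = dep (bot x) - dep (bot t).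
    rewrite (Dsym tm) !pos_depE; [|by lia|by lia].
    by apply: (D_anc ptm) => //; lia.
  rewrite F'anc // dE in lip *; move: lip le_F F_eq.
  move: (f (nd (bot t))) (F (bot t)) (f (nd (pp t))) (D (nd (pp t)) _) => a b c e.
  move: (dep (bot x) - dep (bot t)) => d + le_F H.
  case: (leP a d) => ?; case: (leP b d) => ?; case: (leP c e) => ? lip;
    (split; [lra | by case: H => ?; first [left; lra | right; lra]]).
rewrite F'nanc // (dist_exit tps _ _ (b := bot x)) in lip *; try lia; last first.
  by move=> tx; apply: nbx; apply: bottom_below.
move: lip le_F F_eq.
move: (f (nd (bot t))) (F (bot t)) (f (nd (pp t))) (D (nd (pp t)) _) => a b c e.
move=> + le_F H; case: (leP a _) => ?; case: (leP c e) => ? lip;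
  (split; [lra | by case: H => ?; first [left; lra | right; lra]]).
Qed.

End Picks.

End NearOnPieces.

(** * Program logic *)

Section Logic.
Context {R : realType}.
Variables (W : nat) (orc : nat -> nat -> R).
Implicit Types (p q : cmd) (s : state R) (Q : nat -> state R -> Prop).

(* Started in s with a budget of T steps, p halts and Q holds of the unspent
   budget and the final state. *)
Definition wp p s (T : nat) Q : Prop :=
  exists t s', [/\ exec W orc p s t s', (t <= T)%N & Q (T - t)%N s'].

Lemma wp_conseq p s T Q Q' : wp p s T Q -> (forall T' s', Q T' s' -> Q' T' s') ->
  wp p s T Q'.
Proof. by move=> [t [s' [e tT Qs]]] QQ'; exists t, s'; split=> //; apply: QQ'. Qed.

Lemma wp_skip s T Q : (0 < T)%N -> Q T.-1 s -> wp Skip s T Q.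
Proof. by move=> T0 Qs; exists 1%N, s; split; rewrite ?subn1 //; constructor. Qed.

Lemma wp_wset x e v s T Q : weval W s e = v -> (0 < T)%N ->
  Q T.-1 (set_wvar s x v) -> wp (WSet x e) s T Q.
Proof.
by move=> <- T0 Qs; exists 1%N, (set_wvar s x (weval W s e)); split;
  rewrite ?subn1 //; constructor.
Qed.

Lemma wp_wput a e1 e2 i v s T Q : weval W s e1 = i -> weval W s e2 = v ->
  (0 < T)%N -> Q T.-1 (set_warr s a i v) -> wp (WPut a e1 e2) s T Q.
Proof.
by move=> <- <- T0 Qs; exists 1%N, (set_warr s a (weval W s e1) (weval W s e2)); split;
  rewrite ?subn1 //; constructor.
Qed.

Lemma wp_cset x e v s T Q : ceval W orc s e = v -> (0 < T)%N ->
  Q T.-1 (set_cvar s x v) -> wp (CSet x e) s T Q.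
Proof.
by move=> <- T0 Qs; exists 1%N, (set_cvar s x (ceval W orc s e)); split;
  rewrite ?subn1 //; constructor.
Qed.

Lemma wp_cput a e1 e2 i v s T Q : weval W s e1 = i -> ceval W orc s e2 = v ->
  (0 < T)%N -> Q T.-1 (set_carr s a i v) -> wp (CPut a e1 e2) s T Q.
Proof.
by move=> <- <- T0 Qs; exists 1%N, (set_carr s a (weval W s e1) (ceval W orc s e2)); split;
  rewrite ?subn1 //; constructor.
Qed.

Lemma wp_seq p q s T Q : wp p s T (fun T' s' => wp q s' T' Q) -> wp (Seq p q) s T Q.
Proof.
move=> [t [s' [e tT [t' [s'' [e' tT' Qs]]]]]]; exists (t + t')%N, s''.
by split; [apply: ExecSeq e e' | lia | rewrite subnDA].
Qed.

Lemma wp_if b p q s T Q c : beval W orc s b = c -> (0 < T)%N ->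
  (c -> wp p s T.-1 Q) -> (~~ c -> wp q s T.-1 Q) -> wp (If b p q) s T Q.
Proof.
move=> bc T0 p_ok q_ok; case: c bc p_ok q_ok => bc.
  move=> /(_ isT) [t [s' [e tT Qs]]] _; exists t.+1, s'.
  by split; [apply: ExecIfT | lia | have -> : (T - t.+1 = T.-1 - t)%N by lia].
move=> _ /(_ isT) [t [s' [e tT Qs]]]; exists t.+1, s'.
by split; [apply: ExecIfF; rewrite ?bc | lia | have -> : (T - t.+1 = T.-1 - t)%N by lia].
Qed.

(* The budget bounds the number of iterations, so it serves as the variant. *)
Lemma wp_while_aux (I : nat -> state R -> Prop) b p s T Q : I T s ->
  (forall T s, I T s -> (0 < T)%N /\
     if beval W orc s b then wp p s T.-1 I else Q T.-1 s) ->
  wp (While b p) s T Q.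
Proof.
move=> + Iok; elim/ltn_ind: T s => T IHT s /Iok [T0].
case: ifP => [bT [t [s' [e tT Is]]]|bF Qs].
  have [|t' [s'' [e' tT' Qs]]] := IHT _ _ _ Is; first by lia.
  exists (t + t').+1, s''; split; [exact: ExecWhileT e e' | by lia |].
  by have -> : (T - (t + t').+1 = T.-1 - t - t')%N by lia.
by exists 1%N, s; split; [apply: ExecWhileF; rewrite bF | | rewrite subn1].
Qed.

(** The tags 0, 1, 2 and 3 stand for word variables, word arrays, cost variables and cost arrays. *)
Fixpoint writes p : seq (nat * nat) :=
  match p with
  | Skip => [::]
  | WSet x _ => [:: (0, x)]
  | WPut a _ _ => [:: (1, a)]
  | CSet x _ => [:: (2, x)]
  | CPut a _ _ => [:: (3, a)]
  | Seq p q => writes p ++ writes q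
  | If _ p q => writes p ++ writes q
  | While _ p => writes p
  end%N.

Record frame p s s' : Prop := Frame {
  fr_wvar : forall x, (0%N, x) \notin writes p -> wvar s' x = wvar s x;
  fr_warr : forall x, (1%N, x) \notin writes p -> warr s' x = warr s x;
  fr_cvar : forall x, (2%N, x) \notin writes p -> cvar s' x = cvar s x;
  fr_carr : forall x, (3%N, x) \notin writes p -> carr s' x = carr s x }.

Lemma exec_frame p s t s' : exec W orc p s t s' -> frame p s s'.
Proof.
have neq (k x y : nat) : ((k, x) \notin [:: (k, y)]) -> x != y.
  by rewrite inE; apply: contraNneq => ->.
elim=> {p s t s'} /=.
- by move=> s; split.
- by move=> x e s; split=> //= y /neq yx; rewrite upd_neq.
- by move=> x e e' s; split=> //= y /neq yx; rewrite upd_neq.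
- by move=> x e s; split=> //= y /neq yx; rewrite upd_neq.
- by move=> x e e' s; split=> //= y /neq yx; rewrite upd_neq.
- move=> p q s t s' t' s'' _ [? ? ? ?] _ [? ? ? ?].
  by split=> x; rewrite /= mem_cat negb_or => /andP[? ?]; eauto using eq_trans.
- move=> b p q s t s' _ _ [? ? ? ?].
  by split=> x; rewrite /= mem_cat negb_or => /andP[? ?]; eauto.
- move=> b p q s t s' _ _ [? ? ? ?].
  by split=> x; rewrite /= mem_cat negb_or => /andP[? ?]; eauto.
- move=> b p s t s' t' s'' _ _ [? ? ? ?] _ [? ? ? ?].
  by split=> x xp; eauto using eq_trans.
- by move=> b p s _; split.
Qed.

Lemma wp_frame p s T Q : wp p s T (fun T' s' => frame p s s' -> Q T' s') -> wp p s T Q.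
Proof.
by move=> [t [s' [e tT Qs]]]; exists t, s'; split=> //; apply: Qs; apply: exec_frame e.
Qed.

Lemma frame_trans p q s s' s'' : (forall x, x \in writes q -> x \in writes p) ->
  frame p s s' -> frame q s' s'' -> frame p s s''.
Proof.
move=> sub [? ? ? ?] [? ? ? ?].
have nsub x : x \notin writes p -> x \notin writes q by apply/contra/sub.
by split=> x xp; eauto using eq_trans.
Qed.

(** The frame relative to the state before the loop is supplied at every iteration, so an invariant
    need not record what the loop leaves alone. *)
Lemma wp_while (I : nat -> state R -> Prop) b p s T Q : I T s ->
  (forall T' s', I T' s' -> frame (While b p) s s' -> (0 < T')%N /\
     if beval W orc s' b then wp p s' T'.-1 I else Q T'.-1 s') ->
  wp (While b p) s T Q.
Proof.
move=> Is Iok; apply: (wp_while_aux (I := fun T' s' => I T' s' /\ frame (While b p) s s')).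
  by split=> //; split.
move=> T' s' [Is' Fr]; have [T'0 body] := Iok _ _ Is' Fr; split=> //.
case: ifP body => // _ body; apply: wp_frame; apply: wp_conseq body _.
by move=> T'' s'' Is'' Fr'; split=> //; apply: frame_trans Fr Fr'.
Qed.

End Logic.

Ltac lookup :=
  cbn [set_wvar set_warr set_cvar set_carr wvar warr cvar carr weval ceval beval];
  repeat match goal with
  | |- context [upd ?f ?i ?a ?j] =>
      let b := eval vm_compute in (Nat.eqb j i) in
      match b with
      | true => change (upd f i a j) with a
      | false => change (upd f i a j) with (f j)
      end
  | H : wvar ?s ?x = _ |- context [wvar ?s ?x] => rewrite H
  | H : cvar ?s ?x = _ |- context [cvar ?s ?x] => rewrite H
  end.

Ltac ev := lookup;
  repeat match goal with
  | |- context [modn ?a ?w] =>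
      lazymatch a with
      | context [modn _ _] => fail
      | _ => rewrite (@modn_small a w); [ | lia ]
      end
  end.

Ltac wset := apply: wp_wset; [ev; reflexivity | lia | ].
Ltac wput := apply: wp_wput; [ev; reflexivity | ev; reflexivity | lia | ].
Ltac cset := apply: wp_cset; [ev; reflexivity | lia | ].
Ltac cput := apply: wp_cput; [ev; reflexivity | ev; reflexivity | lia | ].
Ltac wif := apply: wp_if; [ev; reflexivity | lia | | ].

(* Word variables: 0 n, 1 k, 2 the first vertex, 3 the bit length L of n, 4 the
   maximal piece size S, 11 the number of used positions, 12 the number of
   picks made.  Word arrays: 0 offsets, 1 targets, 2-3 output, 4 visited marks,
   6 par, 7 the vertex of a node, 8 lc, 9 oc, 10 nd, 11 pp, 12 ocp, 13 bot,
   14 top, 15 nxt, 16-17 positions of prefix and suffix maxima within a piece.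
   Cost arrays: 0 wt, 1 hgt, 2 ohgt, 3 dep, 4 hp, 5 F. *)

Local Notation "p ;; q" := (Seq p q) (at level 60, right associativity).
Local Notation "# m" := (WConst m) (at level 2, format "# m").

(** * Prefix and suffix maxima within a path *)

Definition scan_up : cmd :=
  WPut 16 (WVar 16) (WVar 16) ;;
  WSet 18 (WVar 16) ;;
  While (BWLt (WVar 18) (WVar 17)) (
    WSet 18 (WAdd (WVar 18) #1) ;;
    WSet 26 (WGet 16 (WSub (WVar 18) #1)) ;;
    If (BCLe (CAdd (CGet 4 (WVar 26)) (CGet 3 (WVar 26)))
             (CAdd (CGet 4 (WVar 18)) (CGet 3 (WVar 18))))
      (WPut 16 (WVar 18) (WVar 18))
      (WPut 16 (WVar 18) (WVar 26))).

Definition scan_down : cmd :=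
  WPut 17 (WVar 17) (WVar 17) ;;
  WSet 18 (WVar 17) ;;
  While (BWLt (WVar 16) (WVar 18)) (
    WSet 18 (WSub (WVar 18) #1) ;;
    WSet 26 (WGet 17 (WAdd (WVar 18) #1)) ;;
    If (BCLe (CSub (CGet 4 (WVar 26)) (CGet 3 (WVar 26)))
             (CSub (CGet 4 (WVar 18)) (CGet 3 (WVar 18))))
      (WPut 17 (WVar 18) (WVar 18))
      (WPut 17 (WVar 18) (WVar 26))).

Definition scan : cmd := scan_up ;; scan_down.

Ltac framed Fr := repeat match goal with
  | |- context [wvar ?s ?x] => rewrite (fr_wvar Fr (x := x) isT)
  | |- context [warr ?s ?x] => rewrite (fr_warr Fr (x := x) isT)
  | |- context [cvar ?s ?x] => rewrite (fr_cvar Fr (x := x) isT)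
  | |- context [carr ?s ?x] => rewrite (fr_carr Fr (x := x) isT)
  end.

Section Scans.
Context {R : realType}.
Variables (W : nat) (orc : nat -> nat -> R).
Hypothesis W_gt : (81 <= W)%N.

(** In the upper part of a path the distance to the picks is a constant plus the depth, in the lower
    part a constant minus the depth. With the height added, the best positions maximize [hp + dep]
    over a prefix and [hp - dep] over a suffix. The maximizers do not depend on the constants, so
    they survive new picks as long as the path itself is unchanged. *)
Definition prefix_max (u : nat -> R) (a : nat -> nat) l r : Prop :=
  forall i, (l <= i <= r)%N ->
  (l <= a i <= i)%N /\ forall j, (l <= j <= i)%N -> u j <= u (a i).

Definition suffix_max (u : nat -> R) (a : nat -> nat) l r : Prop :=
  forall i, (l <= i <= r)%N ->
  (i <= a i <= r)%N /\ forall j, (i <= j <= r)%N -> u j <= u (a i).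

Lemma wp_scan_up (s : state R) T Q l r :
  wvar s 16 = l -> wvar s 17 = r -> (l <= r)%N -> (r.+1 < W)%N ->
  (10 * (r - l) + 10 <= T)%N ->
  (forall T' s', (T <= T' + (10 * (r - l) + 10))%N -> frame scan_up s s' ->
     prefix_max (fun i => carr s 4 i + carr s 3 i) (warr s' 16) l r ->
     (forall i, ~~ (l <= i <= r)%N -> warr s' 16 i = warr s 16 i) -> Q T' s') ->
  wp W orc scan_up s T Q.
Proof.
move=> El Er lr rW leT post; apply: wp_frame.
apply: wp_seq; wput.
apply: wp_seq; wset.
pose I T' (s' : state R) := exists j, [/\ wvar s' 16 = l /\ wvar s' 17 = r, wvar s' 18 = j,
   (l <= j <= r)%N, (T <= T' + 10 * (j - l) + 4)%N &
   [/\ carr s' 3 = carr s 3, carr s' 4 = carr s 4,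
     prefix_max (fun i => carr s 4 i + carr s 3 i) (warr s' 16) l j &
     forall i, ~~ (l <= i <= r)%N -> warr s' 16 i = warr s 16 i]].
apply: (wp_while (I := I)).
  exists l; lookup; split=> //; try lia; split=> //.
    by move=> i il; rewrite (_ : i = l) ?upd_eq; [split; [lia|move=> j jl; rewrite (_ : j = l) //; lia]|lia].
  by move=> i il; rewrite upd_neq //; lia.
move=> {}T' s' [j [[E16 E17] E18 lj leT' [d3 d4 pm out]]] _; split; first by lia.
ev; case: ifP => jr; last first.
  move=> fr; apply: post => //; first by lia.
  by have -> : r = j by lia.
apply: wp_seq; wset.
apply: wp_seq; wset.
have new : forall v, (l <= v <= j.+1)%N ->
    (forall i, (l <= i <= j.+1)%N -> carr s 4 i + carr s 3 i <= carr s 4 v + carr s 3 v) ->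
    prefix_max (fun i : nat => carr s 4 i + carr s 3 i) (upd (warr s' 16) j.+1 v) l j.+1.
  move=> v lv v_max i li; have [->|ij] := eqVneq i j.+1; first by rewrite upd_eq.
  by rewrite upd_neq //; apply: pm; lia.
have jj : (l <= j <= j)%N by lia.
have [/andP[l_a a_j] a_max] := pm j jj.
rewrite addn1 subSS subn0; wif; rewrite d3 d4 => le_a.
  wput; exists j.+1; lookup; split=> //; [by lia|by lia|split=> //].
    apply: new => [|i li]; first by lia.
    have [->//|ij] := eqVneq i j.+1; apply: le_trans (a_max i _) le_a; lia.
  by move=> i li; rewrite upd_neq ?out //; lia.
wput; exists j.+1; lookup; split=> //; [by lia|by lia|split=> //].
  apply: new => [|i li]; first by lia.
  have [->|ij] := eqVneq i j.+1; last by apply: a_max; lia.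
  by apply: ltW; rewrite ltNge.
by move=> i li; rewrite upd_neq ?out //; lia.
Qed.

Lemma wp_scan_down (s : state R) T Q l r :
  wvar s 16 = l -> wvar s 17 = r -> (l <= r)%N -> (r.+1 < W)%N ->
  (10 * (r - l) + 10 <= T)%N ->
  (forall T' s', (T <= T' + (10 * (r - l) + 10))%N -> frame scan_down s s' ->
     suffix_max (fun i => carr s 4 i - carr s 3 i) (warr s' 17) l r ->
     (forall i, ~~ (l <= i <= r)%N -> warr s' 17 i = warr s 17 i) -> Q T' s') ->
  wp W orc scan_down s T Q.
Proof.
move=> El Er lr rW leT post; apply: wp_frame.
apply: wp_seq; wput.
apply: wp_seq; wset.
pose I T' (s' : state R) := exists j, [/\ wvar s' 16 = l /\ wvar s' 17 = r, wvar s' 18 = j,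
   (l <= j <= r)%N, (T <= T' + 10 * (r - j) + 4)%N &
   [/\ carr s' 3 = carr s 3, carr s' 4 = carr s 4,
     suffix_max (fun i => carr s 4 i - carr s 3 i) (warr s' 17) j r &
     forall i, ~~ (l <= i <= r)%N -> warr s' 17 i = warr s 17 i]].
apply: (wp_while (I := I)).
  exists r; lookup; split=> //; try lia; split=> //.
    by move=> i ir; rewrite (_ : i = r) ?upd_eq; [split; [lia|move=> j jr; rewrite (_ : j = r) //; lia]|lia].
  by move=> i ir; rewrite upd_neq //; lia.
move=> {}T' s' [j [[E16 E17] E18 lj leT' [d3 d4 sm out]]] _; split; first by lia.
ev; case: ifP => lj'; last first.
  move=> fr; apply: post => //; first by lia.
  by have -> : l = j by lia.
apply: wp_seq; wset.
apply: wp_seq; wset.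
have j1 : ((j - 1).+1 = j)%N by lia.
have new : forall v, (j - 1 <= v <= r)%N ->
    (forall i, (j - 1 <= i <= r)%N -> carr s 4 i - carr s 3 i <= carr s 4 v - carr s 3 v) ->
    suffix_max (fun i : nat => carr s 4 i - carr s 3 i) (upd (warr s' 17) (j - 1) v) (j - 1) r.
  move=> v lv v_max i li; have [->|ij] := eqVneq i (j - 1)%N; first by rewrite upd_eq.
  by rewrite upd_neq //; apply: sm; lia.
have jj : (j <= j <= r)%N by lia.
have [/andP[l_a a_j] a_max] := sm j jj.
rewrite addn1 j1; wif; rewrite d3 d4 => le_a.
  wput; exists (j - 1)%N; lookup; split=> //; [by lia|by lia|split=> //].
    apply: new => [|i li]; first by lia.
    have [->//|ij] := eqVneq i (j - 1)%N; apply: le_trans (a_max i _) le_a; lia.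
  by move=> i li; rewrite upd_neq ?out //; lia.
wput; exists (j - 1)%N; lookup; split=> //; [by lia|by lia|split=> //].
  apply: new => [|i li]; first by lia.
  have [->|ij] := eqVneq i (j - 1)%N; last by apply: a_max; lia.
  by apply: ltW; rewrite ltNge.
by move=> i li; rewrite upd_neq ?out //; lia.
Qed.

Lemma wp_scan (s : state R) T Q l r :
  wvar s 16 = l -> wvar s 17 = r -> (l <= r)%N -> (r.+1 < W)%N ->
  (20 * (r - l) + 20 <= T)%N ->
  (forall T' s', (T <= T' + (20 * (r - l) + 20))%N -> frame scan s s' ->
     prefix_max (fun i => carr s 4 i + carr s 3 i) (warr s' 16) l r ->
     suffix_max (fun i => carr s 4 i - carr s 3 i) (warr s' 17) l r ->
     (forall i, ~~ (l <= i <= r)%N -> warr s' 16 i = warr s 16 i) ->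
     (forall i, ~~ (l <= i <= r)%N -> warr s' 17 i = warr s 17 i) -> Q T' s') ->
  wp W orc scan s T Q.
Proof.
move=> El Er lr rW leT post; apply: wp_frame; apply: wp_seq.
apply: (wp_scan_up El Er) => //; first by lia.
move=> T1 s1 leT1 Fr1 pm out1.
apply: (@wp_scan_down _ _ _ l r); rewrite ?(fr_wvar Fr1) //; first by lia.
move=> T2 s2 leT2 Fr2 sm out2 Fr; apply: post => //; first by lia.
- by framed Fr2.
- by move: sm; framed Fr1.
- by move=> i ir; framed Fr2; apply: out1.
- by move=> i ir; rewrite out2 //; framed Fr1.
Qed.

End Scans.

(** * Active paths *)

(** The value in array 5 of a new position is its depth, that is, its distance to the first pick. It
    may be too large until the next pass corrects it. *)
Definition act_path : cmd :=
  While (BNot (BWEq (WVar 13) #0)) (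
    WPut 10 (WVar 11) (WVar 13) ;;
    WPut 11 (WVar 11) (WVar 14) ;;
    WPut 12 (WVar 11) (WGet 9 (WVar 13)) ;;
    CPut 4 (WVar 11) (CGet 2 (WVar 13)) ;;
    CPut 3 (WVar 11) (CAdd (CGet 3 (WVar 14)) (CGet 0 (WVar 13))) ;;
    CPut 5 (WVar 11) (CGet 3 (WVar 11)) ;;
    WSet 14 (WVar 11) ;;
    WSet 11 (WAdd (WVar 11) #1) ;;
    WSet 13 (WGet 8 (WVar 13))).

Definition chop : cmd :=
  While (BWLt (WVar 16) (WVar 11)) (
    If (BWLt (WVar 11) (WAdd (WVar 16) (WVar 4)))
      (WSet 17 (WSub (WVar 11) #1))
      (WSet 17 (WSub (WAdd (WVar 16) (WVar 4)) #1)) ;;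
    WPut 13 (WVar 16) (WVar 17) ;;
    WPut 14 (WVar 17) (WVar 16) ;;
    WPut 15 (WVar 16) (WGet 15 (WVar 15)) ;;
    WPut 15 (WVar 15) (WVar 16) ;;
    scan ;;
    WSet 15 (WVar 16) ;;
    WSet 16 (WAdd (WVar 17) #1)).

Section Maxima.
Context {R : realType}.

Definition maxima (s : state R) t : Prop :=
  prefix_max (fun i => carr s 4 i + carr s 3 i) (warr s 16) t (warr s 13 t) /\
  suffix_max (fun i => carr s 4 i - carr s 3 i) (warr s 17) t (warr s 13 t).

Lemma eq_prefix_max (u u' : nat -> R) a a' l r :
  (forall i, (l <= i <= r)%N -> u i = u' i /\ a i = a' i) ->
  prefix_max u a l r -> prefix_max u' a' l r.
Proof.
move=> eq_ua pm i li; have [_ <-] := eq_ua i li; have [la a_max] := pm i li.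
split=> // j lj; have [|<- _] := eq_ua j; first by lia.
by have [|<- _] := eq_ua (a i); [lia | apply: a_max].
Qed.

Lemma eq_suffix_max (u u' : nat -> R) a a' l r :
  (forall i, (l <= i <= r)%N -> u i = u' i /\ a i = a' i) ->
  suffix_max u a l r -> suffix_max u' a' l r.
Proof.
move=> eq_ua pm i li; have [_ <-] := eq_ua i li; have [la a_max] := pm i li.
split=> // j lj; have [|<- _] := eq_ua j; first by lia.
by have [|<- _] := eq_ua (a i); [lia | apply: a_max].
Qed.

Lemma eq_maxima (s s' : state R) t : warr s' 13 t = warr s 13 t ->
  (forall i, (t <= i <= warr s 13 t)%N -> [/\ carr s' 4 i = carr s 4 i,
    carr s' 3 i = carr s 3 i, warr s' 16 i = warr s 16 i & warr s' 17 i = warr s 17 i]) ->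
  maxima s t -> maxima s' t.
Proof.
rewrite /maxima => -> eq_s [pm sm]; split.
  by apply: eq_prefix_max pm => i /eq_s[-> -> -> _].
by apply: eq_suffix_max sm => i /eq_s[-> -> _ ->].
Qed.

End Maxima.

Section Activation.
Context {R : realType}.
Variables (W S : nat) (orc : nat -> nat -> R).
Variables (N : nat) (par : nat -> nat) (wt : nat -> R) (D : nat -> nat -> R).
Variables (lc oc : nat -> nat) (hgt ohgt : nat -> R).
Hypothesis tm : tree_metric N par wt D.
Hypothesis lcs : long_children N par wt lc oc hgt ohgt.
Hypothesis wt1 : wt 1%N = 0.
Hypothesis N_gt0 : (0 < N)%N.
Hypothesis W_gt : (81 <= W)%N.
Hypothesis W_NS : (2 * N + S + 10 < W)%N.
Hypothesis S_gt0 : (0 < S)%N.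

Record tables (s : state R) : Prop := Tables {
  tab_S : wvar s 4 = S;
  tab_lc : warr s 8 = lc;
  tab_oc : warr s 9 = oc;
  tab_wt : carr s 0 = wt;
  tab_ohgt : carr s 2 = ohgt }.

Definition active_state (s : state R) z p : Prop :=
  active N par D oc ohgt (wvar s 11) (warr s 10) (warr s 11) (warr s 12)
    (carr s 3) (carr s 4) z p.

Record old_positions (c : nat) (s s' : state R) : Prop := OldPositions {
  op_nd : forall i, (i < c)%N -> warr s' 10 i = warr s 10 i;
  op_pp : forall i, (i < c)%N -> warr s' 11 i = warr s 11 i;
  op_ocp : forall i, (i < c)%N -> warr s' 12 i = warr s 12 i;
  op_dep : forall i, (i < c)%N -> carr s' 3 i = carr s 3 i;
  op_hp : forall i, (i < c)%N -> carr s' 4 i = carr s 4 i;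
  op_F : forall i, (i < c)%N -> carr s' 5 i = carr s 5 i }.

Record new_path (c z p : nat) (s' : state R) : Prop := NewPath {
  np_cnt : (c <= wvar s' 11)%N;
  np_F : forall i, (c <= i < wvar s' 11)%N -> carr s' 5 i = carr s' 3 i;
  np_pp : forall i, (c < i < wvar s' 11)%N -> warr s' 11 i = i.-1;
  np_top : (c < wvar s' 11)%N -> warr s' 11 c = p;
  np_anc : forall i, (c <= i < wvar s' 11)%N -> anc par z (warr s' 10 i) }.

(** Depth plus height is constant along long children, so the last activated node is a deepest
    descendant of [z]. Each iteration activates a new node, hence [active_size] bounds the time. *)
Lemma wp_act_path (s : state R) T Q c z p :
  tables s -> active_state s z p -> wvar s 11 = c -> wvar s 13 = z -> wvar s 14 = p ->
  (20 * (N.+1 - c) + 10 <= T)%N ->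
  (forall T' s', (T <= T' + 20 * (wvar s' 11 - c) + 10)%N -> frame act_path s s' ->
     (exists p', active_state s' 0 p') -> old_positions c s s' -> new_path c z p s' ->
     (z = 0%N /\ wvar s' 11 = c \/ z <> 0%N /\ (c < wvar s' 11)%N /\
      D 1 (warr s' 10 (wvar s' 11).-1) = D 1 z + hgt z) -> Q T' s') ->
  wp W orc act_path s T Q.
Proof.
move=> tabs act Ec Ez Ep leT post; apply: wp_frame.
pose I T' (s' : state R) := exists z' p', [/\ active_state s' z' p',
  wvar s' 13 = z' /\ wvar s' 14 = p',
  (T <= T' + 20 * (wvar s' 11 - c) + 4)%N,
  old_positions c s s' /\ new_path c z p s' &
  [/\ p' = if wvar s' 11 == c then p else (wvar s' 11).-1,
      z' <> 0%N -> [/\ z <> 0%N, anc par z z' & D 1 z' + hgt z' = D 1 z + hgt z] &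
      z' = 0%N -> z = 0%N /\ wvar s' 11 = c \/ z <> 0%N /\ (c < wvar s' 11)%N /\
       D 1 (warr s' 10 (wvar s' 11).-1) = D 1 z + hgt z]].
apply: (wp_while (I := I)).
  exists z, p; split=> //; [by lia| |].
    by split; split=> //; rewrite ?Ec // => *; exfalso; lia.
  rewrite Ec eqxx; split=> // [z0|->]; last by left.
  by split=> //; apply: anc_refl.
move=> {}T' s' [z' [p' [act' [Ez' Ep'] leT' [old new] [pE zN0 z0]]]] Fr.
have lc_s' : warr s' 8 = lc by framed Fr; apply: tab_lc.
have oc_s' : warr s' 9 = oc by framed Fr; apply: tab_oc.
have wt_s' : carr s' 0 = wt by framed Fr; apply: tab_wt.
have ohgt_s' : carr s' 2 = ohgt by framed Fr; apply: tab_ohgt.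
have c_le := np_cnt new.
have c'_le := active_size N_gt0 act'.
split; first by lia.
ev; have [z'0|/eqP z'_neq0] := eqVneq z' 0%N.
  move=> _; apply: post => //; [by lia | by exists p'; rewrite -z'0 | exact: z0].
have [zz anc_z hz] := zN0 z'_neq0.
move Ec' : (wvar s' 11) => c' in c_le c'_le act' leT' new pE z0 *.
have c'N := active_lt_size N_gt0 act' z'_neq0; rewrite Ec' in c'N.
have [z'N p'c z'nd _] := act_z act' z'_neq0; rewrite Ec' in p'c z'nd.
have stepA := active_step tm lcs wt1 N_gt0 act' z'_neq0; rewrite Ec' in stepA.
do 2!(apply: wp_seq; wput); apply: wp_seq; wput.
do 3!(apply: wp_seq; cput); do 2!(apply: wp_seq; wset); wset.
rewrite /I; lookup; rewrite upd_eq addn1 lc_s'.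
have below i : (i < c)%N -> i != c' by lia.
exists (lc z'), c'; split=> //; first by rewrite /active_state; lookup; rewrite oc_s' wt_s' ohgt_s'.
- by lia.
- split.
    by split=> i ic; lookup; rewrite upd_neq ?below //; apply old.
  split; lookup; first by lia.
  + move=> i ic; have [->|ic'] := eqVneq i c'; first by rewrite !upd_eq.
    by rewrite !upd_neq //; apply: (np_F new); rewrite Ec'; lia.
  + move=> i ic; have [->|ic'] := eqVneq i c'.
      by rewrite upd_eq pE ifF //; lia.
    by rewrite upd_neq //; apply: (np_pp new); rewrite Ec'; lia.
  + move=> _; have [cE|cc'] := eqVneq c c'; first by rewrite pE cE upd_eq eqxx.
    by rewrite upd_neq //; apply: (np_top new); rewrite Ec'; lia.
  + move=> i ic; have [->|ic'] := eqVneq i c'; first by rewrite upd_eq.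
    by rewrite upd_neq //; apply: (np_anc new); rewrite Ec'; lia.
split.
- by rewrite ifF //; lia.
- move=> /eqP lz; have [lN lpar hE] := lc_spec lcs z'N lz; split=> //.
    by apply: anc_trans anc_z _; rewrite -{1}lpar; apply: anc_par.
  by rewrite (dep_step tm lN) lpar -hz hE; lra.
- move=> lz; right; split=> //; split; first by lia.
  by rewrite /= upd_eq -hz (lc0_spec lcs z'N lz) addr0.
Qed.

Definition piece_state (s : state R) lim ps : Prop :=
  pieces lim S (warr s 11) (warr s 13) (warr s 14) (warr s 15) ps.

(** In [ch_size], all new paths except possibly the last consist of exactly [S] positions. *)
Record chopped (l c : nat) (qs : seq nat) (s s' : state R) : Prop := Chopped {
  ch_size : (size qs * S <= c - l + S)%N;
  ch_ge : forall t, t \in qs -> (l <= t)%N;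
  ch_max : forall t, t \in qs -> maxima s' t;
  ch_bot : forall i, (i < l)%N -> warr s' 13 i = warr s 13 i;
  ch_pref : forall i, (i < l)%N -> warr s' 16 i = warr s 16 i;
  ch_suff : forall i, (i < l)%N -> warr s' 17 i = warr s 17 i }.

Lemma wp_chop (s : state R) T Q l c q1 q2 :
  wvar s 4 = S -> wvar s 11 = c -> wvar s 16 = l -> wvar s 15 = last 0%N q1 ->
  (0 < l <= c)%N -> (c <= N.+1)%N -> piece_state s l (q1 ++ q2) ->
  (forall i, (l < i < c)%N -> warr s 11 i = i.-1) ->
  ((l < c)%N -> warr s 11 l = 0%N \/ exists2 t, t \in q1 & warr s 11 l = warr s 13 t) ->
  (60 * (c - l) + 10 <= T)%N ->
  (forall T' s' qs, (T <= T' + 60 * (c - l) + 10)%N -> frame chop s s' ->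
     piece_state s' c (q1 ++ qs ++ q2) -> chopped l c qs s s' -> Q T' s') ->
  wp W orc chop s T Q.
Proof.
move=> ES Ec El Eq lc_ cN ps chain hang leT post; apply: wp_frame.
pose I T' (s' : state R) := exists l' qs, [/\
  wvar s' 16 = l' /\ wvar s' 15 = last 0%N (q1 ++ qs),
  (l <= l' <= c)%N /\ ((l' < c)%N -> (size qs * S <= l' - l)%N),
  (T <= T' + 60 * (l' - l) + 4)%N,
  piece_state s' l' ((q1 ++ qs) ++ q2) &
  chopped l c qs s s' /\
  ((l' < c)%N -> warr s 11 l' = 0%N \/
    exists2 t, t \in q1 ++ qs & warr s 11 l' = warr s' 13 t)].
apply: (wp_while (I := I)).
  by exists l, [::]; rewrite !cats0; split=> //; try split=> //; try lia.
move=> {}T' s' [l' [qs [[El' Eq'] [ll' sz] leT' ps' [ch hang']]]] Fr; split; first by lia.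
have ES' : wvar s' 4 = S by framed Fr.
have Ec' : wvar s' 11 = c by framed Fr.
have Epp : warr s' 11 = warr s 11 by framed Fr.
ev; case: ifP => l'c; last first.
  have l'E : l' = c by lia.
  move=> fr; apply: (post _ _ qs) => //; first by lia.
  by rewrite catA -l'E.
apply: wp_seq.
pose r := if (l' + S <= c)%N then (l' + S - 1)%N else c.-1.
apply: (@wp_conseq _ _ _ _ _ _ (fun T'' s'' => (T' <= T'' + 3)%N /\ s'' = set_wvar s' 17 r)).
  wif => rc; wset; (split; first by lia).
    by rewrite /r ifF; [congr set_wvar; lia | lia].
  by rewrite /r ifT // leqNgt.
have l'r : (l' <= r < c)%N by rewrite /r; case: ifP; lia.
have rS : (r < l' + S)%N by rewrite /r; case: ifP; lia.
move=> T1 _ [leT1 ->].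
have fresh t : t \in (q1 ++ qs) ++ q2 -> (0 < t < l')%N /\ (warr s' 13 t < l')%N.
  by move=> tq; have [? ? _ _] := pc_in ps' tq; lia.
do 3!(apply: wp_seq; wput); apply: wp_seq; wput.
move Es1 : (set_warr _ 15 _ _) => s1.
apply: wp_seq; apply: (@wp_scan _ _ _ W_gt _ _ _ l' r);
  [by rewrite -Es1; ev | by rewrite -Es1; ev | by lia | by lia | by lia |].
move=> T2 s2 leT2 Fr2 pm sm out16 out17.
apply: wp_seq; apply: wp_wset; [by rewrite /= (fr_wvar Fr2) | by lia |].
apply: wp_wset; [by lookup; framed Fr2; rewrite -Es1; ev | by lia |].
have E3 : carr s1 3 = carr s' 3 by rewrite -Es1.
have E4 : carr s1 4 = carr s' 4 by rewrite -Es1.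
rewrite E3 E4 in pm sm.
have E16 : warr s1 16 = warr s' 16 by rewrite -Es1; lookup.
have E17 : warr s1 17 = warr s' 17 by rewrite -Es1; lookup.
rewrite E16 in out16; rewrite E17 in out17.
have E13 : warr s2 13 = upd (warr s' 13) l' r by framed Fr2; rewrite -Es1; lookup.
have E14 : warr s2 14 = upd (warr s' 14) r l' by framed Fr2; rewrite -Es1; lookup.
have E15 : warr s2 15 = upd (upd (warr s' 15) l' (warr s' 15 (last 0%N (q1 ++ qs))))
    (last 0%N (q1 ++ qs)) l' by framed Fr2; rewrite -Es1; lookup.
have E11 : warr s2 11 = warr s 11 by framed Fr2; rewrite -Es1; lookup.
have E3' : carr s2 3 = carr s' 3 by framed Fr2; rewrite E3.
have E4' : carr s2 4 = carr s' 4 by framed Fr2; rewrite E4.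
have new : piece_state (set_wvar (set_wvar s2 15 (wvar s1 16)) 16 (r + 1)) r.+1
    ((q1 ++ rcons qs l') ++ q2).
  rewrite /piece_state -cats1 catA -!catA /= catA; lookup.
  rewrite E11 E13 E14 E15 -Epp; apply: pieces_append => //; [by lia| |].
    by rewrite Epp => i ?; apply: chain; lia.
  by rewrite Epp; apply: hang'.
have same i : (i < l')%N -> warr s2 13 i = warr s' 13 i /\
    (warr s2 16 i = warr s' 16 i /\ warr s2 17 i = warr s' 17 i).
  by move=> il; rewrite E13 upd_neq ?out16 ?out17 //; lia.
exists r.+1, (rcons qs l'); split=> //.
- by lookup; framed Fr2; rewrite addn1 -rcons_cat last_rcons -Es1; ev.
- split; first by lia.
  move=> rc; rewrite size_rcons mulSn; have := sz l'c.
  have -> : r = (l' + S - 1)%N by move: rc; rewrite /r; case: ifP => //; lia.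
  by lia.
- by lia.
split.
  split=> [|t|t|i il|i il|i il].
  - by rewrite size_rcons mulSn; have := sz l'c; lia.
  - by rewrite mem_rcons inE => /predU1P[->|/(ch_ge ch)//]; lia.
  - rewrite mem_rcons inE => /predU1P[->|tq].
      by split; lookup; rewrite E3' E4' E13 upd_eq.
    have [|? ?] := fresh t; first by rewrite !mem_cat tq orbT.
    apply: eq_maxima (ch_max ch tq); lookup; first by have [|] := same t; first lia.
    by move=> i ti; rewrite E3' E4'; have [|_ [-> ->]] := same i; first lia.
  - by lookup; have [|->] := same i; [lia | move=> _; apply: (ch_bot ch)].
  - by lookup; have [|_ [-> _]] := same i; [lia | apply: (ch_pref ch)].
  - by lookup; have [|_ [_ ->]] := same i; [lia | apply: (ch_suff ch)].
move=> rc; right; exists l'; first by rewrite mem_cat mem_rcons mem_head orbT.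
by lookup; rewrite E13 upd_eq chain //; lia.
Qed.

End Activation.

(** * Selecting a farthest node *)

Definition bisect : cmd :=
  WSet 19 (WVar 16) ;;
  WSet 20 (WAdd (WVar 17) #1) ;;
  While (BWLt (WVar 19) (WVar 20)) (
    WSet 21 (WDiv (WAdd (WVar 19) (WVar 20)) #2) ;;
    If (BCLe (CAdd (CVar 0) (CGet 3 (WVar 21))) (CSub (CVar 1) (CGet 3 (WVar 21))))
      (WSet 19 (WAdd (WVar 21) #1))
      (WSet 20 (WVar 21))).

(** Ties replace the incumbent. Scores are non-negative and the incumbent value starts at 0, so a
    position has certainly been recorded after the first path. *)
Definition offer : cmd :=
  If (BCLe (CVar 2) (CVar 3))
    (CSet 2 (CVar 3) ;; WSet 22 (WVar 26) ;; WSet 23 (WVar 16))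
    Skip.

(** After the value at the bottom has been relaxed through the parent, cost variables 0 and 1 hold
    the constants [ft] and [fb] such that the distance to the picks at depth [d] of the path is the
    minimum of [ft + d] and [fb - d]. *)
Definition query : cmd :=
  WSet 17 (WGet 13 (WVar 16)) ;;
  WSet 14 (WGet 11 (WVar 16)) ;;
  CSet 3 (CAdd (CGet 5 (WVar 14)) (CSub (CGet 3 (WVar 17)) (CGet 3 (WVar 14)))) ;;
  If (BCLe (CVar 3) (CGet 5 (WVar 17))) (CPut 5 (WVar 17) (CVar 3)) Skip ;;
  CSet 0 (CSub (CGet 5 (WVar 14)) (CGet 3 (WVar 14))) ;;
  CSet 1 (CAdd (CGet 5 (WVar 17)) (CGet 3 (WVar 17))) ;;
  bisect ;;
  If (BWLt (WVar 16) (WVar 19)) (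
    WSet 26 (WGet 16 (WSub (WVar 19) #1)) ;;
    CSet 3 (CAdd (CVar 0) (CAdd (CGet 4 (WVar 26)) (CGet 3 (WVar 26)))) ;;
    offer) Skip ;;
  If (BWLt (WVar 19) (WAdd (WVar 17) #1)) (
    WSet 26 (WGet 17 (WVar 19)) ;;
    CSet 3 (CAdd (CVar 1) (CSub (CGet 4 (WVar 26)) (CGet 3 (WVar 26)))) ;;
    offer) Skip.

Definition pass : cmd :=
  WSet 16 (WGet 15 #0) ;;
  CSet 2 CZero ;;
  While (BNot (BWEq (WVar 16) #0)) (query ;; WSet 16 (WGet 15 (WVar 16))).

Section Queries.
Context {R : realType}.
Variables (W : nat) (orc : nat -> nat -> R).
Hypothesis W_gt : (81 <= W)%N.

(** With growing depth [ft + dep] does not decrease and [fb - dep] does not increase, so the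
    comparison at the midpoint settles all positions on one side of it. *)
Lemma wp_bisect (s : state R) T Q l r ft fb m :
  wvar s 16 = l -> wvar s 17 = r -> cvar s 0 = ft -> cvar s 1 = fb ->
  (l <= r)%N -> (2 * r + 5 < W)%N -> (r.+1 - l < 2 ^ m)%N ->
  (forall i j, (l <= i <= j)%N -> (j <= r)%N -> carr s 3 i <= carr s 3 j) ->
  (6 * m + 10 <= T)%N ->
  (forall T' s' lo, (T <= T' + 6 * m + 10)%N -> frame bisect s s' ->
     wvar s' 19 = lo -> (l <= lo <= r.+1)%N ->
     (forall i, (l <= i < lo)%N -> ft + carr s 3 i <= fb - carr s 3 i) ->
     (forall i, (lo <= i <= r)%N -> fb - carr s 3 i <= ft + carr s 3 i) -> Q T' s') ->
  wp W orc bisect s T Q.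
Proof.
move=> El Er Eft Efb lr rW rl2m d_mono leT post; apply: wp_frame.
apply: wp_seq; wset; apply: wp_seq; wset; rewrite addn1.
pose I T' (s' : state R) := exists lo hi m', [/\ wvar s' 19 = lo /\ wvar s' 20 = hi,
   (l <= lo <= hi)%N /\ (hi <= r.+1)%N, (hi - lo < 2 ^ m')%N /\ (m' <= m)%N,
   (T <= T' + 6 * (m - m') + 4)%N &
   (forall i, (l <= i < lo)%N -> ft + carr s 3 i <= fb - carr s 3 i) /\
   (forall i, (hi <= i <= r)%N -> fb - carr s 3 i <= ft + carr s 3 i)].
apply: (wp_while (I := I)).
  by exists l, r.+1, m; lookup; split=> //; try split=> //; try lia; move=> i il; exfalso; lia.
move=> {}T' s' [lo [hi [m' [[Elo Ehi] [ll hr] [hm mm] leT' [small large]]]]] Fr.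
have E3 : carr s' 3 = carr s 3 by framed Fr.
have Eft' : cvar s' 0 = ft by framed Fr; lookup.
have Efb' : cvar s' 1 = fb by framed Fr; lookup.
split; first by lia.
ev; case: ifP => lohi; last first.
  have loE : lo = hi by lia.
  by move=> fr; apply: (post _ _ lo) => //; [lia | lia | rewrite loE].
have m'0 : (0 < m')%N by case: m' hm {mm leT'} => //; rewrite expn0; lia.
have half : (2 ^ m' = 2 * 2 ^ m'.-1)%N by rewrite -expnS prednK.
apply: wp_seq; wset.
have mid : (lo <= (lo + hi) %/ 2 < hi)%N by lia.
set md := ((lo + hi) %/ 2)%N in mid *.
wif; rewrite E3 => le_m.
  wset; exists md.+1, hi, m'.-1; lookup; rewrite addn1; split=> //; [by lia|by lia|by lia|].
  split=> // i li; have : carr s 3 i <= carr s 3 md by apply: d_mono; lia.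
  by move: le_m; lra.
wset; exists lo, md, m'.-1; lookup; split=> //; [by lia|by lia|by lia|].
split=> // i li; have : carr s 3 md <= carr s 3 i by apply: d_mono; lia.
by move: le_m; rewrite -ltNge; lra.
Qed.

(* The incumbent after offering the positions satisfying X: either no score
   reaches the old value, or the incumbent is a position w of the piece. *)
Definition offered (score : nat -> R) (t : nat) (inp : pred nat) (X : pred nat)
    (s s' : state R) : Prop :=
  [/\ cvar s' 2 = cvar s 2, wvar s' 22 = wvar s 22, wvar s' 23 = wvar s 23 &
      forall i, X i -> score i < cvar s 2] \/
  [/\ cvar s 2 <= cvar s' 2, wvar s' 23 = t, inp (wvar s' 22),
      cvar s' 2 = score (wvar s' 22) & forall i, X i -> score i <= cvar s' 2].

Lemma offered_trans score t (inp X Y : pred nat) s s' s'' :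
  offered score t inp X s s' -> offered score t inp Y s' s'' ->
  offered score t inp (predU X Y) s s''.
Proof.
case=> [[E2 E22 E23 lt_X]|[le2 E23 in22 E2 le_X]].
  case=> [[F2 F22 F23 lt_Y]|[le2' F23 in22' F2 le_Y]].
    left; rewrite F2 F22 F23; split=> // i /orP[/lt_X//|/lt_Y]; by rewrite E2.
  right; split=> //; first by rewrite -E2.
  by move=> i /orP[/lt_X /ltW|/le_Y//]; rewrite -E2 => /le_trans; apply.
case=> [[F2 F22 F23 lt_Y]|[le2' F23 in22' F2 le_Y]].
  by right; rewrite F2 F22 F23; split=> // i /orP[/le_X//|/lt_Y /ltW].
right; split=> //; first exact: le_trans le2'.
by move=> i /orP[/le_X /le_trans|/le_Y//]; apply.
Qed.

Lemma wp_offer (s : state R) T Q score t (inp X : pred nat) :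
  wvar s 16 = t -> inp (wvar s 26) -> cvar s 3 = score (wvar s 26) ->
  (forall i, X i -> score i <= cvar s 3) ->
  (5 <= T)%N ->
  (forall T' s', (T <= T' + 5)%N -> frame offer s s' -> offered score t inp X s s' ->
     Q T' s') ->
  wp W orc offer s T Q.
Proof.
move=> Et in26 E3; rewrite E3 => le_X leT post; apply: wp_frame.
wif => le23.
  apply: wp_seq; cset; apply: wp_seq; wset; wset => Fr; apply: post => //; first by lia.
  by right; lookup; split.
apply: wp_skip; first by lia.
move=> Fr; apply: post => //; first by lia.
by left; split=> // i /le_X /le_lt_trans; apply; rewrite ltNge.
Qed.

Lemma wp_query (s : state R) T Q t r p m :
  wvar s 16 = t -> warr s 13 t = r -> warr s 11 t = p -> p <> r ->
  (t <= r)%N -> (2 * r + 5 < W)%N -> (r.+1 - t < 2 ^ m)%N ->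
  (forall i j, (t <= i <= j)%N -> (j <= r)%N -> carr s 3 i <= carr s 3 j) ->
  maxima s t -> (6 * m + 50 <= T)%N ->
  (forall T' s', (T <= T' + 6 * m + 50)%N -> frame query s s' ->
     carr s' 5 r = Num.min (carr s 5 p + (carr s 3 r - carr s 3 p)) (carr s 5 r) ->
     (forall i, i <> r -> carr s' 5 i = carr s 5 i) ->
     offered (fun i => carr s 4 i + Num.min (carr s 5 p - carr s 3 p + carr s 3 i)
                                      (carr s' 5 r + carr s 3 r - carr s 3 i))
       t (fun i => t <= i <= r)%N (fun i => t <= i <= r)%N s s' -> Q T' s') ->
  wp W orc query s T Q.
Proof.
move=> Et Er Ep pr tr rW rl2m d_mono [pm sm] leT post; apply: wp_frame.
rewrite Er in pm sm.
apply: wp_seq; apply: wp_wset; [by lookup; rewrite Er | lia |].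
apply: wp_seq; apply: wp_wset; [by lookup; rewrite Ep | lia |].
apply: wp_seq; cset.
set Fr := Num.min (carr s 5 p + (carr s 3 r - carr s 3 p)) (carr s 5 r).
apply: wp_seq.
apply: (@wp_conseq _ _ _ _ _ _ (fun T' s' => [/\ (T <= T' + 5)%N, carr s' 5 r = Fr,
  (forall i, i <> r -> carr s' 5 i = carr s 5 i),
  [/\ wvar s' 16 = t, wvar s' 17 = r, wvar s' 14 = p, wvar s' 22 = wvar s 22
    & wvar s' 23 = wvar s 23] &
  [/\ warr s' = warr s, carr s' 3 = carr s 3, carr s' 4 = carr s 4 & cvar s' 2 = cvar s 2]])).
  wif => le_F.
    cput; split; lookup; rewrite ?upd_eq //.
    - by lia.
    - by rewrite /Fr min_l.
    - by move=> i /eqP ir; rewrite upd_neq.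
  apply: wp_skip; first by lia.
  split=> //; first by lia.
  by rewrite /= /Fr min_r // ltW // ltNge.
move=> T1 s1 [leT1 F1r F1 [Et1 Er1 Ep1 E22 E23] [Ewa E3 E4 E2]].
have F1p : carr s1 5 p = carr s 5 p by apply: F1.
set ft := carr s 5 p - carr s 3 p; set fb := Fr + carr s 3 r.
apply: wp_seq; apply: (wp_cset (v := ft)); [by lookup; rewrite F1p E3 | lia |].
apply: wp_seq; apply: (wp_cset (v := fb)); [by lookup; rewrite F1r E3 | lia |].
move Es2 : (set_cvar _ 1 fb) => s2.
apply: wp_seq; apply: (@wp_bisect _ _ _ t r ft fb m) => //;
  [by rewrite -Es2; lookup | by rewrite -Es2; lookup | by rewrite -Es2; lookup
  | by rewrite -Es2; lookup | by rewrite -Es2; lookup; rewrite E3 | by lia |].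
move=> T3 s3 lo leT3 Fr3 Elo lo_r small large.
have E3_3 : carr s3 3 = carr s 3 by framed Fr3; rewrite -Es2; lookup.
have E3_4 : carr s3 4 = carr s 4 by framed Fr3; rewrite -Es2; lookup.
have E3_5 : carr s3 5 = carr s1 5 by framed Fr3; rewrite -Es2; lookup.
have E3_w : warr s3 16 = warr s 16 /\ warr s3 17 = warr s 17.
  by framed Fr3; rewrite -Es2; lookup; rewrite Ewa.
have E3_ft : cvar s3 0 = ft by framed Fr3; rewrite -Es2; lookup.
have E3_fb : cvar s3 1 = fb by framed Fr3; rewrite -Es2; lookup.
have E3_2 : cvar s3 2 = cvar s 2 by framed Fr3; rewrite -Es2; lookup.
have E3_16 : wvar s3 16 = t by framed Fr3; rewrite -Es2; lookup.
have E3_17 : wvar s3 17 = r by framed Fr3; rewrite -Es2; lookup.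
have E3_22 : wvar s3 22 = wvar s 22 by framed Fr3; rewrite -Es2; lookup.
have E3_23 : wvar s3 23 = wvar s 23 by framed Fr3; rewrite -Es2; lookup.
have {}small i : (t <= i < lo)%N -> ft + carr s 3 i <= fb - carr s 3 i.
  by move=> /small; rewrite -Es2; lookup; rewrite E3.
have {}large i : (lo <= i <= r)%N -> fb - carr s 3 i <= ft + carr s 3 i.
  by move=> /large; rewrite -Es2; lookup; rewrite E3.
pose score i := carr s 4 i + Num.min (ft + carr s 3 i) (fb - carr s 3 i).
pose inp i := (t <= i <= r)%N.
apply: wp_seq.
apply: (@wp_conseq _ _ _ _ _ _ (fun T' s' => [/\ (T3 <= T' + 8)%N,
  offered score t inp (fun i => t <= i < lo)%N s3 s',
  (forall x, carr s' x = carr s3 x), (forall x, warr s' x = warr s3 x) &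
  [/\ wvar s' 16 = t, wvar s' 17 = r, wvar s' 19 = lo & cvar s' 1 = fb]])).
  wif => t_lo; last first.
    apply: wp_skip; first by lia.
    split=> //; first by lia.
    by left; split=> // i ti; exfalso; lia.
  apply: wp_seq; wset.
  set w := warr s3 16 (lo - 1)%N.
  have [tw w_max] : (t <= w < lo)%N /\ forall i, (t <= i < lo)%N ->
      carr s 4 i + carr s 3 i <= carr s 4 w + carr s 3 w.
    have [|tw w_max] := pm (lo - 1)%N; first by lia.
    rewrite -(proj1 E3_w) -/w in tw w_max; split; first by lia.
    by move=> i ti; apply: w_max; lia.
  have score_w i : (t <= i < lo)%N -> score i = ft + (carr s 4 i + carr s 3 i).
    by move=> ti; rewrite /score min_l ?small //; lra.
  apply: wp_seq; apply: (wp_cset (v := score w)).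
    by lookup; rewrite E3_3 E3_4 (score_w w tw).
    by lia.
  apply: (@wp_offer _ _ _ score t inp (fun i => t <= i < lo)%N); lookup => //.
  - by rewrite /inp; lia.
  - by move=> i ti; rewrite !score_w // lerD2l w_max.
  - by lia.
  move=> T4 s4 leT4 Fr4 off; split=> //; first by lia.
  - by move=> x; framed Fr4.
  - by move=> x; framed Fr4.
  - by framed Fr4; lookup.
move=> T4 s4 [leT4 off4 E4c E4w [E4t E4r E4lo E4fb]].
have last_step T5 s5 : (T4 <= T5 + 8)%N ->
    offered score t inp (fun i => lo <= i <= r)%N s4 s5 -> (forall x, carr s5 x = carr s4 x) ->
    frame query s s5 -> Q T5 s5.
  move=> leT5 off5 E5c fr; have E5_5 : carr s5 5 = carr s1 5 by rewrite E5c E4c E3_5.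
  apply: post => //; first by lia.
  - by rewrite E5_5.
  - by move=> i ir; rewrite E5_5 F1.
  have scoreE i : carr s 4 i + Num.min (carr s 5 p - carr s 3 p + carr s 3 i)
      (carr s5 5 r + carr s 3 r - carr s 3 i) = score i by rewrite E5_5 F1r.
  have off := offered_trans off4 off5; rewrite /offered E3_2 E3_22 E3_23 in off.
  case: off => [[? ? ? lt_X]|[? ? ? ? le_X]]; [left | right]; split=> //.
  - by move=> i ti; rewrite scoreE; apply: lt_X => /=; lia.
  - by rewrite scoreE.
  - by move=> i ti; rewrite scoreE; apply: le_X => /=; lia.
wif => lo_r1; last first.
  apply: wp_skip; first by lia.
  apply: last_step => //; first by lia.
  by left; split=> // i ti; exfalso; lia.
apply: wp_seq; wset.
set w := warr s4 17 lo.
have [tw w_max] : (lo <= w <= r)%N /\ forall i, (lo <= i <= r)%N ->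
    carr s 4 i - carr s 3 i <= carr s 4 w - carr s 3 w.
  have [|tw w_max] := sm lo; first by lia.
  by rewrite -(proj2 E3_w) -E4w -/w in tw w_max.
have score_w i : (lo <= i <= r)%N -> score i = fb + (carr s 4 i - carr s 3 i).
  by move=> ti; rewrite /score min_r ?large //; lra.
apply: wp_seq; apply: (wp_cset (v := score w)).
  by lookup; rewrite !E4c E3_3 E3_4 (score_w w tw).
  by lia.
apply: (@wp_offer _ _ _ score t inp (fun i => lo <= i <= r)%N); lookup => //.
- by rewrite /inp; lia.
- by move=> i ti; rewrite !score_w // lerD2l w_max.
- by lia.
move=> T5 s5 leT5 Fr5 off; apply: last_step => //; first by lia.
by move=> x; framed Fr5.
Qed.

End Queries.

Lemma linked_next nxt t q1 q2 : linked nxt t (q1 ++ q2) -> nxt (last t q1) = head 0%N q2.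
Proof.
elim: q1 t => [|u q1 IHq] t /=; last by case=> _ /IHq.
by case: q2 => //= u q2 [].
Qed.

Section Rounds.
Context {R : realType}.
Variables (W S : nat) (orc : nat -> nat -> R).
Variables (N : nat) (par : nat -> nat) (wt : nat -> R) (D : nat -> nat -> R).
Variables (lc oc : nat -> nat) (hgt ohgt : nat -> R).
Hypothesis tm : tree_metric N par wt D.
Hypothesis lcs : long_children N par wt lc oc hgt ohgt.
Hypothesis wt1 : wt 1%N = 0.
Hypothesis N_gt0 : (0 < N)%N.

(** The state between two rounds: no node is pending, and the values at the bottoms are correct only
    in the sense of [prefit]. *)
Record ready (s : state R) (ps ys : seq nat) : Prop := Ready {
  rd_act : exists p, active_state N par D oc ohgt s 0 p;
  rd_cnt : (1 < wvar s 11)%N;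
  rd_pcs : piece_state S s (wvar s 11) ps;
  rd_max : forall t, t \in ps -> maxima s t;
  rd_F0 : carr s 5 0%N = 0;
  rd_ys : forall y, y \in ys -> exists2 t, t \in ps & warr s 10 (warr s 13 t) = y;
  rd_fit : prefit (warr s 10) (warr s 11) (carr s 3) (warr s 13) ps (near D ys) (carr s 5) }.

Let score (s : state R) ys i := carr s 4 i + near D ys (warr s 10 i).

(** Word variables 22 and 23 hold the incumbent position and the top of its path, cost variable 2
    its score. *)
Definition best_in (s0 : state R) ys (q : seq nat) (s : state R) : Prop :=
  [/\ wvar s 23 \in q, (wvar s 23 <= wvar s 22 <= warr s0 13 (wvar s 23))%N,
      cvar s 2 = carr s0 4 (wvar s 22) + near D ys (warr s0 10 (wvar s 22)) &
      forall t i, t \in q -> (t <= i <= warr s0 13 t)%N ->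
        carr s0 4 i + near D ys (warr s0 10 i) <= cvar s 2].

Lemma hp_ge0 (s : state R) p i : active_state N par D oc ohgt s 0 p ->
  (0 < i < wvar s 11)%N -> 0 <= carr s 4 i.
Proof.
move=> A ic; have [oi|/eqP oi] := eqVneq (warr s 12 i) 0%N; first by rewrite (act_oc0 A ic oi).
have [oE hE _ _] := act_oc A ic oi; have iN := act_nd A ic.
have [|oN _ _ ohE _] := oc_spec lcs iN; first by rewrite -oE; lia.
rewrite hE ohE addr_ge0 ?(wt_ge0 tm) //; apply: (hgt_ge0 tm lcs N_gt0); lia.
Qed.

Lemma near_root ys : near D ys 1 = 0.
Proof.
apply/le_anti; rewrite (near_ge0 ys 1 tm) andbT.
by have := near_le1 D ys 1; rewrite (Dxx tm).
Qed.

Hypothesis W_gt : (81 <= W)%N.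
Hypothesis W_NS : (2 * N + S + 10 < W)%N.
Hypothesis S_gt0 : (0 < S)%N.

(** When a path is reached, the bottom it hangs from already carries an exact value, because the
    list is topological. By [prefit], the minimum of the stored value and the route through the
    parent is then exact at its own bottom. *)
Lemma wp_pass (s : state R) T Q ps ys m :
  ready s ps ys -> (2 * N < 2 ^ m)%N -> (size ps * (6 * m + 60) + 10 <= T)%N ->
  (forall T' s', (T <= T' + (size ps * (6 * m + 60) + 10))%N -> frame pass s s' ->
     carr s' 5 0%N = 0 ->
     (forall t, t \in ps -> carr s' 5 (warr s 13 t) = near D ys (warr s 10 (warr s 13 t))) ->
     best_in s ys ps s' -> Q T' s') ->
  wp W orc pass s T Q.
Proof.
move=> rd Nm leT post; apply: wp_frame.
have [[p0 A] cnt1 P max_ps F0 ys_bot fit] := rd.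
have cntN := active_size N_gt0 A.
apply: wp_seq; wset; apply: wp_seq; cset.
pose I T' (s' : state R) := exists q1 q2, [/\ ps = q1 ++ q2, wvar s' 16 = head 0%N q2,
  (T <= T' + size q1 * (6 * m + 60) + 3)%N,
  (forall t, t \in q1 -> carr s' 5 (warr s 13 t) = near D ys (warr s 10 (warr s 13 t))) /\
  (forall i, (forall t, t \in q1 -> i <> warr s 13 t) -> carr s' 5 i = carr s 5 i) &
  (q1 = [::] -> cvar s' 2 = 0) /\ (q1 <> [::] -> best_in s ys q1 s')].
apply: (wp_while (I := I)).
  exists [::], ps; lookup; split=> //; last by lia.
  by have := linked_next (q1 := [::]) (pc_linked P).
move=> {}T' s' [q1 [q2 [psE Et leT' [F_q1 F_other] [best0 best]]]] Fr.
have sz_ps : (size ps = size q1 + size q2)%N by rewrite psE size_cat.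
have bot_gt0 t : t \in ps -> (0 < t <= warr s 13 t)%N /\ (warr s 13 t < wvar s 11)%N.
  by move=> /(pc_in P)[].
have F'0 : carr s' 5 0%N = 0.
  rewrite F_other // => t tq; have [|] := bot_gt0 t; last by lia.
  by rewrite psE mem_cat tq.
have sz_mul : (size ps * (6 * m + 60) = size q1 * (6 * m + 60) + size q2 * (6 * m + 60))%N.
  by rewrite sz_ps mulnDl.
split; first by lia.
ev; case: q2 => [|t q2] in psE Et sz_ps sz_mul *; rewrite /= in Et *.
  rewrite cats0 in psE; move=> fr; apply: post => //; first by lia.
    by rewrite psE.
  rewrite psE; apply: best => q0; have [|t tps _] := pc_cover P (i := 1); first by lia.
  by rewrite psE q0 in tps.
rewrite /= mulSn in sz_mul.
have tps : t \in ps by rewrite psE mem_cat mem_head orbT.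
have [t_r r_cnt] := bot_gt0 t tps.
case: ifP => [_|/negbFE/eqP t0]; last by lia.
have E13 : warr s' 13 = warr s 13 by framed Fr.
have E11 : warr s' 11 = warr s 11 by framed Fr.
have E15 : warr s' 15 = warr s 15 by framed Fr.
have E16 : warr s' 16 = warr s 16 by framed Fr.
have E17 : warr s' 17 = warr s 17 by framed Fr.
have E3 : carr s' 3 = carr s 3 by framed Fr.
have E4 : carr s' 4 = carr s 4 by framed Fr.
have tq1 : t \notin q1.
  by have := pc_uniq P; rewrite psE /= cat_uniq /= => /andP[_ /and3P[_ /norP[]]].
have hang := pc_topo P; rewrite psE topo_cat /= in hang; have {hang} [_ [hang _]] := hang.
have ppr : (warr s 11 t < t)%N.
  case: (pp_cases A cnt1 P tps) => t1; last by have [|] := act_pp A (i := t); lia.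
  by rewrite t1; have [-> _] := act_pos1 A cnt1.
have Fp : carr s' 5 (warr s 11 t) = near D ys (warr s 10 (warr s 11 t)).
  case: hang => [->|[t' t'q ->]]; last exact: F_q1.
  by rewrite F'0 (act_nd0 A) near_root.
have Fr' : carr s' 5 (warr s 13 t) = carr s 5 (warr s 13 t).
  apply: F_other => t' t'q bE; have t'ps : t' \in ps by rewrite psE mem_cat t'q.
  have [? ?] := bot_gt0 t' t'ps.
  have tt' : t = t' by apply: (pc_disj P (i := warr s 13 t) tps t'ps); lia.
  by rewrite tt' t'q in tq1.
apply: wp_seq; apply: (@wp_query _ _ _ W_gt _ _ _ t (warr s 13 t) (warr s 11 t) m) => //;
  rewrite ?E13 ?E11 //; try by lia.
- by move=> i j; rewrite E3; apply: (dep_mono tm A cnt1 P tps).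
- apply: eq_maxima (max_ps t tps); first by rewrite E13.
  by move=> i ti; rewrite E4 E3 E16 E17.
move=> T2 s2 leT2 Fr2 F2r F2 off.
have E2_wa x : warr s2 x = warr s' x by framed Fr2.
have bots_inj t' : t' \in q1 -> warr s 13 t' <> warr s 13 t.
  move=> t'q bE; have t'ps : t' \in ps by rewrite psE mem_cat t'q.
  have [? ?] := bot_gt0 t' t'ps.
  have tt' : t = t' by apply: (pc_disj P (i := warr s 13 t) tps t'ps); lia.
  by rewrite tt' t'q in tq1.
have f_t : carr s2 5 (warr s 13 t) = near D ys (warr s 10 (warr s 13 t)).
  rewrite F2r Fp E3 Fr'; have [le_F F_eq] := fit t tps.
  have := near_lip ys (warr s 10 (warr s 13 t)) (warr s 10 (warr s 11 t)) tm.
  rewrite (dist_up tm A cnt1 P tps); last by lia.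
  move=> lip; apply/le_anti; rewrite ge_min le_min lip le_F andbT orbC.
  by case: F_eq => [->|fE]; [rewrite lexx | rewrite {2}fE addrA lexx orbT].
have {off}off : offered (score s ys) t (fun i => t <= i <= warr s 13 t)%N
    (fun i => t <= i <= warr s 13 t)%N s' s2.
  have scoreE i : (t <= i <= warr s 13 t)%N -> carr s' 4 i +
     Num.min (carr s' 5 (warr s 11 t) - carr s' 3 (warr s 11 t) + carr s' 3 i)
       (carr s2 5 (warr s 13 t) + carr s' 3 (warr s 13 t) - carr s' 3 i) = score s ys i.
    by move=> ti; rewrite f_t Fp E3 E4 -(near_piece tm A cnt1 P ys_bot tps ti).
  case: off => [[? ? ? lt_X]|[? ? w_in E2 le_X]]; [left | right]; split=> //.
  - by move=> i ti; rewrite -scoreE //; apply: lt_X.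
  - by rewrite E2; apply: scoreE.
  - by move=> i ti; rewrite -(scoreE i ti); apply: le_X.
apply: wp_wset; [by lookup | by lia |].
exists (rcons q1 t), q2; lookup; rewrite -cats1 -catA size_cat /= addn1 mulSn.
split=> //.
- have := linked_next (q1 := q1 ++ [:: t]) (q2 := q2) (t := 0%N) (nxt := warr s 15).
  rewrite -catA -psE last_cat => <-; last exact: pc_linked P.
  by rewrite /= E2_wa E15; congr (warr s 15 _); framed Fr2; lookup.
- by lia.
- split=> [t'|i i_q].
    rewrite mem_cat mem_seq1 => /orP[t'q|/eqP->] //; rewrite F2 ?F_q1 //; exact: bots_inj.
  rewrite F2 ?F_other //; last by apply: i_q; rewrite mem_cat mem_head orbT.
  by move=> t' t'q; apply: i_q; rewrite mem_cat t'q.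
split=> [|_]; first by case: (q1).
have score_ge0 : 0 <= score s ys t.
  by rewrite addr_ge0 ?(near_ge0 _ _ tm) // (hp_ge0 A) //; lia.
rewrite /best_in; lookup; case: off => [[-> -> -> lt_X]|[le2 E23 w_in E2 le_X]].
  have [q10|/eqP q1_neq0] := eqVneq q1 [::].
    by have := lt_X t; rewrite leqnn (best0 q10) => /(_ _) lt0; have := lt0 ltac:(lia); lra.
  have [bl bw be max_q] := best q1_neq0; split=> //; first by rewrite mem_cat bl.
  move=> t' i; rewrite mem_cat mem_seq1 => /orP[t'q|/eqP->] ti; first exact: max_q ti.
  by apply: ltW; apply: lt_X.
rewrite E23; split=> //; first by rewrite mem_cat mem_head orbT.
move=> t' i; rewrite mem_cat mem_seq1 => /orP[t'q|/eqP->] ti; last exact: le_X.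
apply: le_trans le2; have [|_ _ _ max_q] := best; first by case: (q1) t'q.
exact: max_q ti.
Qed.

End Rounds.

(** * Activating a pick *)

(** Cutting below the selected position makes it a bottom, as required of picks and of positions
    from which new paths hang. Its unexplored child is taken and its height reset to 0, and both
    halves are scanned again since their ranges and heights have changed. *)
Definition split : cmd :=
  WSet 16 (WVar 23) ;;
  WSet 17 (WGet 13 (WVar 16)) ;;
  WSet 14 (WGet 11 (WVar 16)) ;;
  CSet 0 (CAdd (CSub (CGet 5 (WVar 14)) (CGet 3 (WVar 14))) (CGet 3 (WVar 22))) ;;
  CSet 1 (CSub (CAdd (CGet 5 (WVar 17)) (CGet 3 (WVar 17))) (CGet 3 (WVar 22))) ;;
  If (BCLe (CVar 0) (CVar 1)) Skip (CSet 0 (CVar 1)) ;;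
  CPut 5 (WVar 22) (CVar 0) ;;
  WSet 13 (WGet 12 (WVar 22)) ;;
  CPut 4 (WVar 22) CZero ;;
  WPut 12 (WVar 22) #0 ;;
  WPut 13 (WVar 16) (WVar 22) ;;
  WPut 14 (WVar 22) (WVar 16) ;;
  If (BWLt (WVar 22) (WVar 17)) (
    WSet 16 (WAdd (WVar 22) #1) ;;
    WPut 13 (WVar 16) (WVar 17) ;;
    WPut 14 (WVar 17) (WVar 16) ;;
    WPut 15 (WVar 16) (WGet 15 (WVar 23)) ;;
    WPut 15 (WVar 23) (WVar 16) ;;
    scan) Skip ;;
  WSet 16 (WVar 23) ;;
  WSet 17 (WVar 22) ;;
  scan.

(** Array 14 leads from a bottom directly to the top of its path, whose parent is the next bottom.
    The climb thus costs a bounded number of steps per path, not per position. *)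
Definition climb : cmd :=
  WSet 25 (WVar 24) ;;
  While (BNot (BWEq (WVar 25) #0)) (
    CSet 3 (CSub (CGet 3 (WVar 24)) (CGet 3 (WVar 25))) ;;
    If (BCLe (CVar 3) (CGet 5 (WVar 25))) (CPut 5 (WVar 25) (CVar 3)) Skip ;;
    WSet 25 (WGet 11 (WGet 14 (WVar 25)))).

Section Rounds2.
Context {R : realType}.
Variables (W S : nat) (orc : nat -> nat -> R).
Variables (N : nat) (par : nat -> nat) (wt : nat -> R) (D : nat -> nat -> R).
Variables (lc oc : nat -> nat) (hgt ohgt : nat -> R).
Hypothesis tm : tree_metric N par wt D.
Hypothesis lcs : long_children N par wt lc oc hgt ohgt.
Hypothesis wt1 : wt 1%N = 0.
Hypothesis N_gt0 : (0 < N)%N.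

Lemma active_take cnt nd pp ocp dep hp p w :
  active N par D oc ohgt cnt nd pp ocp dep hp 0 p -> (0 < w < cnt)%N ->
  active N par D oc ohgt cnt nd pp (upd ocp w 0%N) dep (upd hp w 0) (ocp w) w.
Proof.
move=> A wc; split; try by apply A.
- move=> i a ic aN ai; case: (act_child A ic aN ai) => [? | aoc | a0]; last by lia.
    by constructor 1.
  rewrite updE; have [iw|_] := eqVneq i w; first by constructor 3; rewrite -iw.
  by constructor 2.
- move=> i ic; rewrite !updE; have [//|iw] := eqVneq i w => oi.
  have [oE hE _ onj] := act_oc A ic oi; split=> // oE'.
  have iN := act_nd A ic; have wN := act_nd A wc.
  have [|_ opar _ _ _] := oc_spec lcs iN; first by rewrite -oE; lia.
  have ow : ocp w <> 0%N by rewrite -oE'.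
  have [owE _ _ _] := act_oc A wc ow.
  have [|_ owpar _ _ _] := oc_spec lcs wN; first by rewrite -owE; lia.
  move/eqP: iw; apply; apply: (act_inj A) => //.
  by rewrite -opar -owpar -oE -owE oE'.
- move=> i ic; rewrite !updE; have [//|iw] := eqVneq i w; exact: (act_oc0 A).
move=> ow; have [owE _ _ onj] := act_oc A wc ow; have wN := act_nd A wc.
have [|oN owpar _ _ _] := oc_spec lcs wN; first by rewrite -owE; lia.
rewrite -owE in oN owpar; split=> //; [by lia|by lia|].
by rewrite ifF; [split=> //; lia | lia].
Qed.

(** The state within a round, after the pass: the values at the bottoms are exact, and the node [z]
    may be pending below [p]. *)
Record exact_state (s : state R) (ps ys : seq nat) (z p : nat) : Prop := ExactState {
  ex_act : active_state N par D oc ohgt s z p;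
  ex_cnt : (1 < wvar s 11)%N;
  ex_pcs : piece_state S s (wvar s 11) ps;
  ex_max : forall t, t \in ps -> maxima s t;
  ex_F0 : carr s 5 0%N = 0;
  ex_ys : forall y, y \in ys -> exists2 t, t \in ps & warr s 10 (warr s 13 t) = y;
  ex_F : forall t, t \in ps -> carr s 5 (warr s 13 t) = near D ys (warr s 10 (warr s 13 t)) }.

Lemma upd_id (A : Type) (f : nat -> A) i : upd f i (f i) = f.
Proof. by apply: boolp.funext => j; rewrite updE; case: eqP => [->|]. Qed.

Lemma pieces_cut lim pp bot top nxt ps l w : pieces lim S pp bot top nxt ps ->
  l \in ps -> (l <= w <= bot l)%N ->
  exists2 ps', pieces lim S pp (if (w < bot l)%N then upd (upd bot l w) w.+1 (bot l) else upd bot l w)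
    (if (w < bot l)%N then upd (upd top w l) (bot l) w.+1 else upd top w l)
    (if (w < bot l)%N then upd (upd nxt w.+1 (nxt l)) l w.+1 else nxt) ps' &
  [/\ size ps' <= (size ps).+1, {subset ps <= ps'} &
   forall t, t \in ps' -> t \in ps \/ t = w.+1 /\ w < bot l]%N.
Proof.
move=> P lps lw; have [l_gt0 _ topl _] := pc_in P lps.
case: ifP => w_lt; last first.
  have wE : w = bot l by lia.
  exists ps; last by split=> // t tps; left.
  by rewrite wE upd_id; rewrite -{2}topl upd_id.
case/splitPr: ps / lps P => q1 q2 P.
exists (q1 ++ l :: w.+1 :: q2); first by apply: pieces_split => //; lia.
split; first by rewrite !size_cat /=; lia.
  by move=> t; rewrite !mem_cat !inE => /or3P[->|->|->]; rewrite ?orbT.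
move=> t; rewrite !mem_cat !inE => /or4P[->|->|/eqP->|->]; rewrite ?orbT; try by left.
by right.
Qed.

Hypothesis W_gt : (81 <= W)%N.
Hypothesis W_NS : (2 * N + S + 10 < W)%N.
Hypothesis S_gt0 : (0 < S)%N.

Lemma wp_split (s : state R) T Q ps ys p l w :
  exact_state s ps ys 0 p -> wvar s 23 = l -> wvar s 22 = w ->
  l \in ps -> (l <= w <= warr s 13 l)%N -> (40 * S + 80 <= T)%N ->
  (forall T' s' ps', (T <= T' + (40 * S + 80))%N -> frame split s s' ->
     exact_state s' ps' ys (warr s 12 w) w -> wvar s' 13 = warr s 12 w ->
     (size ps' <= (size ps).+1)%N -> l \in ps' -> warr s' 13 l = w -> Q T' s') ->
  wp W orc split s T Q.
Proof.
move=> Ex El Ew lps lw leT post; apply: wp_frame.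
have [A cnt1 P max_ps F0 ys_bot F_ex] := Ex.
have cntN := active_size N_gt0 A.
have [l_gt0 r_cnt topl rS] := pc_in P lps.
set r := warr s 13 l in lw l_gt0 r_cnt topl rS.
have Er : warr s 13 l = r by [].
have [ps' P' [sz_ps' sub_ps' ps'_sub]] := pieces_cut P lps lw.
rewrite Er in P'; rewrite Er in ps'_sub.
have wc : (0 < w < wvar s 11)%N by lia.
(* The value at the new bottom [w] is obtained before the cut, from the exact values at the two ends
   of the old path. *)
have Fw : near D ys (warr s 10 w) =
  Num.min (carr s 5 (warr s 11 l) - carr s 3 (warr s 11 l) + carr s 3 w)
          (carr s 5 r + carr s 3 r - carr s 3 w).
  rewrite (near_piece tm A cnt1 P ys_bot lps) -?Er //.
  rewrite (F_ex l lps) //; congr (Num.min (_ - _ + _) _).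
  have /pc_topo := P; rewrite -(cat_take_drop (index l ps) ps) topo_cat.
  rewrite (drop_nth 0%N) ?index_mem // nth_index //= => -[_ [[->|[t t_ps ->]] _]].
    by rewrite F0 (act_nd0 A) (near_root tm).
  by rewrite F_ex // (mem_take t_ps).
apply: wp_seq; wset; apply: wp_seq; apply: wp_wset; [by lookup; rewrite Er|by lia|].
do 3!(apply: wp_seq; first [wset | cset]).
apply: wp_seq.
apply: (@wp_conseq _ _ _ _ _ _ (fun T' s' => [/\ (T <= T' + 8)%N,
  cvar s' 0 = near D ys (warr s 10 w), warr s' = warr s, carr s' = carr s
 & [/\ wvar s' 16 = l, wvar s' 17 = r, wvar s' 22 = w, wvar s' 23 = l
     & wvar s' 11 = wvar s 11]])).
  wif => le_f.
    apply: wp_skip; first by lia.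
    by split=> //; [lia | lookup; rewrite Fw min_l].
  cset; split=> //; first by lia.
  by lookup; rewrite Fw min_r // ltW // ltNge.
move=> T1 s1 [leT1 E0 Ewa Eca [E16 E17 E22 E23 E11]].
apply: wp_seq; cput; apply: wp_seq; apply: wp_wset; [by lookup; rewrite Ewa|by lia|].
apply: wp_seq; cput; do 2!(apply: wp_seq; wput); apply: wp_seq; wput.
move Es2 : (set_warr _ 14 w l) => s2.
have E2_13 : warr s2 13 = upd (warr s 13) l w by rewrite -Es2; lookup; rewrite Ewa.
have E2_14 : warr s2 14 = upd (warr s 14) w l by rewrite -Es2; lookup; rewrite Ewa.
have E2_12 : warr s2 12 = upd (warr s 12) w 0%N by rewrite -Es2; lookup; rewrite Ewa.
have E2_15 : warr s2 15 = warr s 15 by rewrite -Es2; lookup; rewrite Ewa.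
have E2_16 : warr s2 16 = warr s 16 by rewrite -Es2; lookup; rewrite Ewa.
have E2_17 : warr s2 17 = warr s 17 by rewrite -Es2; lookup; rewrite Ewa.
have E2_10 : warr s2 10 = warr s 10 by rewrite -Es2; lookup; rewrite Ewa.
have E2_11 : warr s2 11 = warr s 11 by rewrite -Es2; lookup; rewrite Ewa.
have E2_3 : carr s2 3 = carr s 3 by rewrite -Es2; lookup; rewrite Eca.
have E2_4 : carr s2 4 = upd (carr s 4) w 0 by rewrite -Es2; lookup; rewrite Eca.
have E2_5 : carr s2 5 = upd (carr s 5) w (near D ys (warr s 10 w)) by rewrite -Es2; lookup; rewrite Eca.
have E2_v : [/\ wvar s2 16 = l, wvar s2 17 = r, wvar s2 22 = w, wvar s2 23 = l
   & wvar s2 13 = warr s 12 w] /\ wvar s2 11 = wvar s 11 by rewrite -Es2; lookup.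
have {Es2} [[V16 V17 V22 V23 V13] V11] := E2_v.
pose u i := upd (carr s 4) w 0 i + carr s 3 i.
pose v i := upd (carr s 4) w 0 i - carr s 3 i.
apply: wp_seq.
apply: (@wp_conseq _ _ _ _ _ _ (fun T' s' => [/\ (T <= T' + (20 * S + 40))%N,
  [/\ warr s' 13 = (if (w < r)%N then upd (upd (warr s 13) l w) w.+1 r else upd (warr s 13) l w),
      warr s' 14 = (if (w < r)%N then upd (upd (warr s 14) w l) r w.+1 else upd (warr s 14) w l),
      warr s' 15 = (if (w < r)%N then upd (upd (warr s 15) w.+1 (warr s 15 l)) l w.+1 else warr s 15)
    & [/\ warr s' 10 = warr s 10, warr s' 11 = warr s 11 & warr s' 12 = upd (warr s 12) w 0%N]],
  (w < r)%N -> prefix_max u (warr s' 16) w.+1 r /\ suffix_max v (warr s' 17) w.+1 r,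
  (forall i, ~~ (l <= i <= r)%N -> warr s' 16 i = warr s 16 i) /\
  (forall i, ~~ (l <= i <= r)%N -> warr s' 17 i = warr s 17 i) &
  [/\ wvar s' 22 = w, wvar s' 23 = l, wvar s' 13 = warr s 12 w, wvar s' 11 = wvar s 11
     & [/\ carr s' 3 = carr s 3, carr s' 4 = upd (carr s 4) w 0
         & carr s' 5 = upd (carr s 5) w (near D ys (warr s 10 w))]]])).
  wif => wr; last first.
    apply: wp_skip; first by lia.
    rewrite ifF; last by lia.
    split=> //; [by lia | by split; rewrite ?ifF //; lia | by lia |].
    by rewrite E2_16 E2_17.
  rewrite !ifT //.
  apply: wp_seq; wset; rewrite addn1; do 3!(apply: wp_seq; wput); apply: wp_seq; wput.
  move Es3 : (set_warr _ 15 l w.+1) => s3.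
  apply: (@wp_scan _ _ _ W_gt _ _ _ w.+1 r); try by rewrite -Es3; lookup.
  - by lia.
  - by lia.
  - by lia.
  move=> T4 s4 leT4 Fr4 pm sm out16 out17.
  have E3_3 : carr s3 3 = carr s 3 by rewrite -Es3.
  have E3_4 : carr s3 4 = upd (carr s 4) w 0 by rewrite -Es3.
  have E3_16 : warr s3 16 = warr s 16 by rewrite -Es3; lookup.
  have E3_17 : warr s3 17 = warr s 17 by rewrite -Es3; lookup.
  rewrite E3_3 E3_4 in pm sm.
  split; first by lia.
  - split; framed Fr4; rewrite -Es3; lookup; rewrite ?E2_13 ?E2_14 ?E2_15 //.
  - by [].
  - by split=> i ir; rewrite ?out16 ?out17 ?E3_16 ?E3_17 //; lia.
  - by framed Fr4; rewrite E3_3 E3_4 -Es3; lookup.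
move=> T3 s3 [leT3 [E13 E14 E15 [E10 E3_11 E12]] mx [out16 out17] [E3_22 E3_23 E3_13 E3_c [E3 E4 E5]]].
apply: wp_seq; wset; apply: wp_seq; wset.
move Es4 : (set_wvar _ 17 w) => s4.
apply: (@wp_scan _ _ _ W_gt _ _ _ l w); try by rewrite -Es4; lookup.
- by lia.
- by lia.
- by lia.
move=> T5 s5 leT5 Fr5 pm5 sm5 out5_16 out5_17 fr.
have E4c x : carr s4 x = carr s3 x by rewrite -Es4.
have E4w x : warr s4 x = warr s3 x by rewrite -Es4.
rewrite !E4c E3 E4 in pm5 sm5; rewrite E4w in out5_16; rewrite E4w in out5_17.
have F13 : warr s5 13 = warr s3 13 by framed Fr5.
have F14 : warr s5 14 = warr s3 14 by framed Fr5.
have F15 : warr s5 15 = warr s3 15 by framed Fr5.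
have F10 : warr s5 10 = warr s 10 by framed Fr5; rewrite E4w.
have F11 : warr s5 11 = warr s 11 by framed Fr5; rewrite E4w.
have F12 : warr s5 12 = upd (warr s 12) w 0%N by framed Fr5; rewrite E4w.
have F3 : carr s5 3 = carr s 3 by framed Fr5; rewrite E4c.
have F4 : carr s5 4 = upd (carr s 4) w 0 by framed Fr5; rewrite E4c.
have F5 : carr s5 5 = upd (carr s 5) w (near D ys (warr s 10 w)) by framed Fr5; rewrite E4c.
have Fc : wvar s5 11 = wvar s 11 by framed Fr5; rewrite -Es4; lookup.
have Fz : wvar s5 13 = warr s 12 w by framed Fr5; rewrite -Es4; lookup.
have bot_l : warr s5 13 l = w.
  by rewrite F13 E13; case: ifP => _; rewrite ?upd_eq // upd_neq ?upd_eq //; lia.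
have bot_w : (w < r)%N -> warr s5 13 w.+1 = r by move=> wr; rewrite F13 E13 wr upd_eq.
have bot_t t : t \in ps -> t != l -> warr s5 13 t = warr s 13 t.
  move=> tps tl; rewrite F13 E13; case: ifP => wr; last by rewrite upd_neq.
  rewrite !upd_neq //; apply/eqP => tw; have [? _ _ _] := pc_in P tps.
  by move/eqP: tl; apply; apply: (pc_disj P (i := t) tps lps); lia.
have apart t i : t \in ps -> t != l -> (t <= i <= warr s 13 t)%N -> ~~ (l <= i <= r)%N.
  move=> tps tl ti; apply/negP => li; move/eqP: tl; apply.
  exact: (pc_disj P (i := i) tps lps).
have at_w t : t \in ps -> t != l -> warr s 13 t != w.
  move=> tps tl; apply/eqP => tw; have [? _ _ _] := pc_in P tps.
  by have := apart t (warr s 13 t) tps tl; lia.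
apply: (post _ _ ps') => //; [by lia | | exact: sub_ps'].
split; rewrite ?Fc //.
- by rewrite /active_state Fc F10 F11 F12 F3 F4; apply: active_take A wc.
- by rewrite /piece_state F11 F13 F14 F15 E13 E14 E15; apply: P'.
- move=> t /ps'_sub[tps|[-> wr]].
    have [->|tl] := eqVneq t l.
      by split; rewrite bot_l F3 F4.
    apply: eq_maxima (max_ps t tps); first exact: bot_t.
    move=> i ti; have ir := apart t i tps tl ti.
    rewrite F3 F4 upd_neq; last by apply: contraNneq ir => ->; lia.
    by split=> //; rewrite ?out5_16 ?out5_17 ?out16 ?out17 //; lia.
  have [pm sm] := mx wr; rewrite /maxima bot_w // F3 F4; split.
    by apply: eq_prefix_max pm => i ti; split=> //; rewrite out5_16 //; lia.
  by apply: eq_suffix_max sm => i ti; split=> //; rewrite out5_17 //; lia.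
- by rewrite F5 upd_neq //; lia.
- move=> y /ys_bot[t tps yE]; rewrite F10.
  (* A pick at the old bottom of [l] now sits at the bottom of the lower half, or still at that of
     [l] if nothing was cut off. *)
  have [tl|tl] := eqVneq t l; last by exists t; rewrite ?sub_ps' // bot_t.
  have [wr|wr] := ltnP w r; last first.
    by exists l; [exact: sub_ps' | rewrite bot_l -yE tl -/r; congr (warr s 10 _); lia].
  exists w.+1; last by rewrite bot_w // -yE tl.
  have [t' t'ps' t'i] := pc_cover P' (i := w.+1) ltac:(lia).
  case: (ps'_sub t' t'ps') => [t'ps|[<- //]].
  rewrite wr in t'i; have := bot_t t' t'ps; rewrite F13 E13 wr.
  have [t'l|t'l] := eqVneq t' l; first by move: bot_l; rewrite F13 E13 wr t'l in t'i *; lia.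
  by move=> /(_ isT) bE; rewrite bE in t'i; have := apart t' w.+1 t'ps t'l t'i; lia.
move=> t /ps'_sub[tps|[-> wr]]; rewrite F10 F5; last first.
  by rewrite bot_w // upd_neq ?Er; [exact: F_ex lps | lia].
have [->|tl] := eqVneq t l; first by rewrite bot_l upd_eq.
by rewrite bot_t // upd_neq ?at_w // F_ex.
Qed.

End Rounds2.

(** Variable 24 receives the position of the pick: the selected position itself if nothing
    unexplored hangs from it, otherwise the last position of the new path. *)
Definition extend : cmd :=
  If (BWEq (WVar 13) #0) (WSet 24 (WVar 22)) (
    WSet 14 (WVar 22) ;;
    WSet 15 (WVar 23) ;;
    WSet 16 (WVar 11) ;;
    act_path ;;
    chop ;;
    WSet 24 (WSub (WVar 11) #1)).

Section Rounds3.
Context {R : realType}.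
Variables (W S : nat) (orc : nat -> nat -> R).
Variables (N : nat) (par : nat -> nat) (wt : nat -> R) (D : nat -> nat -> R).
Variables (lc oc : nat -> nat) (hgt ohgt : nat -> R).
Hypothesis tm : tree_metric N par wt D.
Hypothesis lcs : long_children N par wt lc oc hgt ohgt.
Hypothesis wt1 : wt 1%N = 0.
Hypothesis N_gt0 : (0 < N)%N.

Lemma eq_topo pp pp' bot B ps : {in ps, pp =1 pp'} -> topo pp bot B ps -> topo pp' bot B ps.
Proof.
elim: ps B => //= t ps IHps B eq_pp [Bt tps]; split; first by rewrite -eq_pp ?mem_head.
by apply: IHps tps => x xps; apply: eq_pp; rewrite inE xps orbT.
Qed.

Lemma eq_pieces lim pp pp' bot top nxt ps : (forall i, (i < lim)%N -> pp i = pp' i) ->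
  pieces lim S pp bot top nxt ps -> pieces lim S pp' bot top nxt ps.
Proof.
move=> eq_pp P; split; try by apply P.
- apply: eq_topo (pc_topo P) => t tps; apply: eq_pp.
  by have [? ? _ _] := pc_in P tps; lia.
- move=> t i tps ti; rewrite -eq_pp; first exact: (pc_chain P tps ti).
  by have [? ? _ _] := pc_in P tps; lia.
Qed.

(** All picks are active, hence none lies below the unexplored child, and every way from [v] to a
    pick first climbs to [nd i]. *)
Lemma near_unexplored cnt nd pp ocp dep hp p ys i v :
  active N par D oc ohgt cnt nd pp ocp dep hp 0 p -> (1 < cnt)%N ->
  (forall y, y \in ys -> exists2 j, (0 < j < cnt)%N & nd j = y) ->
  (0 < i < cnt)%N -> ocp i <> 0%N -> (v <= N)%N -> anc par (ocp i) v ->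
  near D ys v = near D ys (nd i) + (D 1 v - D 1 (nd i)).
Proof.
move=> A cnt1 ys_act ic oi vN ov; have [oE _ _ _] := act_oc A ic oi.
have iN := act_nd A ic; have [|oN opar _ _ _] := oc_spec lcs iN; first by rewrite -oE; lia.
rewrite -oE in oN opar.
have iv : anc par (nd i) v by apply: anc_trans ov; rewrite -opar; apply: anc_par.
have dE : D v (nd i) = D 1 v - D 1 (nd i) by apply: (D_anc tm) => //; lia.
apply/le_anti/andP; split; first by rewrite -dE; apply: near_lip tm.
have far y : y \in ys -> D v y = D 1 v - D 1 (nd i) + D (nd i) y.
  move=> /ys_act[j jc <-]; rewrite -opar; apply: (D_cut tm) => //; first by lia.
    by apply: (act_nd A).
  exact: (unexplored_anc tm N_gt0 A cnt1).
case: (near_attained D ys v) => [->|[y yys ->]].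
  by have := near_le1 D ys (nd i); rewrite !(Dsym tm _ 1); lra.
by have := near_le D (nd i) yys; rewrite (far y yys); lra.
Qed.

Hypothesis W_gt : (81 <= W)%N.
Hypothesis W_NS : (2 * N + S + 10 < W)%N.
Hypothesis S_gt0 : (0 < S)%N.

Lemma wp_extend (s : state R) T Q ps ys z w l :
  exact_state S N par D oc ohgt s ps ys z w -> tables S wt lc oc ohgt s ->
  wvar s 13 = z -> wvar s 22 = w -> wvar s 23 = l -> l \in ps -> warr s 13 l = w ->
  (forall v, z <> 0%N -> (v <= N)%N -> anc par z v ->
     near D ys v = near D ys (warr s 10 w) + (D 1 v - D 1 (warr s 10 w))) ->
  (80 * (N.+1 - wvar s 11) + 60 <= T)%N ->
  (forall T' s' ps' x, (T <= T' + 80 * (wvar s' 11 - wvar s 11) + 60)%N ->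
     frame extend s s' -> (wvar s 11 <= wvar s' 11)%N ->
     ready S N par D oc ohgt s' ps' ys ->
     (size ps' * S <= size ps * S + (wvar s' 11 - wvar s 11) + S)%N ->
     x \in ps' -> wvar s' 24 = warr s' 13 x ->
     near D ys (warr s' 10 (warr s' 13 x)) = near D ys (warr s 10 w) +
       (if z == 0%N then 0 else D 1 z + hgt z - D 1 (warr s 10 w)) -> Q T' s') ->
  wp W orc extend s T Q.
Proof.
move=> Ex tabs Ez Ew El lps bl HU leT post; apply: wp_frame.
have [A cnt1 P max_ps F0 ys_bot F_ex] := Ex.
have cntN := active_size N_gt0 A.
have bot_c t : t \in ps -> (0 < t <= warr s 13 t)%N /\ (warr s 13 t < wvar s 11)%N.
  by move=> /(pc_in P)[].
wif => [/eqP z0|/eqP z_neq0].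
  wset => fr; apply: (post _ _ ps l) => //.
  - by lia.
  - split=> //; first by exists w; rewrite -z0.
    by move=> t tps; rewrite F_ex //; split=> //; left.
  - by lookup; lia.
  - by rewrite /= bl z0 eqxx addr0.
apply: wp_seq; wset; apply: wp_seq; wset; apply: wp_seq; wset.
move Es1 : (set_wvar _ 16 _) => s1.
have A1 : active_state N par D oc ohgt s1 z w by rewrite -Es1.
have tabs1 : tables S wt lc oc ohgt s1 by case: tabs => *; rewrite -Es1; split.
apply: wp_seq; apply: (@wp_act_path _ _ _ _ _ _ _ _ _ _ _ _ tm lcs wt1 N_gt0 W_gt W_NS S_gt0 _ _ _ (wvar s 11) z w tabs1 A1).
all: try by rewrite -Es1; lookup.
  by lia.
move=> T2 s2 leT2 Fr2 [p2 A2] old new [[//]|[_ [c_lt dE]]].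
set c := wvar s 11 in c_lt leT2 old new cntN bot_c A cnt1 P *.
move Ec2 : (wvar s2 11) => c2 in c_lt leT2 dE *.
have c2N := active_size N_gt0 A2; rewrite Ec2 in c2N.
have [l_gt0 lc_] := bot_c l lps; rewrite bl in l_gt0 lc_.
have E1w x : warr s1 x = warr s x by rewrite -Es1.
have E1c x : carr s1 x = carr s x by rewrite -Es1.
have o_nd i : (i < c)%N -> warr s2 10 i = warr s 10 i by move=> ic; rewrite (op_nd old) // E1w.
have o_pp i : (i < c)%N -> warr s2 11 i = warr s 11 i by move=> ic; rewrite (op_pp old) // E1w.
have o_dep i : (i < c)%N -> carr s2 3 i = carr s 3 i by move=> ic; rewrite (op_dep old) // E1c.
have o_hp i : (i < c)%N -> carr s2 4 i = carr s 4 i by move=> ic; rewrite (op_hp old) // E1c.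
have o_F i : (i < c)%N -> carr s2 5 i = carr s 5 i by move=> ic; rewrite (op_F old) // E1c.
have o_13 : warr s2 13 = warr s 13 by framed Fr2.
have o_14 : warr s2 14 = warr s 14 by framed Fr2.
have o_15 : warr s2 15 = warr s 15 by framed Fr2.
have o_16 : warr s2 16 = warr s 16 by framed Fr2.
have o_17 : warr s2 17 = warr s 17 by framed Fr2.
have [q1 [q2 [psE lastE lq1]]] : exists q1 q2, [/\ ps = q1 ++ q2, last 0%N q1 = l & l \in q1].
  case/splitPr: lps => q1 q2; exists (rcons q1 l), q2.
  by rewrite cat_rcons last_rcons mem_rcons mem_head.
have pp_c : warr s2 11 c = w by apply: (np_top new); rewrite Ec2.
have pp_new i : (c < i < c2)%N -> warr s2 11 i = i.-1.
  by move=> ic; apply: (np_pp new); rewrite Ec2.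
have P2 : piece_state S s2 c (q1 ++ q2).
  rewrite -psE /piece_state o_13 o_14 o_15; apply: eq_pieces P => i ic.
  by rewrite o_pp.
apply: wp_seq; apply: (@wp_chop _ _ _ _ N N_gt0 W_gt W_NS S_gt0 s2 _ _ c c2 q1 q2) => //.
- by framed Fr2; apply: tab_S tabs1.
- by framed Fr2; rewrite -Es1; lookup.
- by framed Fr2; rewrite -Es1; lookup.
- by lia.
- by move=> _; right; exists l; rewrite // pp_c o_13.
- by lia.
move=> T3 s3 qs leT3 Fr3 P3 ch.
apply: wp_wset; [by lookup; framed Fr3; rewrite Ec2; ev|by lia|] => fr.
have F10 : warr s3 10 = warr s2 10 by framed Fr3.
have F11 : warr s3 11 = warr s2 11 by framed Fr3.
have F3 : carr s3 3 = carr s2 3 by framed Fr3.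
have F4 : carr s3 4 = carr s2 4 by framed Fr3.
have F5 : carr s3 5 = carr s2 5 by framed Fr3.
have Fc : wvar s3 11 = c2 by framed Fr3.
have in_ps t : t \in q1 ++ qs ++ q2 = (t \in ps) || (t \in qs).
  by rewrite psE !mem_cat; case: (t \in q1); case: (t \in qs); case: (t \in q2).
have bot_old t : t \in ps -> warr s3 13 t = warr s 13 t.
  by move=> /bot_c[? ?]; rewrite (ch_bot ch) ?o_13 //; lia.
have bot_new t : t \in qs -> (c <= t <= warr s3 13 t)%N /\ (warr s3 13 t < c2)%N.
  move=> tqs; have ? := ch_ge ch tqs; have [|? ? _ _] := pc_in P3 (t := t); last by lia.
  by rewrite in_ps tqs orbT.
have near_new i : (c <= i < c2)%N -> near D ys (warr s2 10 i) =
    near D ys (warr s 10 w) + (D 1 (warr s2 10 i) - D 1 (warr s 10 w)).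
  move=> ic; apply: HU => //; last by apply: (np_anc new); rewrite Ec2.
  by have := act_nd A2 (i := i); lia.
have dep_new i : (c <= i < c2)%N -> carr s2 3 i = D 1 (warr s2 10 i).
  by move=> ic; apply: (act_dep A2); lia.
have dep_w : carr s 3 w = D 1 (warr s 10 w) by apply: (act_dep A); lia.
have [x xps x_c2] := pc_cover P3 (i := c2.-1) ltac:(lia).
have [_ x_lt _ _] := pc_in P3 xps.
have bx : warr s3 13 x = c2.-1 by lia.
apply: (post _ _ (q1 ++ qs ++ q2) x) => //; lookup; rewrite ?Fc.
- by lia.
- by lia.
- split; lookup; rewrite ?Fc.
  + by exists p2; rewrite /active_state; lookup; rewrite -Ec2 F10 F11 F3 F4 (fr_warr Fr3).
  + by lia.
  + exact: P3.
  + move=> t; rewrite in_ps => /orP[tps|tqs]; last exact: (ch_max ch tqs).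
    have [? ?] := bot_c t tps; apply: eq_maxima (max_ps t tps); first exact: bot_old.
    move=> i ti; lookup; rewrite F3 F4 o_dep ?o_hp //; try by lia.
    by rewrite (ch_pref ch) ?(ch_suff ch) ?o_16 ?o_17 //; lia.
  + by rewrite F5 o_F //; lia.
  + move=> y /ys_bot[t tps <-]; exists t; first by rewrite in_ps tps.
    by rewrite bot_old // F10 o_nd //; have [] := bot_c t tps.
  move=> t; rewrite in_ps => /orP[tps|tqs]; lookup; rewrite F10 F11 F3 F5.
    have [? ?] := bot_c t tps; rewrite bot_old // o_nd // o_F // F_ex //.
    by split; [exact: lexx | left].
  have [tb b_c2] := bot_new t tqs.
  have b_new : (c <= warr s3 13 t < c2)%N by lia.
  (* New bottoms store their depth, which is at least the distance to the picks. Every pick is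
     reached through [w], hence through the parent of the new path, which is the second alternative
     of [prefit]. *)
  split; first by rewrite (np_F new) ?Ec2 // dep_new // (Dsym tm); apply: near_le1.
  right; rewrite near_new // dep_new //.
  have [->|tc] := eqVneq t c.
    by rewrite pp_c (o_nd w) ?(o_dep w) ?dep_w; [lra | lia | lia].
  have t1_new : (c <= t.-1 < c2)%N by lia.
  rewrite pp_new; last by lia.
  by rewrite near_new // dep_new //; lra.
- have := ch_size ch; rewrite !size_cat psE size_cat !mulnDl; lia.
- by rewrite bx; lia.
by rewrite bx F10 near_new ?dE ?ifF //; [exact/eqP | lia].
Qed.

End Rounds3.

(** * The rounds of the greedy selection *)

Definition round : cmd :=
  pass ;; split ;; extend ;; climb ;;
  WPut 2 (WVar 12) (WVar 2) ;;
  WPut 3 (WVar 12) (WGet 7 (WGet 10 (WVar 24))) ;;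
  WSet 12 (WAdd (WVar 12) #1).

Definition start : cmd :=
  WPut 10 #0 #1 ;;
  WSet 11 #1 ;;
  WSet 13 #1 ;;
  WSet 14 #0 ;;
  WSet 15 #0 ;;
  WSet 16 #1 ;;
  act_path ;;
  chop.

Definition rounds : cmd :=
  start ;;
  WSet 12 #0 ;;
  While (BWLt (WVar 12) (WVar 1)) round.

Section Rounds4.
Context {R : realType}.
Variables (W S : nat) (orc : nat -> nat -> R).
Variables (N : nat) (par : nat -> nat) (wt : nat -> R) (D : nat -> nat -> R).
Variables (lc oc : nat -> nat) (hgt ohgt : nat -> R).
Hypothesis tm : tree_metric N par wt D.
Hypothesis lcs : long_children N par wt lc oc hgt ohgt.
Hypothesis wt1 : wt 1%N = 0.
Hypothesis N_gt0 : (0 < N)%N.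
Hypothesis W_gt : (81 <= W)%N.
Hypothesis W_NS : (2 * N + S + 10 < W)%N.
Hypothesis S_gt0 : (0 < S)%N.

Local Notation ready := (ready S N par D oc ohgt).
Local Notation tables := (tables S wt lc oc ohgt).

Lemma wp_climb (s : state R) T Q ps ys x :
  ready s ps ys -> x \in ps -> wvar s 24 = warr s 13 x -> (8 * size ps + 10 <= T)%N ->
  (forall T' s', (T <= T' + (8 * size ps + 10))%N -> frame climb s s' ->
     ready s' ps (rcons ys (warr s 10 (warr s 13 x))) -> Q T' s') ->
  wp W orc climb s T Q.
Proof.
move=> rd xps Ex leT post; apply: wp_frame.
have [[p0 A] cnt1 P max_ps F0 ys_bot fit] := rd.
have bot_c t : t \in ps -> (0 < t <= warr s 13 t)%N /\ (warr s 13 t < wvar s 11)%N.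
  by move=> /(pc_in P)[].
have bot_inj t t' : t \in ps -> t' \in ps -> warr s 13 t = warr s 13 t' -> t = t'.
  move=> tps t'ps tt'; have [? ?] := bot_c t tps; have [? ?] := bot_c t' t'ps.
  by apply: (pc_disj P (i := warr s 13 t) tps t'ps); lia.
set e := warr s 13 x in Ex *.
pose new i := Num.min (carr s 5 i) (carr s 3 e - carr s 3 i).
apply: wp_seq; wset.
(* The path of the current bottom lies in the prefix [q1]. Its parent path is listed earlier, so
   [q1] shrinks at each step, which bounds the length of the climb. *)
pose I T' (s' : state R) := exists q1 q2 b, [/\ ps = q1 ++ q2, wvar s' 25 = b,
  b = 0%N \/ (exists2 t, t \in q1 & b = warr s 13 t /\ anc (warr s 11) b e),
  (T <= T' + 8 * size q2 + 4)%N &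
  [/\ forall t, t \in ps -> anc (warr s 11) (warr s 13 t) e ->
        carr s' 5 (warr s 13 t) = new (warr s 13 t) \/
        carr s' 5 (warr s 13 t) = carr s 5 (warr s 13 t) /\ anc (warr s 11) (warr s 13 t) b,
      forall t, t \in ps -> ~ anc (warr s 11) (warr s 13 t) e ->
        carr s' 5 (warr s 13 t) = carr s 5 (warr s 13 t)
    & carr s' 5 0%N = 0]].
apply: (wp_while (I := I)).
  exists ps, [::], e; lookup; rewrite cats0; split=> //; [|by lia|by split=> // t tps te; right].
  by right; exists x => //; split=> //; apply: anc_refl.
move=> {}T' s' [q1 [q2 [b [psE Eb b_in leT' [F_anc F_nanc F0']]]]] Fr.
have sz : (size ps = size q1 + size q2)%N by rewrite psE size_cat.
split; first by lia.
have E24 : wvar s' 24 = e by framed Fr; lookup.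
have E3 : carr s' 3 = carr s 3 by framed Fr.
have E11 : warr s' 11 = warr s 11 by framed Fr.
have E14 : warr s' 14 = warr s 14 by framed Fr.
have E13 : warr s' 13 = warr s 13 by framed Fr.
ev; have [b0|b_neq0] := eqVneq b 0%N; rewrite /=.
  move=> fr; apply: post => //; first by lia.
  have Ec : wvar s' 11 = wvar s 11 by framed Fr; lookup.
  have E10 : warr s' 10 = warr s 10 by framed Fr.
  have E12 : warr s' 12 = warr s 12 by framed Fr.
  have E15 : warr s' 15 = warr s 15 by framed Fr.
  have E16 : warr s' 16 = warr s 16 by framed Fr.
  have E17 : warr s' 17 = warr s 17 by framed Fr.
  have E4 : carr s' 4 = carr s 4 by framed Fr.
  split; rewrite ?Ec //.
  - by exists p0; rewrite /active_state Ec E10 E11 E12 E3 E4.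
  - by rewrite /piece_state E11 E13 E14 E15.
  - by move=> t tps; rewrite /maxima E3 E4 E13 E16 E17; apply: max_ps.
  - move=> y; rewrite mem_rcons inE => /predU1P[->|/ys_bot[t tps <-]].
      by exists x; rewrite // E10 E13.
    by exists t; rewrite // E10 E13.
  rewrite E10 E11 E3 E13; apply: (prefit_climb tm A cnt1 P xps fit) => t tps.
    move=> te; case: (F_anc t tps te) => // -[_]; rewrite b0 => /(anc0 (active_metric tm N_gt0 A cnt1)).
    by have [? ?] := bot_c t tps; lia.
  exact: F_nanc.
case: b_in => [b0|[t tq [bE be]]]; first by rewrite b0 in b_neq0.
have tps : t \in ps by rewrite psE mem_cat tq.
have [_ _ topt _] := pc_in P tps.
case/splitPr: q1 / tq psE sz => r1 r2 psE sz.
have hang : warr s 11 t = 0%N \/ exists2 t', t' \in r1 & warr s 11 t = warr s 13 t'.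
  have := pc_topo P; rewrite psE -catA topo_cat /= => -[_ [h _]].
  by case: h => [->|[t' ? ->]]; [left | right; exists t'].
have anc_next t' : t' \in ps -> anc (warr s 11) (warr s 13 t') b ->
    warr s 13 t' = b \/ anc (warr s 11) (warr s 13 t') (warr s 11 t).
  by move=> t'ps; rewrite bE; apply: (bottom_step tm A cnt1 P).
have b_new : carr s' 5 b = new b \/ carr s' 5 b = carr s 5 b.
  by rewrite bE; rewrite bE in be; case: (F_anc t tps be) => [?|[? _]]; [left|right].
apply: wp_seq; cset; rewrite E3.
apply: wp_seq.
apply: (@wp_conseq _ _ _ _ _ _ (fun T'' s'' => [/\ (T'.-1 <= T'' + 3)%N,
  carr s'' 5 b = new b, (forall i, i <> b -> carr s'' 5 i = carr s' 5 i),
  warr s'' = warr s' & wvar s'' = wvar s'])).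
  wif => le_F.
    cput; lookup; split; rewrite ?upd_eq //; first by lia.
      by rewrite /new; case: b_new le_F => -> le_F; [move: le_F; rewrite le_min; case/andP => *; rewrite min_r // | rewrite min_r].
    by move=> i /eqP ib; rewrite upd_neq.
  apply: wp_skip; first by lia.
  split=> //; [by lia | lookup].
  rewrite /new; case: b_new le_F => -> // le_F.
  by rewrite min_l // ltW // ltNge.
move=> T2 s2 [leT2 F_b F_other Ewa Ewv].
apply: (@wp_wset _ _ _ _ _ (warr s 11 t)).
  by lookup; rewrite Ewa Ewv Eb E11 E14 bE topt.
  by lia.
exists r1, (t :: r2 ++ q2), (warr s 11 t); lookup; split=> //.
- by rewrite psE -catA.
- case: hang => [->|[t' t'r ptE]]; [by left | right; exists t' => //].
  split=> //; apply: anc_trans be; rewrite bE.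
  have [tb _] := bot_c t tps.
  by apply: anc_trans (anc_par _ t) _; apply: (anc_piece A cnt1 P tps); lia.
- by rewrite /= size_cat; move: sz; rewrite size_cat /=; lia.
split.
- move=> t' t'ps t'e; have [tb|/eqP tb] := eqVneq (warr s 13 t') b.
    by left; rewrite tb.
  rewrite F_other //; case: (F_anc t' t'ps t'e) => [|[F' /(anc_next _ t'ps)[]//]]; first by left.
  by move=> ?; right.
- move=> t' t'ps nt'e; rewrite F_other ?F_nanc // => tb.
  by apply: nt'e; rewrite tb.
by rewrite F_other // => b0; rewrite -b0 in b_neq0.
Qed.

End Rounds4.

Section Rounds5.
Context {R : realType}.
Variables (W S : nat) (orc : nat -> nat -> R).
Variables (N : nat) (par : nat -> nat) (wt : nat -> R) (D : nat -> nat -> R).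
Variables (lc oc : nat -> nat) (hgt ohgt : nat -> R).
Hypothesis tm : tree_metric N par wt D.
Hypothesis lcs : long_children N par wt lc oc hgt ohgt.
Hypothesis wt1 : wt 1%N = 0.
Hypothesis N_gt0 : (0 < N)%N.
Hypothesis W_gt : (81 <= W)%N.
Hypothesis W_NS : (2 * N + S + 10 < W)%N.
Hypothesis S_gt0 : (0 < S)%N.

Local Notation ready := (ready S N par D oc ohgt).
Local Notation tables := (tables S wt lc oc ohgt).

(** Per path, [6 * m + 60] steps pay for the pass and 8 for the climb; [40 * S] covers the two scans
    after the cut. Each newly activated position pays 80 steps for activation and scanning, and 8
    more because it may bring a new path to the climb. *)
Lemma wp_round (s : state R) T Q ps ys m :
  ready s ps ys -> tables s -> (2 * N < 2 ^ m)%N -> ((wvar s 12).+1 < W)%N ->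
  (size ps * (6 * m + 68) + 40 * S + 88 * (N.+1 - wvar s 11) + 300 <= T)%N ->
  (forall T' s' ps' y,
     (T <= T' + (size ps * (6 * m + 68) + 40 * S + 88 * (wvar s' 11 - wvar s 11) + 300))%N ->
     frame round s s' -> ready s' ps' (rcons ys y) ->
     (wvar s 11 <= wvar s' 11)%N ->
     (size ps' * S <= size ps * S + (wvar s' 11 - wvar s 11) + 2 * S)%N ->
     (0 < y <= N)%N -> (forall v, (0 < v <= N)%N -> near D ys v <= near D ys y) ->
     warr s' 2 = upd (warr s 2) (wvar s 12) (wvar s 2) ->
     warr s' 3 = upd (warr s 3) (wvar s 12) (warr s 7 y) ->
     wvar s' 12 = (wvar s 12).+1 -> Q T' s') ->
  wp W orc round s T Q.
Proof.
move=> rd tabs Nm iW leT post; apply: wp_frame.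
have [[p0 A] cnt1 P max_ps F0 ys_bot fit] := rd.
have cntN := active_size N_gt0 A.
have mul_m : (size ps * (6 * m + 68) = size ps * (6 * m + 60) + 8 * size ps)%N by lia.
apply: wp_seq; apply: (wp_pass orc tm lcs N_gt0 W_gt W_NS S_gt0 rd Nm); first by lia.
move=> T1 s1 leT1 Fr1 F1_0 F1 [l_in lw bestE best_max].
set l := wvar s1 23 in l_in lw *; set w := wvar s1 22 in lw bestE *.
have Ex1 : exact_state S N par D oc ohgt s1 ps ys 0 p0.
  have E x : x \in [:: 10; 11; 12; 13; 14; 15; 16; 17]%N -> warr s1 x = warr s x.
    by rewrite !inE; do !(case/predU1P=> [->|]; first by framed Fr1); move/eqP->; framed Fr1.
  have E3 : carr s1 3 = carr s 3 by framed Fr1.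
  have E4 : carr s1 4 = carr s 4 by framed Fr1.
  have Ec : wvar s1 11 = wvar s 11 by framed Fr1.
  split; rewrite /active_state /piece_state ?Ec ?E3 ?E4 ?E //.
  - by move=> t tps; rewrite /maxima E3 E4 !E //; apply: max_ps.
have wc : (0 < w < wvar s 11)%N by have [? ? _ _] := pc_in P l_in; lia.
have E1_10 : warr s1 10 = warr s 10 by framed Fr1.
have E1_12 : warr s1 12 = warr s 12 by framed Fr1.
have E1_13 : warr s1 13 = warr s 13 by framed Fr1.
apply: wp_seq; apply: (wp_split orc tm lcs N_gt0 W_gt W_NS S_gt0 Ex1 (l := l) (w := w)) => //.
- by rewrite E1_13.
- by lia.
move=> T2 s2 ps2 leT2 Fr2 Ex2 E2_13 sz2 l2 bl2; rewrite E1_12 in Ex2 E2_13.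
have E2_10 : warr s2 10 = warr s 10 by framed Fr2.
have E2_c : wvar s2 11 = wvar s 11 by framed Fr2; framed Fr1.
have tabs2 : tables s2.
  by case: tabs => *; split; framed Fr2; framed Fr1.
have ys_act y : y \in ys -> exists2 j, (0 < j < wvar s 11)%N & warr s 10 j = y.
  move=> /ys_bot[t tps <-]; exists (warr s 13 t) => //.
  by have [? ? _ _] := pc_in P tps; lia.
apply: wp_seq; apply: (wp_extend orc tm lcs wt1 N_gt0 W_gt W_NS S_gt0 Ex2 tabs2 E2_13 _ _ l2 bl2).
- by framed Fr2.
- by framed Fr2.
- move=> v zN vN zv; rewrite E2_10; exact: (near_unexplored tm lcs N_gt0 A cnt1 ys_act wc).
- by rewrite E2_c; lia.
move=> T3 s3 ps3 x leT3 Fr3 c_le rd3 sz3 x3 E24 nearE; rewrite E2_c in leT3 c_le sz3.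
set y := warr s3 10 (warr s3 13 x) in nearE *.
have [[p3 A3] cnt3 P3 _ _ _ _] := rd3.
have c3N := active_size N_gt0 A3.
have sz3' : (size ps3 <= size ps + 2 + (wvar s3 11 - wvar s 11))%N.
  rewrite -(leq_pmul2r S_gt0) !mulnDl; apply: leq_trans sz3 _.
  have := leq_mul sz2 (leqnn S); rewrite mulSn.
  by have := leq_pmulr (wvar s3 11 - wvar s 11) S_gt0; lia.
have [x_gt0 x_lt _ _] := pc_in P3 x3.
apply: wp_seq; apply: (wp_climb orc tm N_gt0 W_gt W_NS S_gt0 rd3 x3 E24); first by lia.
move=> T4 s4 leT4 Fr4 rd4; rewrite -/y in rd4.
have E4_12 : wvar s4 12 = wvar s 12 by framed Fr4; framed Fr3; framed Fr2; framed Fr1.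
have E4_2 : wvar s4 2 = wvar s 2 by framed Fr4; framed Fr3; framed Fr2; framed Fr1.
have E4_w2 : warr s4 2 = warr s 2 by framed Fr4; framed Fr3; framed Fr2; framed Fr1.
have E4_w3 : warr s4 3 = warr s 3 by framed Fr4; framed Fr3; framed Fr2; framed Fr1.
have E4_w7 : warr s4 7 = warr s 7 by framed Fr4; framed Fr3; framed Fr2; framed Fr1.
have E4_c : wvar s4 11 = wvar s3 11 by framed Fr4.
have E4_y : warr s4 10 (wvar s4 24) = y by framed Fr4; rewrite E24.
apply: wp_seq; wput; apply: wp_seq; wput; wset => fr.
apply: (post _ _ ps3 y) => //; lookup; rewrite ?E4_w2 ?E4_w3 ?E4_w7 ?E4_y ?addn1 //.
- by lia.
- by case: rd4 => *; split.
- by have := leq_mul sz2 (leqnn S); rewrite mulSn; lia.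
- by apply: (act_nd A3); lia.
move=> v vN; have [i ic le_v] := near_le_hanging tm lcs N_gt0 A cnt1 ys vN.
apply: le_trans le_v _.
have [t tps ti] := pc_cover P ic; have := best_max t i tps ti.
rewrite bestE nearE E2_10; suff -> : (if warr s 12 w == 0%N then 0
    else D 1 (warr s 12 w) + hgt (warr s 12 w) - D 1 (warr s 10 w)) = carr s 4 w by lra.
have [z0|/eqP z0] := eqVneq (warr s 12 w) 0%N; first by rewrite (act_oc0 A wc z0).
have [oE hE _ _] := act_oc A wc z0; have wN := act_nd A wc.
have [|oN opar _ ohE _] := oc_spec lcs wN; first by rewrite -oE; lia.
by rewrite hE ohE -oE (dep_step tm) ?oE // opar; lra.
Qed.

Lemma wp_start (s : state R) T Q : tables s -> warr s 11 0%N = 0%N ->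
  warr s 15 0%N = 0%N -> carr s 3 0%N = 0 -> carr s 5 0%N = 0 ->
  (80 * N + 100 <= T)%N ->
  (forall T' s' ps, (T <= T' + 80 * (wvar s' 11 - 1) + 100)%N -> frame start s s' ->
     ready s' ps [::] -> (size ps * S <= wvar s' 11 + S)%N -> Q T' s') ->
  wp W orc start s T Q.
Proof.
move=> tabs pp0 nxt0 dep0 F0 leT post; apply: wp_frame.
apply: wp_seq; wput; do 4!(apply: wp_seq; wset); apply: wp_seq; wset.
move Es1 : (set_wvar _ 16 1) => s1.
have tabs1 : tables s1 by case: tabs => *; rewrite -Es1; split.
have A1 : active_state N par D oc ohgt s1 1 0.
  by rewrite /active_state -Es1; lookup; apply: active_start; rewrite ?upd_eq.
apply: wp_seq; apply: (@wp_act_path _ _ _ _ _ _ _ _ _ _ _ _ tm lcs wt1 N_gt0 W_gt W_NS S_gt0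
   _ _ _ 1 1 0 tabs1 A1); try by rewrite -Es1; lookup.
  by lia.
move=> T2 s2 leT2 Fr2 [p2 A2] old new [[//]|[_ [c_lt _]]].
move Ec2 : (wvar s2 11) => c2 in c_lt leT2 *.
have c2N := active_size N_gt0 A2; rewrite Ec2 in c2N.
have P2 : piece_state S s2 1 ([::] ++ [::]).
  by apply: pieces_start; framed Fr2; rewrite -Es1; lookup.
apply: (@wp_chop _ _ _ _ N N_gt0 W_gt W_NS S_gt0 s2 _ _ 1 c2 [::] [::]) => //.
- by framed Fr2; apply: tab_S tabs1.
- by framed Fr2; rewrite -Es1; lookup.
- by framed Fr2; rewrite -Es1; lookup.
- by lia.
- by move=> i ic; apply: (np_pp new); rewrite Ec2.
- by move=> _; left; apply: (np_top new); rewrite Ec2.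
- by lia.
move=> T3 s3 qs leT3 Fr3; rewrite cats0 /= => P3 ch fr.
have F10 : warr s3 10 = warr s2 10 by framed Fr3.
have F11 : warr s3 11 = warr s2 11 by framed Fr3.
have F12 : warr s3 12 = warr s2 12 by framed Fr3.
have F3 : carr s3 3 = carr s2 3 by framed Fr3.
have F4 : carr s3 4 = carr s2 4 by framed Fr3.
have F5 : carr s3 5 = carr s2 5 by framed Fr3.
have Fc : wvar s3 11 = c2 by framed Fr3.
apply: (post _ _ qs) => //; rewrite ?Fc; [by lia| |by have := ch_size ch; lia].
split; rewrite ?Fc //.
- by exists p2; rewrite /active_state Fc -Ec2 F10 F11 F12 F3 F4.
- exact: ch_max ch.
- by rewrite F5 (op_F old) // -Es1; lookup.
move=> t tqs; have t_ge := ch_ge ch tqs; have [? ? _ _] := pc_in P3 tqs.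
rewrite F10 F11 F3 F5 /near !big_nil (np_F new) ?Ec2; last by lia.
rewrite (act_dep A2); last by lia.
by rewrite (Dsym tm); split; [exact: lexx | left].
Qed.

Definition greedy (ys : seq nat) : Prop :=
  forall l, (l < size ys)%N -> forall v, (0 < v <= N)%N ->
  near D (take l ys) v <= near D (take l ys) (nth 0%N ys l).

(** The number of paths is bounded through the positions they contain. A round adds at most two
    paths not accounted for in this way, one by the cut and one at the end of the new path, and the
    start adds one; this is the term [2 * k + 1]. *)
Lemma wp_rounds (s : state R) T Q k m M :
  tables s -> wvar s 1 = k -> warr s 11 0%N = 0%N ->
  warr s 15 0%N = 0%N -> carr s 3 0%N = 0 -> carr s 5 0%N = 0 -> (2 * N < 2 ^ m)%N ->
  (k.+1 < W)%N -> (forall p, (p * S <= N.+1 + S * (2 * k + 1))%N -> (p <= M)%N) ->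
  (k * (M * (6 * m + 68) + 40 * S + 301) + 88 * N.+1 + 110 <= T)%N ->
  (forall T' s' ys, size ys = k -> greedy ys ->
     (forall y, y \in ys -> (0 < y <= N)%N) ->
     (forall l, (l < k)%N -> warr s' 2 l = wvar s 2 /\ warr s' 3 l = warr s 7 (nth 0%N ys l)) ->
     Q T' s') ->
  wp W orc rounds s T Q.
Proof.
move=> tabs Ek pp0 nxt0 dep0 F0 Nm kW hM leT post.
apply: wp_seq; apply: wp_start => //; first by lia.
move=> T1 s1 ps1 leT1 Fr1 rd1 sz1.
have c1N : (0 < wvar s1 11 <= N.+1)%N.
  by have [[p A] c1 _ _ _ _ _] := rd1; have := active_size N_gt0 A; lia.
apply: wp_seq; wset.
move EC : (M * (6 * m + 68) + 40 * S + 301)%N leT => C leT.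
pose I T' (s' : state R) := exists ps ys, [/\ wvar s' 12 = size ys /\ (size ys <= k)%N,
  ready s' ps ys /\ greedy ys,
  (size ps * S <= wvar s' 11 + S * (2 * size ys + 1))%N /\ (wvar s' 11 <= N.+1)%N,
  ((k - size ys) * C + 88 * (N.+1 - wvar s' 11) + 4 <= T')%N &
  (forall y, y \in ys -> (0 < y <= N)%N) /\
  forall l, (l < size ys)%N ->
    warr s' 2 l = wvar s 2 /\ warr s' 3 l = warr s 7 (nth 0%N ys l)].
apply: (wp_while (I := I)).
  exists ps1, [::]; lookup; split=> //.
  - by split=> //; case: rd1 => *; split.
  - by lia.
  - by rewrite subn0; lia.
move=> T2 s2 [ps [ys [[E12 ys_k] [rd gr] [sz cN] leT2 [ysN out]]]] Fr.
split; first by apply: leq_trans leT2; rewrite addnS.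
have E1 : wvar s2 1 = k by framed Fr; lookup; framed Fr1.
have E2 : wvar s2 2 = wvar s 2 by framed Fr; lookup; framed Fr1.
have E7 : warr s2 7 = warr s 7 by framed Fr; lookup; framed Fr1.
have tabs2 : tables s2 by case: tabs => *; split; framed Fr; lookup; framed Fr1.
ev; case: ifP => ik; last first.
  have szk : size ys = k by lia.
  by apply: (post _ _ ys) => // l lk; apply: out; lia.
have szM : (size ps <= M)%N.
  apply: hM; apply: leq_trans sz _; apply: leq_add => //.
  by rewrite leq_pmul2l //; lia.
have cost : (size ps * (6 * m + 68) + 40 * S + 301 <= C)%N.
  by rewrite -EC !leq_add2r leq_mul.
have kC : ((k - size ys) * C = (k - (size ys).+1) * C + C)%N.
  by rewrite -mulSnr; congr (_ * _)%N; lia.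
rewrite kC in leT2; move EX : ((k - (size ys).+1) * C)%N leT2 => X leT2.
move Esz : (size ps * (6 * m + 68))%N cost => Y cost.
apply: (wp_round rd tabs2 Nm); rewrite ?Esz; [by lia | by lia |].
move=> T3 s3 ps' y leT3 Fr3 rd3 c_le sz3 yN y_max out2 out3 E12'.
have [[p3 A3] _ _ _ _ _ _] := rd3; have c3N := active_size N_gt0 A3.
exists ps', (rcons ys y); rewrite size_rcons; split=> //.
- by rewrite E12' E12; lia.
- split=> // l; rewrite size_rcons ltnS => l_le v vN.
  have [->|l_neq] := eqVneq l (size ys).
    by rewrite nth_rcons ltnn eqxx -cats1 take_size_cat // y_max.
  have l_lt : (l < size ys)%N by lia.
  by rewrite nth_rcons l_lt -cats1 takel_cat ?(ltnW l_lt) //; apply: gr.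
- by split=> //; move: sz3 sz; lia.
- by rewrite EX; lia.
split=> [x|l l_lt]; first by rewrite mem_rcons inE => /predU1P[->//|/ysN].
rewrite out2 out3 E12 E2 E7 !updE nth_rcons.
have [->|l_neq] := eqVneq l (size ys); first by rewrite ltnn.
by have l_lt' : (l < size ys)%N by [lia]; rewrite l_lt'; apply: out.
Qed.

End Rounds5.

(** * Heights *)

(** Nodes are treated in decreasing order. Since parents have smaller numbers, the height of a node
    is final when it is passed on to its parent. *)
Definition heights : cmd :=
  WSet 5 (WMul #2 (WVar 0)) ;;
  While (BWLt #2 (WVar 5)) (
    WSet 5 (WSub (WVar 5) #1) ;;
    WSet 6 (WGet 6 (WVar 5)) ;;
    CSet 0 (CAdd (CGet 1 (WVar 5)) (CGet 0 (WVar 5))) ;;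
    If (BWEq (WGet 8 (WVar 6)) #0)
      (WPut 8 (WVar 6) (WVar 5) ;; CPut 1 (WVar 6) (CVar 0))
      (If (BCLe (CGet 1 (WVar 6)) (CVar 0))
        (WPut 9 (WVar 6) (WGet 8 (WVar 6)) ;;
         CPut 2 (WVar 6) (CGet 1 (WVar 6)) ;;
         WPut 8 (WVar 6) (WVar 5) ;;
         CPut 1 (WVar 6) (CVar 0))
        (WPut 9 (WVar 6) (WVar 5) ;;
         CPut 2 (WVar 6) (CVar 0)))).

Section Heights.
Context {R : realType}.
Variables (W n : nat) (orc : nat -> nat -> R) (par : nat -> nat) (wt : nat -> R).
Local Notation N := (2 * n - 1)%N.
Hypothesis n_gt0 : (0 < n)%N.
Hypothesis W_gt : (81 <= W)%N.
Hypothesis W_n : (4 * n + 10 < W)%N.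
Hypothesis par_lt : forall z, (1 < z <= N)%N -> (0 < par z < z)%N.
Hypothesis binary : forall a b c, (1 < a < b)%N -> (b < c <= N)%N ->
  par a = par b -> par a = par c -> False.

(* The children from z on have been taken into account. *)
Record pushed z (lc oc : nat -> nat) (hgt ohgt : nat -> R) : Prop := Pushed {
  pu_lc : forall p, lc p <> 0%N ->
    [/\ (z <= lc p <= N)%N, par (lc p) = p & hgt p = hgt (lc p) + wt (lc p)];
  pu_lc0 : forall p, lc p = 0%N -> hgt p = 0 /\ oc p = 0%N;
  pu_oc : forall p, oc p <> 0%N -> [/\ (z <= oc p <= N)%N, par (oc p) = p, oc p <> lc p,
    ohgt p = hgt (oc p) + wt (oc p) & ohgt p <= hgt p];
  pu_oc0 : forall p, oc p = 0%N -> ohgt p = 0;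
  pu_child : forall a, (z <= a <= N)%N -> a = lc (par a) \/ a = oc (par a) }.

Lemma pushed_step z lc oc hgt ohgt lc' oc' hgt' ohgt' :
  pushed z.+1 lc oc hgt ohgt -> (1 < z <= N)%N ->
  (forall q, q != par z -> [/\ lc' q = lc q, oc' q = oc q, hgt' q = hgt q & ohgt' q = ohgt q]) ->
  [/\ (z <= lc' (par z) <= N)%N, par (lc' (par z)) = par z &
      hgt' (par z) = hgt (lc' (par z)) + wt (lc' (par z))] ->
  (oc' (par z) <> 0%N -> [/\ (z <= oc' (par z) <= N)%N, par (oc' (par z)) = par z,
     oc' (par z) <> lc' (par z), ohgt' (par z) = hgt (oc' (par z)) + wt (oc' (par z))
   & ohgt' (par z) <= hgt' (par z)]) ->
  (oc' (par z) = 0%N -> ohgt' (par z) = 0) ->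
  (forall a, a <> 0%N -> [\/ a = z, a = lc (par z) | a = oc (par z)] ->
     a = lc' (par z) \/ a = oc' (par z)) ->
  pushed z lc' oc' hgt' ohgt'.
Proof.
move=> pu zN other lcz ocz oc0z childz; have pz := par_lt zN.
have hgt_new a : (z <= a)%N -> hgt' a = hgt a.
  by move=> za; have [|_ _ -> _] := other a; first lia.
split=> [p|p|p|p|a za].
- have [->|pz'] := eqVneq p (par z).
    by move=> _; have [? ? ->] := lcz; split=> //; rewrite hgt_new //; lia.
  have [-> _ -> _] := other p pz' => /(pu_lc pu)[? ? ->].
  by split=> //; [lia | rewrite hgt_new //; lia].
- have [->|pz'] := eqVneq p (par z); first by have [? _ _] := lcz; lia.
  by have [-> -> -> _] := other p pz'; apply: (pu_lc0 pu).
- have [->|pz'] := eqVneq p (par z).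
    by move=> /ocz[? ? ? -> ?]; split=> //; rewrite hgt_new //; lia.
  have [-> -> -> ->] := other p pz' => /(pu_oc pu)[? ? ? -> ?].
  by split=> //; [lia | rewrite hgt_new //; lia].
- have [->|pz'] := eqVneq p (par z); first exact: oc0z.
  by have [_ -> _ ->] := other p pz'; apply: (pu_oc0 pu).
have [az|az] := eqVneq a z.
  by rewrite az; apply: childz; [lia | constructor 1].
have a_old : (z < a <= N)%N by lia.
have := pu_child pu a_old; have [paz|paz] := eqVneq (par a) (par z).
  by rewrite paz => -[aE|aE]; apply: childz; try lia; [constructor 2 | constructor 3].
by have [-> -> _ _] := other _ paz.
Qed.

Lemma wp_heights (s : state R) T Q :
  wvar s 0 = n -> warr s 6 = par -> carr s 0 = wt -> warr s 8 = (fun=> 0%N) ->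
  warr s 9 = (fun=> 0%N) -> carr s 1 = (fun=> 0) -> carr s 2 = (fun=> 0) ->
  (20 * n + 20 <= T)%N ->
  (forall T' s', (T <= T' + (20 * n + 20))%N -> frame heights s s' ->
     long_children N par wt (warr s' 8) (warr s' 9) (carr s' 1) (carr s' 2) -> Q T' s') ->
  wp W orc heights s T Q.
Proof.
move=> En Epar Ewt E8 E9 E1 E2 leT post; apply: wp_frame.
apply: wp_seq; wset.
pose I T' (s' : state R) := exists z, [/\ wvar s' 5 = z, (1 < z <= 2 * n)%N,
  (T <= T' + 10 * (2 * n - z) + 5)%N &
  pushed z (warr s' 8) (warr s' 9) (carr s' 1) (carr s' 2)].
apply: (wp_while (I := I)).
  exists (2 * n)%N; lookup; split=> //; [by lia|by lia|].
  by split; rewrite ?E8 ?E9 ?E1 ?E2 //; lia.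
move=> {}T' s' [z [Ez zn leT' pu]] Fr.
have Epar' : warr s' 6 = par by framed Fr; lookup.
have Ewt' : carr s' 0 = wt by framed Fr; lookup.
split; first by lia.
ev; case: ifP => z2; last first.
  have z2' : z = 2%N by lia.
  move=> fr; apply: post => //; first by lia.
  rewrite z2' in pu; split.
  - by move=> p pN /eqP/(pu_lc pu)[].
  - by move=> p pN /(pu_lc0 pu)[].
  - by move=> p pN /eqP/(pu_oc pu)[].
  - by move=> p pN; apply: (pu_oc0 pu).
  - by move=> a aN; apply: (pu_child pu).
apply: wp_seq; wset; apply: wp_seq; apply: wp_wset; [by lookup; rewrite Epar' | by lia |].
move Ez' : (z - 1)%N => z'.
have zE : z = z'.+1 by lia.
have z'N : (1 < z' <= N)%N by lia.
rewrite zE in pu; have pz := par_lt z'N.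
apply: wp_seq; cset; rewrite Ewt'.
set p := par z' in pz *; set val := carr s' 1 z' + wt z'.
wif => [/eqP lc0|/eqP lc_neq0].
  have [hgt0 oc0] := pu_lc0 pu lc0.
  apply: wp_seq; wput; cput; exists z'; lookup; split=> //; [by lia | by lia |].
  apply: (pushed_step pu z'N) => [q qp||||a a0]; rewrite -/p ?upd_eq.
  - by rewrite !upd_neq.
  - by split=> //; lia.
  - by rewrite oc0.
  - exact: (pu_oc0 pu).
  - by rewrite lc0 oc0; case=> //; left.
have [lcN plc lcE] := pu_lc pu lc_neq0.
(* Otherwise [z'] would be a third child of [p], against [binary]. *)
have oc0 : warr s' 9 p = 0%N.
  case: (eqVneq (warr s' 9 p) 0%N) => // /eqP oc_neq0.
  have [ocN poc ocE _ _] := pu_oc pu oc_neq0; exfalso.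
  have [lt|ge] := ltnP (warr s' 8 p) (warr s' 9 p).
    by apply: (binary (a := z') (b := warr s' 8 p) (c := warr s' 9 p)); rewrite ?plc ?poc //; lia.
  by apply: (binary (a := z') (b := warr s' 9 p) (c := warr s' 8 p)); rewrite ?plc ?poc //; lia.
wif => le_h.
  apply: wp_seq; wput; apply: wp_seq; cput; apply: wp_seq; wput; cput.
  exists z'; lookup; split=> //; [by lia | by lia |].
  apply: (pushed_step pu z'N) => [q qp||||a a0]; rewrite -/p ?upd_eq.
  - by rewrite !upd_neq.
  - by split=> //; lia.
  - by move=> _; split=> //; lia.
  - by lia.
  - by rewrite oc0; case=> //; [left | right].
apply: wp_seq; wput; cput; exists z'; lookup; split=> //; [by lia | by lia |].
apply: (pushed_step pu z'N) => [q qp||||a a0]; rewrite -/p ?upd_eq.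
- by rewrite !upd_neq.
- by split=> //; lia.
- by move=> _; split=> //; [lia | lia | apply: ltW; rewrite ltNge].
- by lia.
- by rewrite oc0; case=> //; [right | left].
Qed.

End Heights.

(** * Breadth-first search *)

Section Bridge.
Context {V : finType}.
Variable T : rel V.
Hypothesis Ttree : is_tree T.

Definition cut_edge (u q : V) : rel V :=
  [rel x y | T x y && ([set x; y] != [set u; q])].

Lemma cut_edge_sym u q : symmetric (cut_edge u q).
Proof. by move=> x y; rewrite /cut_edge /= (tree_sym Ttree) setUC. Qed.

(** A simple path that avoids the edge closes up with it to a cycle on at least three vertices,
    since the only shorter path is the edge itself. *)
Lemma tree_bridge u q : T u q -> ~~ connect (cut_edge u q) u q.
Proof.
move=> Tuq; apply/negP => /connectP[p0 Ep0 qE].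
case: (shortenP Ep0) qE => p Ep up _ {p0 Ep0} qE.
have Tp : path T u p by apply: sub_path Ep => x y /andP[].
suff : (2 < size (u :: p))%N.
  rewrite ltnNge => /negP; apply; apply: (tree_acyclic Ttree).
  by rewrite /ucycle up andbT /= rcons_path Tp -qE (tree_sym Ttree).
case: p Ep {Tp up} qE => [_ /= qu|a [|b p]] //=.
  by rewrite qu (tree_irr Ttree) in Tuq.
by move=> /andP[/andP[_ neq] _] qa; rewrite qa eqxx in neq.
Qed.

End Bridge.

(** * The binary tree built by a complete search *)

Section BfsTree.
Context {R : realType}.
Variables (n : nat) (T : rel 'I_n) (c : 'I_n -> 'I_n -> R) (x1 : 'I_n).
Hypothesis Tc : metric_instance T c.

(* The i-th visited vertex is vt i, its parent vt (pi i), and t vertices have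
   been visited.  Node 2i+1 stands for vt i; node 2i, at distance 0 from the
   parent, chains the children of vt (pi i), so that every node has at most two
   children.  rho gives the vertex at which a node is located. *)
Record bfs_tree t (vt : nat -> 'I_n) (pi par rho : nat -> nat) (wt : nat -> R) : Prop :=
  BfsTree {
  bt_t : (0 < t <= n)%N;
  bt_vt0 : vt 0%N = x1;
  bt_inj : forall i j, (i < t)%N -> (j < t)%N -> vt i = vt j -> i = j;
  bt_rho1 : forall j, (j < t)%N -> rho (2 * j + 1)%N = vt j;
  bt_rho0 : forall j, (0 < j < t)%N -> rho (2 * j)%N = vt (pi j);
  bt_pi0 : pi 0%N = 0%N;
  bt_pi : forall j, (0 < j < t)%N -> (pi j < j)%N;
  bt_edge : forall j, (0 < j < t)%N -> T (vt j) (vt (pi j));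
  bt_mono : forall i j, (0 < i <= j)%N -> (j < t)%N -> (pi i <= pi j)%N;
  bt_par0 : par 0%N = 0%N;
  bt_par1 : par 1%N = 0%N;
  bt_par_odd : forall j, (0 < j < t)%N -> par (2 * j + 1)%N = (2 * j)%N;
  bt_par_even : forall j, (0 < j < t)%N ->
    par (2 * j)%N = if (1 < j)%N && (pi j.-1 == pi j) then (2 * j.-1)%N else (2 * pi j + 1)%N;
  bt_wt1 : wt 1%N = 0;
  bt_wt_even : forall j, wt (2 * j)%N = 0;
  bt_wt_odd : forall j, (0 < j < t)%N -> wt (2 * j + 1)%N = c (vt (pi j)) (vt j) }.

Variables (vt : nat -> 'I_n) (pi par rho : nat -> nat) (wt : nat -> R).
Hypothesis bt : bfs_tree n vt pi par rho wt.

Let Ttree := instance_tree Tc.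
Let T_sym := tree_sym Ttree.

Let T_neq u v : T u v -> u != v.
Proof. by apply: contraTneq => ->; rewrite (tree_irr Ttree). Qed.

Let T_ge0 u v : T u v -> 0 <= c u v.
Proof. by move/T_neq/(cost_ge0 Tc). Qed.

Lemma vt_surj v : exists2 i, (i < n)%N & vt i = v.
Proof.
have inj : injective (fun i : 'I_n => vt i).
  by move=> i j /(bt_inj bt) ij; apply: val_inj; apply: ij.
by have [g _ gK] := injF_bij inj; exists (g v); rewrite ?gK.
Qed.

Lemma pi_anc_le j i : (i < n)%N -> anc pi j i -> (j <= i)%N.
Proof.
move=> + [m]; elim: m i => [|m IHm] i iN; first by move=> <-.
rewrite iterSr; have [i0|i0] := posnP i.
  by rewrite i0 (bt_pi0 bt) => /IHm; apply; have := bt_t bt; lia.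
by have pii := bt_pi bt (j := i) ltac:(lia) => /IHm le_j; have := le_j ltac:(lia); lia.
Qed.

(** Parent edges other than the one above [j] connect the subtree of [j] to [vt j], and all
    remaining vertices, including [vt (pi j)], to the root. Another edge between the two sides would
    bypass a bridge. *)
Lemma crossing_edge j a b : (0 < j < n)%N -> (a < n)%N -> (b < n)%N ->
  T (vt a) (vt b) -> anc pi j a -> ~ anc pi j b -> a = j /\ b = pi j.
Proof.
move=> jn an bn Tab ja njb.
have pij := bt_pi bt jn.
pose E := cut_edge T (vt j) (vt (pi j)).
have E_sym : connect_sym E by apply: sym_connect_sym; apply: cut_edge_sym.
have step i : (0 < i < n)%N -> i != j -> connect E (vt i) (vt (pi i)).
  move=> iN ij; apply: connect1; rewrite /E /cut_edge /= (bt_edge bt) //=.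
  have pii := bt_pi bt iN; apply/eqP => same.
  have /set2P[/(bt_inj bt) ij'|/(bt_inj bt) ip] : vt i \in [set vt j; vt (pi j)].
      by rewrite -same set21.
    by move/eqP: ij; apply; apply: ij'; lia.
  have {}ip : i = pi j by apply: ip; lia.
  have /set2P[/(bt_inj bt) ij'|/(bt_inj bt) ip'] : vt (pi i) \in [set vt j; vt (pi j)].
      by rewrite -same set22.
    by have := ij' ltac:(lia) ltac:(lia); lia.
  by have := ip' ltac:(lia) ltac:(lia); lia.
have up i : (i < n)%N -> anc pi j i -> connect E (vt i) (vt j).
  elim/ltn_ind: i => i IHi iN ji; have [->|ij] := eqVneq i j; first exact: connect0.
  case: (anc_case ji) => [jE|jpi]; first by rewrite jE eqxx in ij.
  have i0 : (0 < i)%N by have := pi_anc_le iN ji; lia.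
  have pii := bt_pi bt (j := i) ltac:(lia).
  by apply: connect_trans (step i _ ij) (IHi _ _ _ jpi); lia.
have down i : (i < n)%N -> ~ anc pi j i -> connect E (vt i) (vt 0%N).
  elim/ltn_ind: i => i IHi iN nji; have [->|i0] := posnP i; first exact: connect0.
  have pii := bt_pi bt (j := i) ltac:(lia).
  apply: connect_trans (step i _ _) (IHi _ _ _ _); try lia.
    by apply/eqP => ij; apply: nji; rewrite ij; apply: anc_refl.
  by move=> jpi; apply: nji; apply: anc_trans jpi (anc_par pi i).
have npij : ~ anc pi j (pi j) by move=> /pi_anc_le; lia.
have := tree_bridge Ttree (bt_edge bt jn) => /negP nbridge.
have [same|diff] := eqVneq [set vt a; vt b] [set vt j; vt (pi j)].
  have /set2P[/(bt_inj bt) aj|/(bt_inj bt) ap] : vt a \in [set vt j; vt (pi j)].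
      by rewrite -same set21.
    have {}aj : a = j by apply: aj; lia.
    split=> //; have /set2P[/(bt_inj bt) bj|/(bt_inj bt) bp] :
      vt b \in [set vt j; vt (pi j)] by rewrite -same set22.
      by case: njb; rewrite bj; [apply: anc_refl | lia | lia].
    by apply: bp; lia.
  by case: npij; rewrite -ap //; lia.
case: nbridge; apply: connect_trans (_ : connect E _ (vt a)) _.
  by rewrite E_sym; apply: up.
apply: connect_trans (_ : connect E _ (vt b)) _.
  by apply: connect1; rewrite /E /cut_edge /= Tab.
apply: connect_trans (down b bn njb) _; rewrite E_sym; apply: down => //; lia.
Qed.

Lemma edge_parent a b : (a < n)%N -> (b < n)%N -> T (vt a) (vt b) -> a = pi b \/ b = pi a.
Proof.
move=> an bn Tab; have ab : a <> b by move=> ab; have := T_neq Tab; rewrite ab eqxx.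
have [lt|ge] := ltnP a b.
  left; have bn' : (0 < b < n)%N by lia.
  have nba : ~ anc pi b a by move/(pi_anc_le an); lia.
  by have [] := crossing_edge bn' bn an (etrans (T_sym _ _) Tab) (anc_refl _ _) nba.
right; have an' : (0 < a < n)%N by lia.
have nab : ~ anc pi a b by move/(pi_anc_le bn); lia.
by have [] := crossing_edge an' an bn Tab (anc_refl _ _) nab.
Qed.

Let dT := dist T c.

(** A walk that leaves the subtree of [j] has to use the edge to the parent. The induction along the
    walk runs over an arbitrary start in the subtree. *)
Lemma vertex_cut j i : (0 < j < n)%N -> (i < n)%N -> ~ anc pi j i ->
  dT (vt j) (vt i) = c (vt (pi j)) (vt j) + dT (vt (pi j)) (vt i).
Proof.
move=> jn iN nji; have Tj := bt_edge bt jn.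
rewrite (cost_sym Tc); last by apply: T_neq; rewrite T_sym.
have conn := tree_connected Ttree.
apply/le_anti/andP; split.
  apply: le_trans (dist_triangle conn T_ge0 (vt (pi j)) _ _) _.
  by rewrite lerD2r; apply: dist_edge.
apply: le_dist => // p.
suff cross a q : (a < n)%N -> anc pi j a -> path T (vt a) q -> last (vt a) q = vt i ->
    c (vt j) (vt (pi j)) + dT (vt (pi j)) (vt i) <= walk_cost c (vt a) q.
  by apply: cross; [lia | apply: anc_refl].
elim: q a => [|w q IHq] a an ja /=.
  by move=> _ /(bt_inj bt) ai; case: nji; rewrite -ai.
have [b bn <-] := vt_surj w => /andP[Tab Tq] lq.
have [jb|njb] := boolp.pselect (anc pi j b).
  by apply: le_trans (IHq b bn jb Tq lq) _; rewrite lerDr T_ge0.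
have [aj bj] := crossing_edge jn an bn Tab ja njb.
by rewrite aj bj in Tq lq *; rewrite lerD2l; apply: dist_le.
Qed.

Definition loc z : 'I_n := insubd x1 (rho z).
Definition node_dist z z' : R := dT (loc z) (loc z').

Local Notation N := (2 * n - 1)%N.

Lemma loc_odd j : (j < n)%N -> loc (2 * j + 1) = vt j.
Proof. by move=> jn; rewrite /loc (bt_rho1 bt jn) valKd. Qed.

Lemma loc_even j : (0 < j < n)%N -> loc (2 * j) = vt (pi j).
Proof. by move=> jn; rewrite /loc (bt_rho0 bt jn) valKd. Qed.

Lemma node_cases z : (0 < z <= N)%N ->
  (exists2 j, (j < n)%N & z = (2 * j + 1)%N) \/ (exists2 j, (0 < j < n)%N & z = (2 * j)%N).
Proof.
move=> zN; have := odd_double_half z; rewrite -mul2n; case: (odd z) => /= zE.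
  by left; exists z./2; lia.
by right; exists z./2; lia.
Qed.

Lemma bfs_par_lt z : (1 < z <= N)%N -> (0 < par z < z)%N.
Proof.
move=> zN; have [|[j jn zE]|[j jn zE]] := node_cases (z := z); first by lia.
  by rewrite zE (bt_par_odd bt); lia.
rewrite zE (bt_par_even bt) //; have := bt_pi bt jn; case: ifP => // ? ?; lia.
Qed.

Lemma even_anc j : (0 < j < n)%N -> anc par (2 * pi j + 1) (2 * j).
Proof.
elim/ltn_ind: j => j IHj jn; have := bt_par_even bt jn.
case: ifP => [/andP[j1 /eqP pij] parE|_ <-]; last exact: anc_par.
have := IHj j.-1; rewrite pij => /(_ _ _) anc_pj.
by apply: anc_trans (anc_par par (2 * j)); rewrite parE; apply: anc_pj; lia.
Qed.

Lemma anc_vertex j i : (0 < j < n)%N -> (i < n)%N -> anc pi j i ->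
  anc par (2 * j + 1) (2 * i + 1).
Proof.
move=> jn; elim/ltn_ind: i => i IHi iN ji.
case: (anc_case ji) => [->|jpi]; first exact: anc_refl.
have i0 : (0 < i)%N by have := pi_anc_le iN ji; lia.
have pii := bt_pi bt (j := i) ltac:(lia).
apply: anc_trans (anc_trans (IHi _ pii _ jpi) (even_anc _)) _; [by lia|by lia|].
by have := anc_par par (2 * i + 1); rewrite (bt_par_odd bt) //; lia.
Qed.

Lemma bfs_metric : tree_metric N par wt node_dist.
Proof.
have conn := tree_connected Ttree.
split.
- exact: bt_par0 bt.
- exact: bt_par1 bt.
- exact: bfs_par_lt.
- move=> z zN; have [|[j jn zE]|[j jn zE]] := node_cases (z := z); first by lia.
    rewrite zE (bt_wt_odd bt); last by lia.
    by apply: T_ge0; rewrite T_sym; apply: (bt_edge bt); lia.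
  by rewrite zE (bt_wt_even bt).
- by move=> z; apply: distxx.
- by move=> z z'; apply: dist_sym => // u v /T_neq/(cost_sym Tc).
- by move=> z z'; apply: dist_ge0.
- by move=> y x z; apply: dist_triangle.
move=> z b zN bN nzb.
have [|[j jn zE]|[j jn zE]] := node_cases (z := z); first by lia.
  have jn' : (0 < j < n)%N by lia.
  rewrite zE (bt_wt_odd bt jn') (bt_par_odd bt jn') /node_dist loc_odd // loc_even //.
  have {bN}[[i iN bE]|[i iN bE]] := node_cases bN.
    rewrite bE loc_odd // vertex_cut // => ji; apply: nzb.
    by rewrite zE bE; apply: anc_vertex.
  have pii := bt_pi bt iN.
  rewrite bE loc_even // vertex_cut //; first by lia.
  move=> ji; apply: nzb; rewrite zE bE; apply: anc_trans (even_anc iN).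
  by apply: anc_vertex => //; lia.
have pij := bt_pi bt jn.
rewrite zE (bt_wt_even bt) add0r /node_dist; congr (dT _ _).
rewrite loc_even // (bt_par_even bt jn); case: ifP => [/andP[j1 /eqP pE]|_].
  by rewrite loc_even ?pE //; lia.
by rewrite loc_odd //; lia.
Qed.

(** Two of the three nodes have the same parity, while [par] is injective on the odd nodes and on
    the even nodes in question. For even nodes this rests on [bt_mono]: siblings are visited
    consecutively, so each chain link has one successor. *)
Lemma bfs_binary a b d : (1 < a < b)%N -> (b < d <= N)%N ->
  par a = par b -> par a = par d -> False.
Proof.
have odd_inj i j : (0 < i < n)%N -> (0 < j < n)%N -> par (2 * i + 1)%N = par (2 * j + 1)%N -> i = j.
  by move=> iN jN; rewrite !(bt_par_odd bt) //; lia.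
have even_inj i j : (0 < i < j)%N -> (j < n)%N -> par (2 * i)%N = par (2 * j)%N -> False.
  move=> ij jn; rewrite !(bt_par_even bt); [|lia|lia].
  have mono1 := bt_mono bt (i := i) (j := j.-1) ltac:(lia) ltac:(lia).
  have mono2 := bt_mono bt (i := j.-1) (j := j) ltac:(lia) ltac:(lia).
  case: ifP => [/andP[i1 /eqP]|]; case: ifP => [/andP[j1 /eqP]|] => ? ? ?; try lia.
have even_inj' i j : (0 < i < n)%N -> (0 < j < n)%N -> par (2 * i)%N = par (2 * j)%N -> i = j.
  by move=> iN jn ij; case: (ltngtP i j) => // lt; exfalso;
    [apply: (even_inj i j) => //; lia | apply: (even_inj j i) => //; lia].
move=> ab bd pab pad; have pbd : par b = par d by rewrite -pab.
have [|[i iN aE]|[i iN aE]] := node_cases (z := a); [by lia | |];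
have [|[j jN bE]|[j jN bE]] := node_cases (z := b); try (by lia);
have [|[l lN dE]|[l lN dE]] := node_cases (z := d); try (by lia);
rewrite aE bE in pab; rewrite bE dE in pbd; rewrite aE dE in pad.
all: first
  [ by have := odd_inj i j ltac:(lia) ltac:(lia) pab; lia
  | by have := odd_inj i l ltac:(lia) ltac:(lia) pad; lia
  | by have := odd_inj j l ltac:(lia) ltac:(lia) pbd; lia
  | by have := even_inj' i j ltac:(lia) ltac:(lia) pab; lia
  | by have := even_inj' i l ltac:(lia) ltac:(lia) pad; lia
  | by have := even_inj' j l ltac:(lia) ltac:(lia) pbd; lia ].
Qed.

(** Every edge joins a vertex to its parent, so an ordered adjacent pair is coded by the index of
    the child and an orientation. *)
Lemma sum_degrees : (\sum_v #|[pred w | T v w]| <= 2 * n)%N.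
Proof.
under eq_bigr => v _ do rewrite -sum1_card.
rewrite pair_big_dep /= sum1_card.
pose f (ei : bool * 'I_n) := if ei.1 then (vt (pi ei.2), vt ei.2) else (vt ei.2, vt (pi ei.2)).
have -> : (2 * n)%N = #|[set: bool * 'I_n]| by rewrite cardsT card_prod card_bool card_ord.
apply: leq_trans (leq_imset_card f _); apply/subset_leq_card/subsetP => -[u v].
rewrite unfold_in /= => Tuv; have [a an uE] := vt_surj u; have [b bn vE] := vt_surj v.
rewrite -uE -vE in Tuv *; case: (edge_parent an bn Tuv) => eq_pi.
  by apply/imsetP; exists (true, Ordinal bn); rewrite ?inE // /f /= -eq_pi.
by apply/imsetP; exists (false, Ordinal an); rewrite ?inE // /f /= -eq_pi.
Qed.

End BfsTree.

Section BfsSteps.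
Context {R : realType}.
Variables (n : nat) (T : rel 'I_n) (c : 'I_n -> 'I_n -> R) (x1 : 'I_n).
Hypothesis Tc : metric_instance T c.

Lemma visited_le t (vt : nat -> 'I_n) :
  (forall i j, (i < t)%N -> (j < t)%N -> vt i = vt j -> i = j) -> (t <= n)%N.
Proof.
move=> inj; have vt_inj : injective (fun i : 'I_t => vt i).
  by move=> i j ij; apply/val_inj/(inj _ _ (ltn_ord i) (ltn_ord j)).
by have := leq_card _ vt_inj; rewrite !card_ord.
Qed.

Lemma sum_visited t (vt : nat -> 'I_n) (F : 'I_n -> nat) :
  (forall i j, (i < t)%N -> (j < t)%N -> vt i = vt j -> i = j) ->
  (\sum_(j < t) F (vt j) <= \sum_v F v)%N.
Proof.
move=> inj; have -> : (\sum_(j < t) F (vt j) = \sum_(v in [set vt j | j : 'I_t]) F v)%N.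
  rewrite big_imset /=; first by apply: eq_bigl => j; rewrite inE.
  by move=> i j _ _ ij; apply/val_inj/(inj _ _ (ltn_ord i) (ltn_ord j)).
by rewrite big_mkcond; apply: leq_sum => v _; case: ifP.
Qed.

Lemma bfs_start : bfs_tree T c x1 1 (fun=> x1) (fun=> 0%N) (fun=> 0%N)
  (upd (fun=> 0%N) 1 (x1 : nat)) (fun=> 0).
Proof.
have n0 : (0 < n)%N by apply: leq_ltn_trans (ltn_ord x1).
by split=> //; try (by move=> *; lia); move=> [|j] // _; rewrite muln0 upd_eq.
Qed.

(** [last] is the end of the chain of children of [vt h]: the even node of the vertex visited last
    if that is a child of [vt h], and the node of [vt h] itself otherwise. *)
Lemma bfs_step t vt pi par rho wt h last u :
  bfs_tree T c x1 t vt pi par rho wt -> (h < t)%N ->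
  (forall j, (0 < j < t)%N -> (pi j <= h)%N) ->
  last = (if (1 < t)%N && (pi t.-1 == h) then 2 * t.-1 else 2 * h + 1)%N ->
  T (vt h) u -> (forall j, (j < t)%N -> vt j <> u) ->
  bfs_tree T c x1 t.+1 (upd vt t u) (upd pi t h)
    (upd (upd par (2 * t) last) (2 * t + 1) (2 * t)%N)
    (upd (upd rho (2 * t) (vt h : nat)) (2 * t + 1) (u : nat))
    (upd wt (2 * t + 1) (c (vt h) u)).
Proof.
move=> bt ht pi_le lastE Thu new; have t0 : (0 < t)%N by lia.
have inj i j : (i < t.+1)%N -> (j < t.+1)%N -> upd vt t u i = upd vt t u j -> i = j.
  rewrite !updE; have [->|it] := eqVneq i t; have [->|jt] := eqVneq j t => //.
  - by move=> _ jlt uE; case: (new j); rewrite ?uE //; lia.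
  - by move=> ilt _ uE; case: (new i); rewrite ?uE //; lia.
  - by move=> ilt jlt; apply: (bt_inj bt); lia.
have pi_lt j : (0 < j < t)%N -> (pi j < t)%N by move=> jt; have := bt_pi bt jt; lia.
split.
- by rewrite (visited_le inj).
- by rewrite upd_neq ?(bt_vt0 bt) //; lia.
- exact: inj.
- move=> j jt; have [->|jt'] := eqVneq j t; first by rewrite !upd_eq.
  by rewrite !upd_neq ?(bt_rho1 bt) //; lia.
- move=> j jt; have [->|jt'] := eqVneq j t.
    by rewrite upd_neq ?upd_eq; [rewrite upd_neq //; lia | lia].
  by rewrite [upd pi _ _ _]upd_neq // !upd_neq ?(bt_rho0 bt) //; try lia; have := pi_lt j; lia.
- by rewrite upd_neq ?(bt_pi0 bt) //; lia.
- move=> j jt; have [->|jt'] := eqVneq j t; first by rewrite !upd_eq.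
  by rewrite !upd_neq ?(bt_pi bt) //; lia.
- move=> j jt; have [->|jt'] := eqVneq j t.
    rewrite !upd_eq upd_neq; last by lia.
    by rewrite (tree_sym (instance_tree Tc)).
  by rewrite [upd pi _ _ _]upd_neq // !upd_neq ?(bt_edge bt) //; try lia; have := pi_lt j; lia.
- move=> i j ij jt; have [jE|jt'] := eqVneq j t.
    rewrite jE upd_eq updE; case: eqP => // it; apply: pi_le; lia.
  by rewrite !upd_neq ?(bt_mono bt) //; lia.
- by rewrite !upd_neq ?(bt_par0 bt) //; lia.
- by rewrite !upd_neq ?(bt_par1 bt) //; lia.
- move=> j jt; have [->|jt'] := eqVneq j t; first by rewrite !upd_eq.
  by rewrite !upd_neq ?(bt_par_odd bt) //; lia.
- move=> j jt; have [->|jt'] := eqVneq j t.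
    rewrite upd_neq ?upd_eq; last by lia.
    by rewrite [upd pi _ _ t.-1]upd_neq //; lia.
  by rewrite !upd_neq ?(bt_par_even bt) //; lia.
- by rewrite upd_neq ?(bt_wt1 bt) //; lia.
- by move=> j; rewrite upd_neq ?(bt_wt_even bt) //; lia.
move=> j jt; have [->|jt'] := eqVneq j t.
  by rewrite !upd_eq upd_neq //; lia.
rewrite [upd pi _ _ _]upd_neq // !upd_neq ?(bt_wt_odd bt) //; try lia.
by have := pi_lt j; lia.
Qed.

End BfsSteps.

(** Word variables 5 and 6 are the two ends of the queue, 7 is the vertex being scanned, 8 a
    position in its adjacency list, 9 the end of its chain of children, and 10 the neighbour found.
    The odd entries of array 7 serve as the queue. *)
Definition discover : cmd :=
  WPut 4 (WVar 10) #1 ;;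
  WSet 11 (WMul #2 (WVar 6)) ;;
  WPut 6 (WVar 11) (WVar 9) ;;
  WPut 7 (WVar 11) (WVar 7) ;;
  WPut 6 (WAdd (WVar 11) #1) (WVar 11) ;;
  WPut 7 (WAdd (WVar 11) #1) (WVar 10) ;;
  CPut 0 (WAdd (WVar 11) #1) (COracle (WVar 7) (WVar 10)) ;;
  WSet 9 (WVar 11) ;;
  WSet 6 (WAdd (WVar 6) #1).

Definition visit : cmd :=
  While (BWLt (WVar 8) (WGet 0 (WAdd (WVar 7) #1))) (
    WSet 10 (WGet 1 (WVar 8)) ;;
    If (BWEq (WGet 4 (WVar 10)) #0) discover Skip ;;
    WSet 8 (WAdd (WVar 8) #1)).

Definition bfs : cmd :=
  WPut 4 (WVar 2) #1 ;;
  WPut 7 #1 (WVar 2) ;;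
  WSet 5 #0 ;;
  WSet 6 #1 ;;
  While (BWLt (WVar 5) (WVar 6)) (
    WSet 9 (WAdd (WMul #2 (WVar 5)) #1) ;;
    WSet 7 (WGet 7 (WVar 9)) ;;
    WSet 8 (WGet 0 (WVar 7)) ;;
    visit ;;
    WSet 5 (WAdd (WVar 5) #1)).

Section Bfs.
Context {R : realType}.
Variables (W n : nat) (T : rel 'I_n) (c : 'I_n -> 'I_n -> R) (adj : 'I_n -> seq 'I_n).
Variables (x1 : 'I_n) (off tgt : nat -> nat).
Hypothesis Tc : metric_instance T c.
Hypothesis adjT : adjacency_lists T adj.
Hypothesis off_step : forall v : 'I_n, off v.+1 = (off v + size (adj v))%N.
Hypothesis tgt_off : forall (v : 'I_n) i, (i < size (adj v))%N -> tgt (off v + i) = nth x1 (adj v) i.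
Hypothesis off_lt : forall v : 'I_n, (off v.+1 < W)%N.
Hypothesis W_n : (4 * n + 10 < W)%N.

Record search h t (vt : nat -> 'I_n) (pi : nat -> nat) (s : state R) : Prop := Search {
  se_h : wvar s 5 = h;
  se_t : wvar s 6 = t;
  se_tree : bfs_tree T c x1 t vt pi (warr s 6) (warr s 7) (carr s 0);
  se_vis : forall j, (j < t)%N -> warr s 4 (vt j) <> 0%N;
  se_vt : forall u : 'I_n, warr s 4 u <> 0%N -> exists2 j, (j < t)%N & vt j = u;
  se_closed : forall j v, (j < h)%N -> T (vt j) v -> warr s 4 v <> 0%N }.

Lemma wp_discover h t vt pi last (u : 'I_n) (s : state R) B Q :
  search h t vt pi s -> (h < t)%N -> (forall j, (0 < j < t)%N -> (pi j <= h)%N) ->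
  wvar s 7 = vt h -> wvar s 10 = u -> wvar s 9 = last ->
  last = (if (1 < t)%N && (pi t.-1 == h) then 2 * t.-1 else 2 * h + 1)%N ->
  T (vt h) u -> warr s 4 u = 0%N -> (9 <= B)%N ->
  (forall s', search h t.+1 (upd vt t u) (upd pi t h) s' -> wvar s' 9 = (2 * t)%N ->
     (forall v, warr s 4 v <> 0%N -> warr s' 4 v <> 0%N) -> warr s' 4 u <> 0%N ->
     frame discover s s' -> Q (B - 9)%N s') ->
  wp W (oracle c) discover s B Q.
Proof.
move=> [Eh Et bt vis vis' closed] ht pi_le Ev Eu El lastE Thu u0 B9 post.
apply: wp_frame.
have new j : (j < t)%N -> vt j <> u by move=> /vis + jE; rewrite jE.
have bt' := bfs_step Tc bt ht pi_le lastE Thu new.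
have tn : (t < n)%N by have := bt_t bt'; lia.
have un := ltn_ord u; have vn := ltn_ord (vt h).
apply: wp_seq; wput; apply: wp_seq; wset; apply: wp_seq; wput; apply: wp_seq; wput.
apply: wp_seq; wput; apply: wp_seq; wput.
apply: wp_seq; apply: (@wp_cput _ _ _ _ _ _ (2 * t + 1)%N (c (vt h) u)).
- by ev.
- by lookup; rewrite /oracle !valK.
- by lia.
apply: wp_seq; wset; wset; rewrite -!subn1 -!subnDA; apply: post => //.
- split; lookup; rewrite ?addn1 //.
  + by rewrite !addn1 in bt'.
  + move=> j jt; rewrite !updE; case: (eqVneq j t) => [_|jt']; first by rewrite eqxx.
    by case: ifP => // _; apply: vis; lia.
  + move=> v; rewrite updE; case: (eqVneq (v : nat) u) => [/val_inj-> _|_ /vis'[j jt jE]].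
      by exists t; rewrite ?upd_eq.
    by exists j; [lia | rewrite upd_neq //; lia].
  move=> j v jh; rewrite upd_neq; last by lia.
  by rewrite updE; case: ifP => // _; apply: closed.
- by move=> v v0; lookup; rewrite updE; case: ifP.
- by lookup; rewrite upd_eq.
Qed.
Definition chain h t (pi : nat -> nat) :=
  (if (1 < t)%N && (pi t.-1 == h) then 2 * t.-1 else 2 * h + 1)%N.

Record visiting h v i t vt pi (s : state R) : Prop := Visiting {
  vi_search : search h t vt pi s;
  vi_h : (h < t)%N;
  vi_v : vt h = v;
  vi_pi : forall j, (0 < j < t)%N -> (pi j <= h)%N;
  vi_i : (i <= size (adj v))%N;
  vi_e : wvar s 8 = (off v + i)%N;
  vi_last : wvar s 9 = chain h t pi;
  vi_seen : forall l, (l < i)%N -> warr s 4 (nth x1 (adj v) l) <> 0%N }.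

Lemma wp_visit h t vt pi v (s : state R) B Q :
  visiting h v 0 t vt pi s -> wvar s 7 = v -> warr s 0 = off -> warr s 1 = tgt ->
  (14 * size (adj v) + 1 <= B)%N ->
  (forall B' s' t' vt' pi', (B <= B' + 14 * size (adj v) + 1)%N ->
     frame visit s s' -> visiting h v (size (adj v)) t' vt' pi' s' ->
     (forall j, (j < t)%N -> vt' j = vt j) -> Q B' s') ->
  wp W (oracle c) visit s B Q.
Proof.
move=> vi Ev Eoff Etgt B_ge post; apply: wp_frame.
pose I B' (s' : state R) := exists i t' vt' pi', [/\ visiting h v i t' vt' pi' s',
  (t <= t')%N, forall j, (j < t)%N -> vt' j = vt j & (B <= B' + 14 * i)%N].
apply: (wp_while (I := I)); first by exists 0%N, t, vt, pi; split=> //; lia.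
move=> B' s' [i [t' [vt' [pi' [vi' tt' old leB]]]]] Fr.
have {}Ev : wvar s' 7 = v by framed Fr.
have Eoff' : warr s' 0 = off by framed Fr.
have Etgt' : warr s' 1 = tgt by framed Fr.
have [se ht vtv pi_le iv Ee El seen] := vi'.
split; first by have := vi_i vi'; lia.
have vn := ltn_ord v; have offv := off_lt v; have offE := off_step v.
lookup; rewrite Eoff' (@modn_small 1); last by lia.
rewrite (@modn_small (v + 1)); last by lia.
rewrite addn1 offE ltn_add2l; case: ifP => i_lt; last first.
  have iE : i = size (adj v) by lia.
  rewrite iE in vi' leB; move=> fr; apply: post fr vi' old; lia.
apply: wp_seq; apply: wp_wset; [by lookup; rewrite Etgt' tgt_off // | by lia |].
set u := nth x1 (adj v) i.
have Tvu : T v u.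
  have : u \in adj v by apply: mem_nth.
  by rewrite (perm_mem (adjT v)) mem_enum.
pose s1 := set_wvar s' 10 u; rewrite -/s1.
have se1 : search h t' vt' pi' s1 by case: se => *; split.
have next B1 s2 t2 vt2 pi2 : search h t2 vt2 pi2 s2 -> (t' <= t2)%N -> (h < t2)%N ->
    (forall j, (j < t')%N -> vt2 j = vt' j) -> (forall j, (0 < j < t2)%N -> (pi2 j <= h)%N) ->
    wvar s2 8 = (off v + i)%N -> wvar s2 9 = chain h t2 pi2 ->
    (forall w, warr s1 4 w <> 0%N -> warr s2 4 w <> 0%N) -> warr s2 4 u <> 0%N ->
    (B' <= B1 + 13)%N -> (0 < B1)%N ->
    wp W (oracle c) (WSet 8 (WAdd (WVar 8) #1)) s2 B1 I.
  move=> se2 tt2 ht2 old2 pi2_le Ee2 El2 mono u2 leB1 B10.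
  wset; exists i.+1, t2, vt2, pi2; split; [split=> //|by lia| |by lia].
  - by case: se2 => *; split.
  - by rewrite old2.
  - by lookup; lia.
  - move=> l; rewrite ltnS leq_eqVlt => /orP[/eqP->|li] //.
    by lookup; apply: mono; apply: seen.
  by move=> j jt; rewrite old2 ?old //; lia.
apply: wp_seq; wif => [/eqP u0|/eqP u_neq0].
  apply: (wp_discover (last := chain h t' pi') se1) => //; [by rewrite vtv | by rewrite vtv | by lia |].
  move=> s2 se2 El2 mono u2 fr; apply: (next _ _ _ _ _ se2) => //; try lia.
  - by move=> j jt; rewrite upd_neq //; lia.
  - move=> j jt; rewrite updE; case: eqP => // jt'; apply: pi_le; lia.
  - by framed fr.
  by rewrite El2 /chain upd_eq eqxx (_ : (1 < t'.+1)%N); [|lia].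
apply: wp_skip; first by lia.
by apply: (next _ _ _ _ _ se1) => //; lia.
Qed.

Lemma search_complete t vt pi (s : state R) : search t t vt pi s -> t = n.
Proof.
move=> se; have inj := bt_inj (se_tree se); have := visited_le inj.
have t0 : (0 < t)%N by have := bt_t (se_tree se); lia.
have all_visited u : exists2 j, (j < t)%N & vt j = u.
  have /connectP[p Tp ->] := tree_connected (instance_tree Tc) (vt 0%N) u.
  have : exists2 j, (j < t)%N & vt j = vt 0%N by exists 0%N.
  elim: p (vt 0%N) Tp => [|v p IHp] w //= /andP[Twv Tp] [j jt jw].
  by apply: IHp Tp _; apply: (se_vt se); apply: (se_closed se jt); rewrite jw.
have : (#|[set: 'I_n]| <= #|[set vt j | j : 'I_t]|)%N.
  apply/subset_leq_card/subsetP => u _; have [j jt <-] := all_visited u.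
  by apply/imsetP; exists (Ordinal jt).
have := leq_imset_card (fun j : 'I_t => vt j) 'I_t; rewrite cardsT !card_ord.
by move=> le_t n_le tn; apply/anti_leq; rewrite tn (leq_trans n_le le_t).
Qed.

Lemma wp_bfs (s : state R) B Q :
  wvar s 2 = x1 -> warr s 0 = off -> warr s 1 = tgt -> warr s 4 = (fun=> 0%N) ->
  warr s 6 = (fun=> 0%N) -> warr s 7 = (fun=> 0%N) -> carr s 0 = (fun=> 0) ->
  (14 * (\sum_v size (adj v)) + 8 * n + 10 <= B)%N ->
  (forall B' s' vt pi, (B <= B' + (14 * (\sum_v size (adj v)) + 8 * n + 10))%N ->
     frame bfs s s' ->
     bfs_tree T c x1 n vt pi (warr s' 6) (warr s' 7) (carr s' 0) -> Q B' s') ->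
  wp W (oracle c) bfs s B Q.
Proof.
have le_total t vt := @sum_visited n t vt (fun v => size (adj v)).
move: (\sum_v size (adj v))%N le_total => total le_total.
move=> E2 Eoff Etgt E4 E6 E7 Ec0 B_ge post; apply: wp_frame.
apply: wp_seq; wput; apply: wp_seq; wput; apply: wp_seq; wset; apply: wp_seq; wset.
pose I B' (s' : state R) := exists h t vt pi, [/\ search h t vt pi s', (h <= t)%N,
  forall j, (0 < j < t)%N -> (pi j < h)%N &
  (B <= B' + 14 * (\sum_(j < h) size (adj (vt j))) + 8 * h + 4)%N].
apply: (wp_while (I := I)).
  exists 0%N, 1%N, (fun=> x1), (fun=> 0%N); split=> //; try (by lia).
  split; lookup; rewrite ?E4 ?E6 ?E7 ?Ec0 //.
  + exact: bfs_start.
  + by move=> j _; rewrite upd_eq.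
  by move=> u; rewrite updE; case: (eqVneq (u : nat) x1) => // /val_inj<- _; exists 0%N.
move=> B' s' [h [t [vt [pi [se ht pi_lt leB]]]]] Fr.
have Eoff' : warr s' 0 = off by framed Fr; lookup.
have Etgt' : warr s' 1 = tgt by framed Fr; lookup.
have [Eh Et bt _ _ _] := se.
have tn := bt_t bt; have sum_t := le_total _ _ (bt_inj bt).
have sum_h i : (i <= t)%N -> (\sum_(j < i) size (adj (vt j)) <= total)%N.
  by move=> it; apply: le_total => a b ai bi; apply: (bt_inj bt); lia.
split; first by have := sum_h _ ht; lia.
lookup; case: ifP => ht'; last first.
  have tE : h = t by lia.
  rewrite tE in se; have tn' := search_complete se; rewrite tn' in bt.
  by move=> fr; apply: post fr bt; have := sum_h _ ht; lia.
have := sum_h _ ht'; rewrite big_ord_recr /=; move E : (\sum_(j < h) _)%N leB => done_h leB sum_h1.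
apply: wp_seq; wset; apply: wp_seq; apply: wp_wset; [by lookup; rewrite (bt_rho1 bt) // | by lia |].
apply: wp_seq; apply: wp_wset; [by lookup; rewrite Eoff' | by lia |].
apply: wp_seq; apply: (wp_visit (v := vt h) (h := h) (t := t) (vt := vt) (pi := pi)) => //.
- split=> //; lookup; rewrite ?addn0 //.
  + by case: se => *; split.
  + by move=> j /pi_lt; lia.
  (* No visited vertex has parent [h] yet, so the chain is still empty. *)
  by rewrite /chain; case: ifP => // /andP[t1 /eqP piE]; have := pi_lt t.-1; lia.
- by lia.
move=> B2 s2 t2 vt2 pi2 leB2 fr [se2 ht2 vt2h pi2_le _ _ _ seen] old.
have [Eh2 Et2 bt2 vis2 vis2' closed2] := se2; have tn2 := bt_t bt2.
wset; exists h.+1, t2, vt2, pi2; split=> //; last first.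
  rewrite big_ord_recr /= vt2h (eq_bigr (fun j : 'I_h => size (adj (vt j)))) ?E; last first.
    by move=> j _; rewrite old //; have := ltn_ord j; lia.
  lia.
split; lookup => //; first by lia.
move=> j v; rewrite ltnS leq_eqVlt => /orP[/eqP->|jh]; last exact: closed2.
rewrite vt2h => Tv; have v_adj : v \in adj (vt h) by rewrite (perm_mem (adjT _)) mem_enum.
by rewrite -(nth_index x1 v_adj); apply: seen; rewrite index_mem.
Qed.

End Bfs.

(** * The algorithm *)

Section Input.
Context {R : realType}.
Variables (n k : nat) (adj : 'I_n -> seq 'I_n) (x1 : 'I_n).

Let s0 := input_state R k adj x1.
Let degrees := [seq size (adj v) | v <- enum 'I_n].

Let shapeE : shape [seq adj v | v <- enum 'I_n] = degrees.
Proof. by rewrite /shape -map_comp. Qed.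

Let nth_degrees (v : 'I_n) : nth 0%N degrees v = size (adj v).
Proof. by rewrite (nth_map v) ?nth_ord_enum // size_enum_ord. Qed.

Let offE i : (i <= n)%N -> warr s0 0 i = sumn (take i degrees).
Proof.
move=> iN.
rewrite -[warr s0 0 i]/(nth 0%N [seq sumn (take j (shape [seq adj v | v <- enum 'I_n])) |
  j <- iota 0 n.+1] i).
by rewrite (nth_map 0%N) ?size_iota // nth_iota // shapeE.
Qed.

Lemma input_off_step (v : 'I_n) : warr s0 0 v.+1 = (warr s0 0 v + size (adj v))%N.
Proof.
rewrite !offE ?(ltnW (ltn_ord v)) // (take_nth 0%N) ?sumn_rcons ?nth_degrees //.
by rewrite size_map size_enum_ord.
Qed.

Lemma input_off_le (v : 'I_n) : (warr s0 0 v.+1 <= \sum_v size (adj v))%N.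
Proof.
have <- : sumn degrees = (\sum_v size (adj v))%N by rewrite sumnE big_map big_enum.
by rewrite offE // -{2}(cat_take_drop v.+1 degrees) sumn_cat leq_addr.
Qed.

Lemma input_tgt (v : 'I_n) i : (i < size (adj v))%N ->
  warr s0 1 (warr s0 0 v + i) = nth x1 (adj v) i.
Proof.
move=> iv; rewrite offE ?(ltnW (ltn_ord v)) //= -[X in nth _ _ X]/(flatten_index degrees v i).
have iv' : (i < nth 0 degrees v)%N by rewrite nth_degrees.
rewrite (nth_map x1) ?size_flatten ?shapeE ?flatten_indexP // nth_flatten shapeE.
rewrite flatten_indexKl ?flatten_indexKr // (nth_map v) ?nth_ord_enum //.
by rewrite size_enum_ord.
Qed.

End Input.

(** The piece size [(k + 1) * (L + 1)] balances two costs: it is large enough for full paths, at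
    O(L) steps each, to cost O(n) over [k] rounds, and small enough for rescanning a cut path in
    every round to cost O(k^2 L). *)
Definition sizes : cmd :=
  WSet 5 (WVar 0) ;;
  While (BWLt #0 (WVar 5)) (
    WSet 5 (WDiv (WVar 5) #2) ;;
    WSet 3 (WAdd (WVar 3) #1)) ;;
  WSet 4 (WMul (WAdd (WVar 1) #1) (WAdd (WVar 3) #1)).

Lemma wp_sizes {R : realType} W (orc : nat -> nat -> R) n k (s : state R) T Q :
  (0 < n)%N -> ((k + 1) * (2 * n + 1) + 4 * n + 10 < W)%N ->
  wvar s 0 = n -> wvar s 1 = k -> wvar s 3 = 0%N -> (6 * n + 10 <= T)%N ->
  (forall T' s' L, (T <= T' + (6 * n + 10))%N -> frame sizes s s' ->
     (n < 2 ^ L <= 2 * n)%N -> wvar s' 4 = ((k + 1) * (L + 1))%N -> Q T' s') ->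
  wp W orc sizes s T Q.
Proof.
move=> n_gt0 W_gt En Ek E3 leT post; apply: wp_frame.
apply: wp_seq; wset; apply: wp_seq.
pose I T' (s' : state R) := exists q L, [/\ wvar s' 5 = q, wvar s' 3 = L,
  (q * 2 ^ L <= n < q.+1 * 2 ^ L)%N, (2 ^ L <= 2 * n)%N & (T <= T' + 3 * L + 1)%N].
apply: (wp_while (I := I)); first by exists n, 0%N; lookup; split=> //; lia.
move=> T' s' [q [L [Eq EL qL L2 leT']]] Fr.
have Ln : (L < 2 * n)%N by apply: leq_trans L2; apply: ltn_expl.
have kL : ((k + 1) * (L + 1) <= (k + 1) * (2 * n + 1))%N by rewrite leq_mul2l; lia.
have kW : (k + 1 <= (k + 1) * (2 * n + 1))%N by rewrite leq_pmulr // addn1.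
have Ek' : wvar s' 1 = k by framed Fr; lookup.
split; first by lia.
ev; case: ifP => q0.
  apply: wp_seq; wset; wset; exists (q %/ 2)%N, (L + 1)%N; lookup.
  have q_eq := divn_eq q 2; have q_mod : (q %% 2 < 2)%N by rewrite ltn_mod.
  move: (q %/ 2)%N (q %% 2)%N q_eq q_mod => q' r q_eq r2.
  rewrite expnD expn1; move: (2 ^ L)%N qL L2 => P qL L2.
  by split=> //; [nia | nia | lia].
move: kL; move E : ((k + 1) * (L + 1))%N => S kL.
apply: wp_wset; [by ev; rewrite E | by lia |].
move=> fr; apply: (post _ _ L) => //; lia.
Qed.

(** Squaring the hypothesis gives [k ^ 2 * ln n <= a ^ 2 * n], and [L + 1] is at most
    [3 * ln n / ln 2]; this is the origin of the constant [3 * a ^ 2 / ln 2]. *)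
Lemma sqrt_budget {R : realType} (a : R) : exists A : nat, forall n k L,
  k%:R <= a * Num.sqrt (n%:R / ln (n%:R : R)) -> (0 < n)%N -> (2 ^ L <= 2 * n)%N ->
  (k * k * (L + 1) <= A * n)%N.
Proof.
have ln2 : 0 < ln (2 : R) by rewrite ln_gt0 // ltr1n.
pose A := 3 * a ^+ 2 / ln (2 : R).
have A_ge0 : 0 <= A by apply: divr_ge0 (ltW ln2); rewrite mulr_ge0 ?sqr_ge0.
exists (Num.bound A) => n k L kle n_gt0 L2.
(* For [n = 1] the logarithm is 0 and the inverse of 0 is 0, so the hypothesis forces [k = 0]. *)
have [n1|n_gt1] := leqP n 1.
  have n1' : n = 1%N by lia.
  move: kle; rewrite n1' ln1 invr0 mulr0 sqrtr0 mulr0 -[0]/(0%:R) ler_nat; lia.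
have nR : 1 < n%:R :> R by rewrite ltr1n.
have ln_n : 0 < ln (n%:R : R) by rewrite ln_gt0.
have k2 : k%:R ^+ 2 * ln (n%:R : R) <= a ^+ 2 * n%:R.
  have q_ge0 : 0 <= n%:R / ln (n%:R : R) by rewrite divr_ge0 // ltW.
  rewrite -ler_pdivlMr // -mulrA -[X in _ <= _ * X]sqr_sqrtr // -exprMn.
  by rewrite lerXn2r // nnegrE ?(le_trans _ kle) ?ler0n.
(* From [2 ^ L <= 2 * n] one gets [L * ln 2 <= ln 2 + ln n]; add [ln 2] and use [ln 2 <= ln n]
   twice. *)
have Lln : (L + 1)%:R * ln (2 : R) <= 3 * ln (n%:R : R).
  have ln2n : ln (2 : R) <= ln n%:R by rewrite ler_ln ?posrE ?ltr0n ?ler_nat.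
  have : ln ((2 : R) ^+ L) <= ln (2 * n%:R).
    by rewrite ler_ln ?posrE ?exprn_gt0 ?mulr_gt0 ?ltr0n // -natrX -natrM ler_nat.
  rewrite lnXn // lnM ?posrE ?ltr0n // -[ln 2 *+ L]mulr_natl natrD mulrDl mul1r.
  by move: (L%:R * _) => X Lle; lra.
rewrite -(ler_nat R) natrM !natrM.
apply: (@le_trans _ _ (A * n%:R)); last first.
  by rewrite ler_wpM2r // ltW // archi_boundP.
rewrite /A [X in _ <= X]mulrAC ler_pdivlMr // -expr2 -mulrA.
apply: le_trans (ler_wpM2l (sqr_ge0 _) Lln) _.
by rewrite mulrCA -[X in _ <= X]mulrA ler_wpM2l.
Qed.

(** * From selected nodes back to vertices *)

Section Picks.
Context {R : realType}.
Variables (n : nat) (T : rel 'I_n) (c : 'I_n -> 'I_n -> R) (x1 : 'I_n).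
Variables (vt : nat -> 'I_n) (pi par rho : nat -> nat) (wt : nat -> R).
Hypothesis bt : bfs_tree T c x1 n vt pi par rho wt.

Local Notation D := (node_dist T c x1 rho).
Local Notation N := (2 * n - 1)%N.

Lemma loc1 : loc x1 rho 1 = x1.
Proof. by rewrite -[1%N]/(2 * 0 + 1)%N (loc_odd bt) ?(bt_vt0 bt) //; have := bt_t bt; lia. Qed.

Lemma val_loc z : (0 < z <= N)%N -> loc x1 rho z = rho z :> nat.
Proof.
move=> zN; have [[j jn ->]|[j jn ->]] := node_cases zN.
  by rewrite (loc_odd bt) // (bt_rho1 bt).
by rewrite (loc_even bt) // (bt_rho0 bt).
Qed.

Variables (k : nat) (ys : seq nat).
Hypothesis ys_size : size ys = k.

Definition picks (l : 'I_k.+1) : 'I_n := loc x1 rho (nth 0%N (1%N :: ys) l).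

(** The root precedes [ys] in the list of picks, so the first [i] picks are the root and the first
    [i.-1] entries of [ys]. *)
Lemma dist_to_first_picks i z : (0 < i <= k.+1)%N ->
  dist_to_first T c picks i (loc x1 rho z) = near D (take i.-1 ys) z.
Proof.
move=> ik; apply/le_anti/andP; split.
  have [->|[y]] := near_attained D (take i.-1 ys) z; first exact: bigmin_le_id.
  move=> /(nthP 0%N)[j]; rewrite size_take_min leq_min => /andP[ji jk] <- ->.
  have jk' : (j.+1 < k.+1)%N by rewrite -ys_size.
  rewrite nth_take // -[D _ _]/(dist T c (loc x1 rho z) (picks (Ordinal jk'))).
  by apply: bigmin_le_cond => /=; lia.
apply: le_bigmin => [|[[|l] lk] /= li]; [exact: near_le1 | exact: near_le1 |].
rewrite -[dist _ _ _ _]/(D z (nth 0%N ys l)); apply: near_le.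
rewrite -(nth_take 0%N (n0 := i.-1)); last by lia.
by apply: mem_nth; rewrite size_take_min leq_min ys_size; lia.
Qed.

Lemma gonzalez_picks : greedy N D ys -> gonzalez T c picks.
Proof.
move=> gr i i0 v; have [j jn <-] := vt_surj bt v.
have ik := ltn_ord i.
rewrite -(loc_odd bt jn) [picks i]/picks !dist_to_first_picks; try lia.
by case: (nat_of_ord i) i0 ik => // l _ lk /=; apply: gr; lia.
Qed.

End Picks.

Definition gonzalez_star : cmd := sizes ;; bfs ;; heights ;; rounds.

(** Full paths cost at most [160 * n] because [k * (L + 1) <= S] and the quotient times [S] is at
    most [2 * n]. The other [2 * k + 1] paths, the rescans with [k * S <= 2 * X], and the constant
    per round are all O(X). Finally [446 = 160 + 176 + 110]. *)
Lemma rounds_budget n k L X S : (0 < n)%N -> S = ((k + 1) * (L + 1))%N ->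
  (k * k * (L + 1) <= X)%N ->
  (k * ((2 * n %/ S + (2 * k + 1)) * (6 * (L + 2) + 68) + 40 * S + 301) + 88 * (2 * n) + 110
    <= 446 * n + 861 * X)%N.
Proof.
move=> n_gt0 SE kA.
have [->|k_gt0] := posnP k; first by nia.
have divS := leq_trunc_div (2 * n) S; move: (2 * n %/ S)%N divS => q divS.
have kS : (k * (L + 1) <= S)%N by rewrite SE; nia.
have S2 : (k * S <= 2 * X)%N by rewrite SE; nia.
have kk : (k <= X)%N by nia.
have qS : (k * (q * (6 * (L + 2) + 68)) <= 80 * (2 * n))%N.
  by apply: leq_trans (leq_mul (leqnn 80) divS); nia.
have kk6 : (k * ((2 * k + 1) * (6 * (L + 2) + 68)) <= 240 * X)%N by nia.
nia.
Qed.

(** The base [n + k + 2] is at least 3, whence [81 = 3 ^ 4]. The second bound covers the piece size,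
    the third the offsets of the adjacency lists, whose total length is at most [n * n]. *)
Lemma word_bound_large n k : (0 < n)%N ->
  [/\ (81 <= word_bound n k 4)%N, ((k + 1) * (2 * n + 1) + 4 * n + 10 < word_bound n k 4)%N
    & (n * n + k.+1 < word_bound n k 4)%N].
Proof.
move=> n_gt0; rewrite /word_bound; move Ex : (n + k + 2)%N => x.
have -> : (x ^ 4 = x * x * (x * x))%N by rewrite !expnS expn0; lia.
have x9 : (9 <= x * x)%N by nia.
have nx : (n * n + 2 * n <= x * x)%N by nia.
have kn : ((k + 1) * (2 * n + 1) <= 2 * (x * x))%N by nia.
have kx : (k + n + 2 <= x * x)%N by nia.
move: (x * x)%N x9 nx kn kx => y *; split; nia.
Qed.

(** The degree sum stays in the budget, and its bound is part of the postcondition, because that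
    bound is read off the search tree that the run itself produces. The other terms add up as
    [480 = 6 + 8 + 20 + 446]. *)
Lemma wp_gonzalez_star {R : realType} (n k X : nat) (T : rel 'I_n) (c : 'I_n -> 'I_n -> R)
    (adj : 'I_n -> seq 'I_n) (x1 : 'I_n) :
  metric_instance T c -> adjacency_lists T adj ->
  (forall L, (2 ^ L <= 2 * n)%N -> (k * k * (L + 1) <= X)%N) ->
  wp (word_bound n k 4) (oracle c) gonzalez_star (input_state R k adj x1)
    (14 * (\sum_v size (adj v)) + 480 * n + 861 * X + 40)
    (fun _ s' => (\sum_v size (adj v) <= 2 * n)%N /\
       exists x : 'I_k.+1 -> 'I_n, [/\ x ord0 = x1, gonzalez T c x & outputs s' x]).
Proof.
move=> Tc adjT kA.
have n_gt0 : (0 < n)%N by apply: leq_ltn_trans (ltn_ord x1).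
have sizeE v : size (adj v) = #|[pred w | T v w]| by rewrite (perm_size (adjT v)) cardE.
have total_le : (\sum_v size (adj v) <= n * n)%N.
  have -> : (n * n = \sum_(v < n) n)%N by rewrite sum_nat_const card_ord.
  by apply: leq_sum => v _; rewrite sizeE; apply: leq_trans (max_card _) _; rewrite card_ord.
have off_le (v : 'I_n) := @input_off_le R n k adj x1 v.
have off_step (v : 'I_n) := @input_off_step R n k adj x1 v.
have tgtE (v : 'I_n) i := @input_tgt R n k adj x1 v i.
move E0 : (input_state R k adj x1) => s0.
have [W81 WkL Wnk] := word_bound_large k n_gt0; move: (word_bound n k 4) W81 WkL Wnk => W W81 WkL Wnk.
have Wn : (4 * n + 10 < W)%N by lia.
have arr0 a : (2 <= a)%N -> warr s0 a = (fun=> 0%N).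
  by rewrite -E0; case: a => [|[|a]] // _; apply: boolp.funext => i /=; rewrite !nth_nil.
have carr0 a : carr s0 a = (fun=> 0) by rewrite -E0.
have wv0 : wvar s0 0 = n by rewrite -E0.
have wv1 : wvar s0 1 = k by rewrite -E0.
have wv2 : wvar s0 2 = x1 by rewrite -E0.
have wv3 : wvar s0 3 = 0%N by rewrite -E0.
rewrite E0 in off_step tgtE off_le.
have run_bfs := @wp_bfs R W n T c adj x1 (warr s0 0) (warr s0 1) Tc adjT off_step tgtE.
move Et : (\sum_v size (adj v))%N total_le off_le run_bfs => total total_le off_le run_bfs.
have off_lt (v : 'I_n) : (warr s0 0 v.+1 < W)%N by have := off_le v; lia.
apply: wp_seq; apply: (wp_sizes _ n_gt0 WkL) => //; first by lia.
move=> T1 s1 L leT1 fr1 nL S1; have kAL := kA L ltac:(lia).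
apply: wp_seq; apply: (run_bfs off_lt Wn s1); try (by framed fr1);
  try (by framed fr1; rewrite ?arr0 ?carr0); first by lia.
move=> T2 s2 vt pi leT2 fr2 bt.
have tm := bfs_metric Tc bt; have wt1 := bt_wt1 bt.
apply: wp_seq; apply: (wp_heights _ n_gt0 W81 Wn (par_lt tm) (@bfs_binary _ _ _ _ _ _ _ _ _ _ bt)) => //;
  try (by framed fr2; framed fr1; rewrite ?arr0 ?carr0); first by lia.
move=> T3 s3 leT3 fr3 lcs.
pose S := ((k + 1) * (L + 1))%N.
have Ln : (L < 2 * n)%N by apply: (@leq_trans (2 ^ L)); [apply: ltn_expl | lia].
have S_le : (S <= (k + 1) * (2 * n + 1))%N by rewrite leq_mul2l; lia.
have S_gt0 : (0 < S)%N by rewrite /S muln_gt0; lia.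
have budget := rounds_budget n_gt0 (erefl S) kAL.
have N1 : (2 * n - 1).+1 = (2 * n)%N by lia.
have N_gt0 : (0 < 2 * n - 1)%N by lia.
have W_NS : (2 * (2 * n - 1) + S + 10 < W)%N by lia.
(* From [n < 2 ^ L] follows [2 * (2 * n - 1) < 2 ^ (L + 2)], so [L + 2] halvings suffice for every
   bisection. *)
apply: (wp_rounds (oracle c) tm lcs wt1 N_gt0 W81 W_NS S_gt0 (k := k) (m := L + 2)
  (M := 2 * n %/ S + (2 * k + 1))) => //; try (by lia);
  try (by framed fr3; framed fr2; framed fr1; rewrite ?arr0 ?carr0).
- by split=> //; framed fr3; framed fr2.
- by rewrite expnD; lia.
- move=> p; rewrite N1 => pS.
  rewrite addnC -leq_subLR leq_divRL // mulnBl; lia.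
move=> T4 s4 ys ys_size gr ysN out; split.
  by rewrite -Et (eq_bigr _ (fun v _ => sizeE v)); apply: (sum_degrees Tc bt).
exists (@picks n x1 (warr s2 7) k ys); split.
- by rewrite /picks /= (loc1 bt).
- exact: (gonzalez_picks bt ys_size gr).
move=> l l0; have lk := ltn_ord l; have [|-> ->] := out l.-1; first by lia.
have y_ys : nth 0%N ys l.-1 \in ys by apply: mem_nth; rewrite ys_size; lia.
have wv2' : wvar s3 2 = x1 by framed fr3; framed fr2; framed fr1.
have w7 : warr s3 7 = warr s2 7 by framed fr3.
split; first by rewrite wv2' /picks /= (loc1 bt).
rewrite w7 /picks; case: (nat_of_ord l) l0 y_ys => // l' _ y_ys /=.
by rewrite (val_loc bt) // ysN.
Qed.

Theorem theorem3 (R : realType) :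
  (exists (P : cmd) (b : nat), forall a : R, exists C : nat,
     forall (n k : nat) (T : rel 'I_n) (c : 'I_n -> 'I_n -> R)
            (adj : 'I_n -> seq 'I_n) (x1 : 'I_n),
       metric_instance T c ->
       k%:R <= a * Num.sqrt (n%:R / ln (n%:R : R)) ->
       adjacency_lists T adj ->
       exists (t : nat) (s : state R) (x : 'I_k.+1 -> 'I_n),
         [/\ exec (word_bound n k b) (oracle c) P (input_state R k adj x1) t s,
             (t <= C * n)%N,
             x ord0 = x1,
             gonzalez T c x
           & outputs s x])
  /\
  (forall (a : R) (n k : nat) (T : rel 'I_n) (c : 'I_n -> 'I_n -> R)
          (x : 'I_k.+1 -> 'I_n) (Sopt : {set {set 'I_n}}),
     metric_instance T c ->
     k%:R <= a * Num.sqrt (n%:R / ln (n%:R : R)) ->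
     gonzalez T c x ->
     optimal T c k Sopt ->
     [/\ shortcuts (star x),
         (#|star x| <= k)%N
       & diam (augment T (star x)) c <= 4 * diam (augment T Sopt) c]).
Proof.
split; last first.
  move=> a n k T c x Sopt Tc _ gonz [feas _].
  by split; [apply: star_shortcuts | apply: card_star | apply: star_approximation].
exists gonzalez_star, 4%N => a; have [A kA] := sqrt_budget a.
(* [548 = 28 + 480 + 40]: the degree sum is at most [2 * n], and the additive 40 is absorbed by
   [1 <= n]. *)
exists (548 + 861 * A)%N => n k T c adj x1 Tc kle adjT.
have n_gt0 : (0 < n)%N by apply: leq_ltn_trans (ltn_ord x1).
have [|t [s [run t_le [total_le [x [x0 gonz out]]]]]] :=
  @wp_gonzalez_star R n k (A * n) T c adj x1 Tc adjT; first by move=> L; apply: kA.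
exists t, s, x; split=> //; apply: leq_trans t_le _.
by rewrite mulnDl -mulnA; move: (A * n)%N => X; lia.
Qed.
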